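(* Let $N\ge 1$ be an integer, $s\in(0,1)$, and let $\varphi:(0,\infty)\to(0,\infty)$ be a $C^1$ function, with $t\mapsto t\varphi(t)$ twice differentiable, such that: $t\varphi(t)\to 0$ as $t\to 0$ and $t\varphi(t)\to\infty$ as $t\to\infty$; $t\mapsto t\varphi(t)$ is strictly increasing on $(0,\infty)$; $-1<\ell-2:=\inf_{t>0}\frac{(t\varphi(t))''t}{(t\varphi(t))'}\le\sup_{t>0}\frac{(t\varphi(t))''t}{(t\varphi(t))'}=:m-2<\infty$; and, with $\Phi(t)=\int_0^{|t|}\tau\varphi(\tau)\,d\tau$, $\int_0^1\left(\frac{t}{\Phi(t)}\right)^{\frac{s}{N-s}}dt<\infty$ and $\int_1^\infty\left(\frac{t}{\Phi(t)}\right)^{\frac{s}{N-s}}dt=\infty$. Let $q,p$ satisfy $\ell\le m<q<p<\ell_s^*:=\frac{N\ell}{N-\ell s}$ and $m(q-\ell)<p(q-m)$. Let $a:\mathbb{R}^N\to\mathbb{R}$ be measurable with $a\in L^{p/(p-q)}(\mathbb{R}^N)$ and $a>0$ a.e. Let $V:\mathbb{R}^N\to\mathbb{R}$ be continuous, with $V\ge V_0$ on $\mathbb{R}^N$ for some constant $V_0>0$, and such that for each $M>0$ the set $\{x:V(x)\le M\}$ has finite Lebesgue measure. Fix $\lambda>0$ and, for $\mu>\mu_n(\lambda)$, let $u_{\lambda,\mu}\in\mathcal{N}^-_{\lambda,\mu}$ and $v_{\lambda,\mu}\in\mathcal{N}^+_{\lambda,\mu}$ be weak solutions of $$(-\Delta_\Phi)^su+V(x)\varphi(|u|)u=\mu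 a(x)|u|^{q-2}u-\lambda|u|^{p-2}u\ \text{ in }\mathbb{R}^N,\qquad u\in W^{s,\Phi}(\mathbb{R}^N),$$ with $\mathcal{I}_{\lambda,\mu}(u_{\lambda,\mu})=\mathcal{E}^-_{\lambda,\mu}$ and $\mathcal{I}_{\lambda,\mu}(v_{\lambda,\mu})=\mathcal{E}^+_{\lambda,\mu}$. Then: (i) $u_{\lambda,\mu}\to0$ in $X$ as $\mu\to+\infty$; in particular, $\mathcal{E}^-_{\lambda,\mu}\to0$ as $\mu\to+\infty$; (ii) $\|v_{\lambda,\mu}\|\to+\infty$ as $\mu\to+\infty$.
   Context: Notation. $D_su(x,y)=\frac{u(x)-u(y)}{|x-y|^s}$ and $d\nu=\frac{dx\,dy}{|x-y|^N}$ on $\mathbb{R}^N\times\mathbb{R}^N$. $W^{s,\Phi}(\mathbb{R}^N)$ is the fractional Orlicz–Sobolev space of functions $u\in L^\Phi(\mathbb{R}^N)$ (Orlicz space) with $\iint\Phi(D_su/\kappa)\,d\nu<\infty$ for some $\kappa>0$. Put $X=\{u\in W^{s,\Phi}(\mathbb{R}^N):\int V\Phi(u)\,dx<\infty\}$, $\mathcal{J}(u)=\iint\Phi(D_su)\,d\nu+\int V\Phi(u)\,dx$, with norm $\|u\|=\inf\{\kappa>0:\mathcal{J}(u/\kappa)\le1\}$ on $X$. Its derivative is $\mathcal{J}'(u)v=\iint\varphi(|D_su|)D_su\,D_sv\,d\nu+\int V\varphi(|u|)uv\,dx$ (integrands are $0$ where the argument of $\varphi$ is $0$). $(-\Delta_\Phi)^su(x)=\mathrm{p.v.}\int_{\mathbb{R}^N}\varphi(|D_su(x,y)|)D_su(x,y)\frac{dy}{|x-y|^{N+s}}$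 is the fractional $\Phi$-Laplacian, understood weakly. $\|u\|_{q,a}^q=\int a|u|^q\,dx$, $\|u\|_p^p=\int|u|^p\,dx$. The energy functional is $\mathcal{I}_{\lambda,\mu}(u)=\mathcal{J}(u)-\frac{\mu}{q}\|u\|_{q,a}^q+\frac{\lambda}{p}\|u\|_p^p$, a $C^2$ functional on $X$. A weak solution is $u\in X$ with $\mathcal{I}'_{\lambda,\mu}(u)v=\mathcal{J}'(u)v-\mu\int a|u|^{q-2}uv\,dx+\lambda\int|u|^{p-2}uv\,dx=0$ for all $v\in X$. $\mathcal{N}_{\lambda,\mu}=\{u\in X\setminus\{0\}:\mathcal{I}'_{\lambda,\mu}(u)u=0\}$, $\mathcal{N}^{\pm}_{\lambda,\mu}=\{u\in\mathcal{N}_{\lambda,\mu}:\pm\mathcal{I}''_{\lambda,\mu}(u)(u,u)>0\}$, $\mathcal{E}^\pm_{\lambda,\mu}=\inf_{\mathcal{N}^\pm_{\lambda,\mu}}\mathcal{I}_{\lambda,\mu}$. For $u\in X\setminus\{0\}$: $R_n(u)=\frac{\mathcal{J}'(u)u+\lambda\|u\|_p^p}{\|u\|_{q,a}^q}$, and $\mu_n(\lambda)=\inf_{u\in X\setminus\{0\}}\inf_{t>0}R_n(tu)$. *)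

(* Defs.v *)
From HB Require Import structures.
From mathcomp Require Import all_boot all_order all_algebra.
From mathcomp Require Import all_classical all_reals all_analysis.

Set Implicit Arguments.
Unset Strict Implicit.
Unset Printing Implicit Defensive.

Import Order.TTheory GRing.Theory Num.Theory.
Import numFieldNormedType.Exports.

Local Open Scope classical_set_scope.
Local Open Scope ring_scope.

(* The tuple type carries the product sigma-algebra of the Borel sets of R,
   i.e. the Borel sets of R^N. *)
Notation Rtuple R N := (N.-tuple (measurableTypeR R)).

Section lebesgue_tuple_step.
Context (R : realType) (n : nat).
Variable m : {sigma_finite_measure set (Rtuple R n) -> \bar R}.

Definition tcons (z : measurableTypeR R * Rtuple R n) : Rtuple R n.+1 :=
  [the n.+1.-tuple _ of z.1 :: z.2].

Definition lebesgue_tcons : set (Rtuple R n.+1) -> \bar R :=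
  pushforward (lebesgue_measure \x m)%E tcons.

Let measurable_tcons : measurable_fun setT tcons.
Proof. exact: measurable_cons. Qed.

Let lebesgue_tcons0 : lebesgue_tcons set0 = 0%E.
Proof. by rewrite /lebesgue_tcons /pushforward preimage_set0 measure0. Qed.

Let lebesgue_tcons_ge0 A : (0 <= lebesgue_tcons A)%E.
Proof. exact: measure_ge0. Qed.

Let lebesgue_tcons_sigma_additive : semi_sigma_additive lebesgue_tcons.
Proof.
move=> F mF tF mUF; rewrite /lebesgue_tcons /pushforward preimage_bigcup.
apply: measure_semi_sigma_additive.
- by move=> k; rewrite -[X in measurable X]setTI; exact: measurable_tcons.
- apply/trivIsetP => /= i j _ _ ij; rewrite -preimage_setI.
  by move/trivIsetP : tF => /(_ _ _ _ _ ij) ->//; rewrite preimage_set0.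
- by rewrite -preimage_bigcup -[X in measurable X]setTI; exact: measurable_tcons.
Qed.

HB.instance Definition _ := isMeasure.Build _ _ _ lebesgue_tcons
  lebesgue_tcons0 lebesgue_tcons_ge0 lebesgue_tcons_sigma_additive.

Let tuncons (x : Rtuple R n.+1) : measurableTypeR R * Rtuple R n :=
  (tnth x ord0, [tuple of behead x]).

Let tconsK : cancel tcons tuncons.
Proof. by move=> [a t]; congr pair; apply/val_inj. Qed.

Let measurable_tuncons : measurable_fun setT tuncons.
Proof.
apply: measurable_fun_pair; first exact: measurable_tnth.
exact: measurable_behead.
Qed.

Let lebesgue_tcons_sigma_finite : sigma_finite setT lebesgue_tcons.
Proof.
have /sigma_finiteP[F [TF ndF Foo]] := sigma_finiteT (@lebesgue_measure R).
have /sigma_finiteP[G [TG ndG Goo]] := sigma_finiteT m.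
exists (fun k => tuncons @^-1` (F k `*` G k)).
  rewrite -preimage_bigcup (_ : \bigcup_k _ = setT) ?preimage_setT//.
  rewrite -subTset => -[x y] _.
  have [k _ Fkx] : (\bigcup_k F k) x by rewrite -TF.
  have [l _ Gly] : (\bigcup_k G k) y by rewrite -TG.
  exists (maxn k l) => //; split.
  - by move: x Fkx; exact/subsetPset/ndF/leq_maxl.
  - by move: y Gly; exact/subsetPset/ndG/leq_maxr.
move=> k; have [mF Fk] := Foo k; have [mG Gk] := Goo k; split.
  rewrite -[X in measurable X]setTI; apply: measurable_tuncons => //.
  exact: measurableX.
rewrite /lebesgue_tcons /pushforward -comp_preimage.
rewrite (_ : tuncons \o tcons = id); last by apply/funext => z /=; rewrite tconsK.
by rewrite preimage_id product_measure1E// lte_mul_pinfty// ge0_fin_numE.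
Qed.

HB.instance Definition _ := Measure_isSigmaFinite.Build _ _ _ lebesgue_tcons
  lebesgue_tcons_sigma_finite.

End lebesgue_tuple_step.

Fixpoint lebesgue_tuple (R : realType) (n : nat) :
    {sigma_finite_measure set (Rtuple R n) -> \bar R} :=
  match n with
  | 0 => \d_([tuple] : Rtuple R 0)
  | n'.+1 => lebesgue_tcons (lebesgue_tuple R n')
  end.

(* The value on boxes, which characterizes the Lebesgue measure. *)
Lemma lebesgue_tuple_box (R : realType) (n : nat)
    (A : 'I_n -> set (measurableTypeR R)) :
  (forall i, measurable (A i)) ->
  lebesgue_tuple R n [set x | forall i, A i (tnth x i)] =
  (\prod_(i < n) lebesgue_measure (A i))%E.
Proof.
elim: n A => [|n IH] A mA /=.
  rewrite big_ord0 diracE mem_set//= => -[].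
  by case.
rewrite big_ord_recl -IH; last by move=> i; exact: mA.
rewrite -product_measure1E//; first last.
  rewrite (_ : mkset _ =
      \bigcap_(i in [set: 'I_n]) ((fun x => tnth x i) @^-1` A (lift ord0 i))).
    apply: fin_bigcap_measurable => // i _.
    by rewrite -[X in measurable X]setTI; exact: measurable_tnth.
  by apply/seteqP; split => x /= H i; [move=> _; exact: H|exact: H].
rewrite /lebesgue_tcons /pushforward; congr (_ _).
apply/seteqP; split => -[a t] /=.
- move=> H; split; first by have := H ord0; rewrite tnth0.
  by move=> i; have := H (lift ord0 i); rewrite tnthS.
- move=> [H0 H] i; case: (unliftP ord0 i) => [j ->|->].
    by rewrite tnthS; exact: H.
  by rewrite tnth0.
Qed.

Section energy.
Context (R : realType) (N : nat).
Local Notation T := (Rtuple R N).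
Local Notation leb := (lebesgue_tuple R N).

Definition Rdist (x y : T) : R :=
  Num.sqrt (\sum_(i < N) ((tnth x i : R) - tnth y i) ^+ 2).

(* Lebesgue measurability (w.r.t. the completed sigma-algebra): almost
   everywhere equal to a Borel function. *)
Definition lebesgue_measurable_fun (f : T -> R) :=
  exists2 g : T -> R, measurable_fun setT g & {ae leb, forall x, f x = g x}.

(* Continuity for the usual topology of R^N, the library's topology on row
   vectors. *)
Definition Rcontinuous (f : T -> R) :=
  continuous (fun r : 'rV[R]_N => f [tuple (r ord0 i : measurableTypeR R) | i < N]).

Variables (s : R) (phi : R -> R) (V a : T -> R) (q p : R).

Definition Phi (t : R) : R :=
  \int[lebesgue_measure]_(tau in `[0%R, `|t|]) (tau * phi tau).

(* On the diagonal, a null set, the quotient is 0 by convention. *)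
Definition Ds (u : T -> R) (z : T * T) : R :=
  (u z.1 - u z.2) / Rdist z.1 z.2 `^ s.

(* Density of nu w.r.t. the Lebesgue measure on R^N x R^N. *)
Definition nu_density (z : T * T) : R := (Rdist z.1 z.2 ^+ N)^-1.

(* Elements of the function spaces are represented by Borel functions: every
   a.e.-class has such a representative, and none of the functionals below
   depends on its choice. *)
Definition Lorlicz (u : T -> R) : Prop :=
  measurable_fun setT u /\
  exists2 k : R, 0 < k & (\int[leb]_x (Phi (u x / k))%:E < +oo)%E.

Definition Wspace (u : T -> R) : Prop :=
  Lorlicz u /\
  exists2 k : R, 0 < k &
    (\int[leb \x leb]_z (Phi (Ds u z / k) * nu_density z)%:E < +oo)%E.

Definition Xspace (u : T -> R) : Prop :=
  Wspace u /\ (\int[leb]_x (V x * Phi (u x))%:E < +oo)%E.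

Definition Xnonzero (u : T -> R) : Prop :=
  Xspace u /\ ~ {ae leb, forall x, u x = 0}.

Definition J (u : T -> R) : \bar R :=
  (\int[leb \x leb]_z (Phi (Ds u z) * nu_density z)%:E
   + \int[leb]_x (V x * Phi (u x))%:E)%E.

Definition Xnorm (u : T -> R) : R :=
  inf [set k : R | 0 < k /\ (J (fun x => (u x / k)%R) <= 1)%E].

(* Where the argument of phi is 0 the integrands vanish whatever the value of
   phi at 0, because they contain that argument as a factor. *)
Definition dJ (u v : T -> R) : R :=
  \int[(leb \x leb)%E]_z
    (phi `|Ds u z| * Ds u z * Ds v z * nu_density z)
  + \int[leb]_x (V x * phi `|u x| * u x * v x).

Definition normqa_q (u : T -> R) : R := \int[leb]_x (a x * `|u x| `^ q).

Definition normp_p (u : T -> R) : R := \int[leb]_x (`|u x| `^ p).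

Definition energy (lambda mu : R) (u : T -> R) : R :=
  fine (J u) - mu / q * normqa_q u + lambda / p * normp_p u.

Definition denergy (lambda mu : R) (u v : T -> R) : R :=
  dJ u v
  - mu * \int[leb]_x (a x * `|u x| `^ (q - 2) * u x * v x)
  + lambda * \int[leb]_x (`|u x| `^ (p - 2) * u x * v x).

(* I''(u)(v,w), the derivative of I'( . )v at u in the direction w. *)
Definition d2energy (lambda mu : R) (u v w : T -> R) : R :=
  derive1 (fun t : R => denergy lambda mu (fun x => u x + t * w x) v) 0.

Definition weak_solution (lambda mu : R) (u : T -> R) : Prop :=
  Xspace u /\ forall v, Xspace v -> denergy lambda mu u v = 0.

Definition nehari (lambda mu : R) : set (T -> R) :=
  [set u | Xnonzero u /\ denergy lambda mu u u = 0].

Definition nehari_plus (lambda mu : R) : set (T -> R) :=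
  [set u | nehari lambda mu u /\ 0 < d2energy lambda mu u u u].

Definition nehari_minus (lambda mu : R) : set (T -> R) :=
  [set u | nehari lambda mu u /\ d2energy lambda mu u u u < 0].

(* Infima are taken in the extended reals, so no junk value arises for empty
   or unbounded sets. *)
Definition Eplus (lambda mu : R) : \bar R :=
  ereal_inf [set (energy lambda mu u)%:E | u in nehari_plus lambda mu].

Definition Eminus (lambda mu : R) : \bar R :=
  ereal_inf [set (energy lambda mu u)%:E | u in nehari_minus lambda mu].

Definition Rn (lambda : R) (u : T -> R) : R :=
  (dJ u u + lambda * normp_p u) / normqa_q u.

Definition mu_n (lambda : R) : \bar R :=
  ereal_inf [set ereal_inf [set (Rn lambda (fun x => t * u x))%:E
                               | t in [set t : R | 0 < t]]
                | u in Xnonzero].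

End energy.

(* Main.v *)
Require Import Defs.
From HB Require Import structures.
From mathcomp Require Import ring lra.
From mathcomp Require Import all_boot all_order all_algebra.
From mathcomp Require Import all_classical all_reals all_analysis.
From mathcomp Require Import measurable_realfun.

(** The modular functions met here, the Young function [Phi], the function
[Gphi t = t ^ 2 * phi t], the energy [J (t u)] and the pairing [dJ (t u) (t u)]
as functions of [t], all satisfy [e1 * f <= t * f' <= e2 * f] (predicate
[growth]), with [e1 = ell] and [e2 = m]: the bounds on the quotient
[t * g'' / g'] give this for [g], integration gives it for [Phi], and
differentiation under the integral sign passes it to the integrals
([growth_modular]).  Such functions are trapped between powers of [t]. With
[A t = dJ (t u) (t u)], [P = normp_p p u] and [Q = normqa_q a q u], the function
[t u] lies on the Nehari set iff [A t + lambda t^p P = mu t^q Q], and the sign of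
the second derivative of the energy there is the sign of
[t A' - q A + lambda (p - q) t^p P] ([nehari_ray]).

(i) On the negative part, the last expression is negative. Eliminating [Q] and
bounding [P] shows that the energy is at least a positive multiple of [J u]
([nehari_minus_coercive]); this is where [m (q - ell) < p (q - m)] enters. So it
suffices that the infimum tends to 0. Along a fixed ray the fibre equation has,
for large [mu], a root near 0, where [A] dominates [t^p] because [m < p]; this
root gives points of the negative part of arbitrarily small energy
([Eminus_upper]).

(ii) Along the same ray there is a root near infinity, where [t^p] dominates; it
gives points of the positive part of energy at most [- c mu^(p / (p - q))]
([Eplus_upper]). Let [v] have so low an energy and put [t = mu^(1 / (p - q))],
[z = |v| / t]. By homogeneity the lower order terms of the energy are [t^p] times
the integral of [lambda z^p / p - a z^q / q]. Young's inequality bounds this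
integrand below by [- C a^(p / (p - q))], which is integrable, and the integrand
is small where [z] is small. Hence [z] cannot be below a fixed [d] outside a set
of small measure, so that the integral of [Phi v] is at least a multiple of
[Phi (d t)], which tends to infinity ([nehari_plus_modular]). Here the integral
of [|v|^p] is finite, since an infinite one would be represented by the value 0,
which would make the energy nonnegative ([normp_p_integrable]).

The ray is that of a tent function supported in a cube on which [V] is bounded.
Its double integral converges because, on the dyadic shells where [|x - y|] is
comparable with [r], the density [|x - y|^(- N)] compensates the measure of the
shell and the remaining factor is geometric ([tent_seminorm_modular_lty]). *)

Set Implicit Arguments.
Unset Strict Implicit.
Unset Printing Implicit Defensive.

Import Order.TTheory GRing.Theory Num.Theory.
Import numFieldNormedType.Exports.

Local Open Scope classical_set_scope.
Local Open Scope ring_scope.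

(** * Functions of power growth *)

Section growth.
Context {R : realType}.
Implicit Types (f : R -> R) (e k t : R).

Lemma nondecreasing_pos f :
  (forall t, 0 < t -> derivable f t 1) -> (forall t, 0 < t -> 0 <= derive1 f t) ->
  forall x y, 0 < x -> x <= y -> f x <= f y.
Proof.
move=> df f0 x y x0 xy.
apply: (@ger0_derive1_le_cc R f x y) => //.
- by move=> z; rewrite in_itv/= => /andP[xz _]; apply/df/(lt_trans x0).
- by move=> z; rewrite in_itv/= => /andP[xz _]; apply/f0/(lt_trans x0).
- apply: derivable_within_continuous => z; rewrite in_itv/= => /andP[xz _].
  exact/df/(lt_le_trans x0).
- by rewrite in_itv/= lexx.
- by rewrite in_itv/= xy lexx.
Qed.

(** Pointwise form of the statement that [f] grows at least like [t ^ e1] and at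
    most like [t ^ e2]. Being pointwise and linear in [f], it passes to sums and
    to integrals. *)
Definition growth e1 e2 f := forall t, 0 < t ->
  [/\ 0 <= f t, derivable f t 1 & e1 * f t <= t * derive1 f t <= e2 * f t].

Lemma is_derive_growth e1 e2 f t : growth e1 e2 f -> 0 < t ->
  is_derive t 1 f (derive1 f t).
Proof. by move=> /[apply] -[_ df _]; rewrite derive1E; exact/derivableP. Qed.

Lemma growth_cont e1 e2 f t : growth e1 e2 f -> 0 < t -> {for t, continuous f}.
Proof.
by move=> /[apply] -[_ df _]; exact/differentiable_continuous/derivable1_diffP.
Qed.

(** The derivative of [f * t ^ - e2] is [t ^ (- e2 - 1) * (t * f' - e2 * f)]. *)
Lemma growth_powR_nonincr e1 e2 f x y : growth e1 e2 f -> 0 < x -> x <= y ->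
  f y * y `^ (- e2) <= f x * x `^ (- e2).
Proof.
move=> gf x0 xy.
pose h t := - (f t * t `^ (- e2)).
have dh t : 0 < t -> is_derive t 1 h (- (f t * (- e2 * t `^ (- e2 - 1)) + t `^ (- e2) * derive1 f t)).
  move=> t0; have ? := is_derive_growth gf t0.
  by have ? := is_derive1_powR (- e2) t0; exact: (@is_deriveN _ _ _ (fun x => f x * x `^ (- e2)) _ _ _ (is_deriveM _ _)).
rewrite -lerN2; apply: (@nondecreasing_pos h) => //.
  by move=> t /dh[].
move=> t t0; rewrite derive1E; have [_ ->] := dh _ t0.
have -> : t `^ (- e2) = t * t `^ (- e2 - 1).
  by rewrite -{2}(powRr1 (ltW t0)) -powRD ?(gt_eqF t0) ?implybT//; congr powR; ring.
have [_ _ /andP[_ h2]] := gf _ t0.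
rewrite (_ : - _ = t `^ (- e2 - 1) * (e2 * f t - t * derive1 f t)); last by ring.
by rewrite mulr_ge0 ?powR_ge0// subr_ge0.
Qed.

Lemma growth_powR_nondecr e1 e2 f x y : growth e1 e2 f -> 0 < x -> x <= y ->
  f x * x `^ (- e1) <= f y * y `^ (- e1).
Proof.
move=> gf x0 xy.
pose h t := (f t * t `^ (- e1)).
have dh t : 0 < t -> is_derive t 1 h (f t * (- e1 * t `^ (- e1 - 1)) + t `^ (- e1) * derive1 f t).
  move=> t0; have ? := is_derive_growth gf t0.
  by have ? := is_derive1_powR (- e1) t0; exact: (@is_deriveM _ _ f (fun x => x `^ (- e1))).
apply: (@nondecreasing_pos h) => //.
  by move=> t /dh[].
move=> t t0; rewrite derive1E; have [_ ->] := dh _ t0.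
have -> : t `^ (- e1) = t * t `^ (- e1 - 1).
  by rewrite -{2}(powRr1 (ltW t0)) -powRD ?(gt_eqF t0) ?implybT//; congr powR; ring.
have [_ _ /andP[h2 _]] := gf _ t0.
rewrite (_ : _ + _ = t `^ (- e1 - 1) * (t * derive1 f t - e1 * f t)); last by ring.
by rewrite mulr_ge0 ?powR_ge0// subr_ge0.
Qed.

Lemma growth_scale_ge1 e1 e2 f k t : growth e1 e2 f -> 1 <= k -> 0 < t ->
  k `^ e1 * f t <= f (k * t) <= k `^ e2 * f t.
Proof.
move=> gf k1 t0; have k0 : 0 < k by exact: lt_le_trans k1.
have tkt : t <= k * t by rewrite ler_peMl// ltW.
have kt0 : 0 < k * t by rewrite mulr_gt0.
apply/andP; split.
- have := growth_powR_nondecr gf t0 tkt.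
  rewrite powRM ?(ltW k0) ?(ltW t0)// !powRN mulrA ler_pM2r ?invr_gt0 ?powR_gt0//.
  by rewrite ler_pdivlMr ?powR_gt0// mulrC.
- have := growth_powR_nonincr gf t0 tkt.
  rewrite powRM ?(ltW k0) ?(ltW t0)// !powRN mulrA ler_pM2r ?invr_gt0 ?powR_gt0//.
  by rewrite ler_pdivrMr ?powR_gt0// (mulrC _ (f t)).
Qed.

(** [growth_scale_ge1] for the inverse dilation factor. *)
Lemma growth_scale_le1 e1 e2 f k t : growth e1 e2 f -> 0 < k <= 1 -> 0 < t ->
  k `^ e2 * f t <= f (k * t) <= k `^ e1 * f t.
Proof.
move=> gf /andP[k0 k1] t0.
have := growth_scale_ge1 gf (_ : 1 <= k^-1) (_ : 0 < k * t).
rewrite invf_ge1// => /(_ k1); rewrite mulr_gt0// => /(_ isT).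
rewrite mulKf ?gt_eqF// -powR_inv1 ?(ltW k0)// -!powRrM !mulN1r !powRN.
rewrite ler_pdivrMl ?powR_gt0// ler_pdivlMl ?powR_gt0//.
by rewrite andbC.
Qed.

Lemma growth_homo e1 e2 f x y : 0 <= e1 -> growth e1 e2 f -> 0 < x -> x <= y ->
  f x <= f y.
Proof.
move=> e10 gf x0 xy; apply: (nondecreasing_pos _ _ x0 xy) => t t0.
  by have [] := gf _ t0.
have [f0 _ /andP[+ _]] := gf _ t0.
by move=> /(le_trans (mulr_ge0 e10 f0)); rewrite pmulr_rge0.
Qed.

Lemma growthD e1 e2 f1 f2 : growth e1 e2 f1 -> growth e1 e2 f2 ->
  growth e1 e2 (fun t => f1 t + f2 t).
Proof.
move=> g1 g2 t t0; have d1 := is_derive_growth g1 t0.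
have d2 := is_derive_growth g2 t0.
have d : is_derive t 1 (fun t => f1 t + f2 t) (derive1 f1 t + derive1 f2 t) by exact: (@is_deriveD _ _ _ f1 f2).
have [p1 _ /andP[l1 u1]] := g1 _ t0; have [p2 _ /andP[l2 u2]] := g2 _ t0.
split; [exact: addr_ge0 | by case: d | rewrite derive1E; case: d => _ ->].
by rewrite !mulrDr !lerD.
Qed.

(** The identity has both exponents equal to 1, so multiplying by it shifts the
    exponents. *)
Lemma growth_mulid e1 e2 f : growth e1 e2 f ->
  growth (e1 + 1) (e2 + 1) (fun t => t * f t).
Proof.
move=> gf t t0; have df := is_derive_growth gf t0.
have d : is_derive t 1 (fun t => t * f t) (t * derive1 f t + f t * 1) by exact: (@is_deriveM _ _ id f).
have [p _ /andP[l u]] := gf _ t0.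
split; [by rewrite mulr_ge0// ltW | by case: d | rewrite derive1E; case: d => _ ->].
by rewrite !mulrDl !mulrDr !mulr1 !mul1r !(mulrCA _ t) !lerD2r !ler_pM2l// l u.
Qed.

Lemma growth_eq e1 e2 f1 f2 : (forall t, 0 < t -> f1 t = f2 t) ->
  growth e1 e2 f1 -> growth e1 e2 f2.
Proof.
move=> f12 gf t t0; have [p d b] := gf _ t0.
have nf : \near t, f1 t = f2 t.
  by near=> x; apply: f12; near: x; exact: lt_nbhsr.
rewrite -f12// derive1E -(near_eq_derive _ nf) -derive1E; split => //.
exact: (near_eq_derivable nf).
Unshelve. all: by end_near. Qed.

End growth.

(** * From second order bounds to power growth *)

Section young_function.
Context {R : realType}.
Implicit Types (f g phi : R -> R) (e k t : R).

(** Both [t * g' - e1 * g] and [e2 * g - t * g'] are nondecreasing. The first is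
    nonnegative because its limit at 0 is; if the second were negative at some
    point, then [t * g'] would stay above a positive constant near 0 and [g]
    would have a logarithmic singularity there. *)
Lemma growth_of_second_order g e1 e2 : 0 < e1 -> 0 <= e2 ->
  (forall t, 0 < t -> 0 <= g t) ->
  (forall t, 0 < t -> derivable g t 1 /\ derivable (derive1 g) t 1) ->
  (forall t, 0 < t -> 0 <= derive1 g t) ->
  (forall t, 0 < t -> (e1 - 1) * derive1 g t <= t * derive1 (derive1 g) t
      <= (e2 - 1) * derive1 g t) ->
  g t @[t --> 0^'+] --> (0 : R) ->
  growth e1 e2 g.
Proof.
move=> e10 e20 g0 dg g'0 g'' cg.
have dg1 t : 0 < t -> is_derive t 1 g (derive1 g t).
  by move=> /dg[d _]; rewrite derive1E; exact/derivableP.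
have dg2 t : 0 < t -> is_derive t 1 (derive1 g) (derive1 (derive1 g) t).
  by move=> /dg[_ d]; rewrite [derive1 (derive1 g) t]derive1E; exact/derivableP.
have dh e t : 0 < t -> is_derive t 1 (fun t => t * derive1 g t - e * g t)
   (t * derive1 (derive1 g) t - (e - 1) * derive1 g t).
  move=> t0; have d1 := dg1 _ t0; have d2 := dg2 _ t0.
  rewrite (_ : _ - _ = t * derive1 (derive1 g) t + derive1 g t * 1 - e * derive1 g t); last by ring.
  exact: (@is_deriveB _ _ _ (fun t => t * derive1 g t) (fun t => e * g t)).
move=> t t0; split; [exact: g0|by have [] := dg _ t0|apply/andP; split].
- have hs (s : R) : 0 < s -> s <= t -> - (e1 * g s) <= t * derive1 g t - e1 * g t.
    move=> s0 st; have H : s * derive1 g s - e1 * g s <= t * derive1 g t - e1 * g t.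
      apply: (@nondecreasing_pos _ (fun t => t * derive1 g t - e1 * g t)) => //.
        by move=> x /(dh e1)[].
      move=> x x0; rewrite derive1E; have [_ ->] := dh e1 _ x0.
      by rewrite subr_ge0; have /andP[] := g'' _ x0.
    by apply: le_trans H; rewrite lerBrDl subrr mulr_ge0 ?g'0 ?(ltW s0).
  rewrite -subr_ge0; apply/ler_addgt0Pr => e e0.
  have : \forall s \near 0^'+, g s < e / e1.
    by apply: (cvgr_lt (0 : R) cg); rewrite divr_gt0.
  move=> ge; near (0 : R)^'+ => s.
  have s0 : 0 < s by near: s; exact: nbhs_right_gt.
  have st : s <= t by near: s; exact: nbhs_right_le.
  rewrite -lerBlDr sub0r; apply: le_trans (hs _ s0 st).
  rewrite lerN2 mulrC -ler_pdivlMr// ltW//.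
  by near: s.
- rewrite leNgt; apply/negP => H.
  set c := t * derive1 g t - e2 * g t; have c0 : 0 < c by rewrite subr_gt0.
  have hs (s : R) : 0 < s -> s <= t -> c <= s * derive1 g s.
    move=> s0 st.
    have : - (s * derive1 g s - e2 * g s) <= - c.
      apply: (@nondecreasing_pos _ (fun t => - (t * derive1 g t - e2 * g t))) => //.
        by move=> x x0; apply: derivableN; have [] := dh e2 _ x0.
      move=> x x0; rewrite derive1E deriveN; last by have [] := dh e2 _ x0.
      have [_ ->] := dh e2 _ x0.
      by rewrite oppr_ge0 subr_le0; have /andP[] := g'' _ x0.
    rewrite lerN2 => /le_trans; apply.
    by rewrite gerBl mulr_ge0// g0.
  (* The integrated inequality bounds c * (ln t - ln s) by g t; this s violates
     it, since ln t - ln s = K. *)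
  pose K := g t / c + 1.
  pose s := t * expR (- K).
  have K0 : 0 < K by rewrite ltr_wpDl// divr_ge0 ?g0// ltW.
  have s0 : 0 < s by rewrite mulr_gt0// expR_gt0.
  have st : s <= t by rewrite ger_pMr// -expR0 ler_expR oppr_le0 ltW.
  have dl (x : R) : 0 < x -> is_derive x 1 (fun x => g x - c * ln x) (derive1 g x - c * x^-1).
    move=> x0; apply: (@is_deriveB _ _ _ g (fun t => c * ln t)); first exact: dg1.
    apply: (@is_deriveZ _ _ _ (@ln R)); exact: is_derive1_ln.
  have : g s - c * ln s <= g t - c * ln t.
    apply: (@ger0_derive1_le_cc R (fun x => g x - c * ln x) s t) => //.
    + by move=> x; rewrite in_itv/= => /andP[/(lt_trans s0)/dl[]].
    + move=> x; rewrite in_itv/= => /andP[sx xt].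
      have x0 := lt_trans s0 sx.
      rewrite derive1E; have [_ ->] := dl _ x0.
      by rewrite subr_ge0 ler_pdivrMr// mulrC hs// ltW.
    + apply: derivable_within_continuous => x; rewrite in_itv/= => /andP[sx _].
      by have [] := dl _ (lt_le_trans s0 sx).
    + by rewrite in_itv/= lexx.
    + by rewrite in_itv/= st lexx.
  rewrite leNgt => /negP; apply.
  have -> : c * ln s = c * ln t - (g t + c).
    rewrite /s lnM ?posrE ?expR_gt0// expRK /K; field.
    by rewrite gt_eqF.
  have := g0 _ s0; lra.
Unshelve. all: by end_near. Qed.

(** Precomposing with the positive part makes monotonicity on the half-line
    global, hence [f] measurable there. *)
Lemma measurable_homo_max f : (forall x y, 0 <= x -> x <= y -> f x <= f y) ->
  measurable_fun setT (fun x : R => f (Num.max 0 x)).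
Proof.
move=> hf; apply: nondecreasing_measurable => // x y xy.
apply: hf; first by rewrite le_max lexx.
by rewrite ge_max !le_max lexx xy orbT.
Qed.

Lemma growth_nneg_homo e1 e2 f : 0 <= e1 -> f 0 = 0 -> growth e1 e2 f ->
  forall x y, 0 <= x -> x <= y -> f x <= f y.
Proof.
move=> e10 f0 gf x y; rewrite le_eqVlt => /predU1P[<-|x0 xy].
  rewrite f0 le_eqVlt => /predU1P[<-|y0]; first by rewrite f0.
  by have [] := gf _ y0.
exact: growth_homo gf x0 xy.
Qed.

Lemma integrable_homo f t : (forall x y, 0 <= x -> x <= y -> f x <= f y) ->
  lebesgue_measure.-integrable `[0, t] (EFin \o f).
Proof.
move=> hf; apply: measurable_bounded_integrable => //.
- by rewrite /= lebesgue_measure_itv/=; case: ifPn => _; rewrite -?EFinD ltry.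
- apply: (@eq_measurable_fun _ _ _ _ _ (fun x : R => f (Num.max 0 x))).
    by move=> x; rewrite inE/= in_itv/= => /andP[x0 _]; rewrite max_r.
  by apply: measurable_funTS; exact: measurable_homo_max.
- exists (`|f 0| + `|f t|); split; first by rewrite num_real.
  move=> M ltM x /=; rewrite in_itv/= => /andP[x0 xt].
  apply: le_trans (ltW ltM); rewrite ler_norml.
  have := hf _ _ (lexx 0) x0; have := hf _ _ x0 xt.
  have := ler_norm (- f 0); rewrite normrN.
  have := ler_norm (f t); have := normr_ge0 (f 0); have := normr_ge0 (f t).
  by move=> *; apply/andP; split; lra.
Qed.

Lemma is_derive_primitive f t : (forall x y : R, 0 <= x -> x <= y -> f x <= f y) ->
  0 < t -> {for t, continuous f} ->
  is_derive t 1 (fun t : R => \int[lebesgue_measure]_(x in `[0, t]) f x) (f t).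
Proof.
move=> hf t0 cf; have tt : t < t + 1 by rewrite ltrDl.
have := @continuous_FTC1_closed R f 0 t (t + 1) tt (integrable_homo _ hf) t0 cf.
by move=> [d e]; apply: DeriveDef; rewrite -?derive1E.
Qed.

(** With [F] the primitive, [t * f - (e1 + 1) * F] and [(e2 + 1) * F - t * f] are
    nondecreasing, and they tend to 0 at 0 since [0 <= F t <= t * f t]. *)
Lemma growth_primitive e1 e2 f : 0 <= e1 -> f 0 = 0 -> growth e1 e2 f ->
  growth (e1 + 1) (e2 + 1)
    (fun t => \int[lebesgue_measure]_(x in `[0, t]) f x).
Proof.
move=> e10 f0 gf.
set F : R -> R := fun t => _.
have hf := growth_nneg_homo e10 f0 gf.
have dF (t : R) : 0 < t -> is_derive t 1 F (f t).
  by move=> t0; apply: is_derive_primitive => //; exact: growth_cont gf t0.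
have Ff (t : R) : 0 < t -> 0 <= F t <= t * f t.
  move=> t0; apply/andP; split.
    apply: Rintegral_ge0 => x /=; rewrite in_itv/= => /andP[x0 _].
    by rewrite -f0; exact: hf.
  have -> : t * f t = \int[lebesgue_measure]_(x in `[0, t]) f t.
    rewrite Rintegral_cst//= lebesgue_measure_itv/= lte_fin t0.
    by rewrite -EFinD/= subr0 mulrC.
  apply: le_Rintegral => //; first exact: integrable_homo.
    apply: measurable_bounded_integrable => //.
      by rewrite /= lebesgue_measure_itv/=; case: ifPn => _; rewrite -?EFinD ltry.
    by exists `|f t|; split => [|M M1 x _]; [rewrite num_real|exact: ltW].
  move=> x /=; rewrite in_itv/= => /andP[x0 xt]; exact: hf.
clearbody F.
have dtf (t : R) : 0 < t -> is_derive t 1 (fun t => t * f t) (t * derive1 f t + f t * 1).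
  move=> t0; have df := is_derive_growth gf t0.
  exact: (@is_deriveM _ _ id f).
have small (x C t : R) : 0 < t -> 0 <= C -> (forall s : R, 0 < s -> s <= t -> - (s * C) <= x) -> 0 <= x.
  move=> t0 C0 H; rewrite leNgt; apply/negP => x0.
  have C1 : 0 < C + 1 by rewrite ltr_wpDl.
  (* Small enough that s * C is below - x. *)
  pose s := Num.min t (- x / 2 / (C + 1)).
  have s0 : 0 < s by rewrite lt_min t0/= !divr_gt0// oppr_gt0.
  have := H s s0; rewrite ge_min lexx => /(_ isT).
  apply/negP; rewrite -ltNge ltrNr.
  have : s * (C + 1) <= - x / 2 by rewrite -ler_pdivlMr// ge_min lexx orbT.
  move=> h; have : s * C <= s * (C + 1) by rewrite ler_pM2l// lerDl.
  lra.
move=> t t0; have [p0 _ _] := gf _ t0; have d := dF _ t0.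
split; [by have /andP[] := Ff _ t0|by case: d|rewrite derive1E; case: d => _ ->].
have ge0 (s : R) (s0 : 0 < s) : 0 <= f s by have [] := gf _ s0.
have eF : forall s : R, 0 < s -> s <= t -> F s <= s * f t.
  move=> s s0 st; have /andP[_ /le_trans->//] := Ff _ s0.
  by rewrite ler_pM2l//; apply: hf => //; exact: ltW.
apply/andP; split; rewrite -subr_ge0.
- apply: (small _ ((e1 + 1) * f t) t t0).
    by rewrite mulr_ge0 ?addr_ge0.
  move=> s s0 st.
  have Ds (x : R) : 0 < x -> is_derive x 1 (fun x => x * f x - (e1 + 1) * F x)
    (x * derive1 f x + f x * 1 - (e1 + 1) * f x).
    move=> x0; exact: (is_deriveB (dtf _ x0) (@is_deriveZ _ _ _ F (e1 + 1) x 1 _ (dF _ x0))).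
  apply: (@le_trans _ _ (s * f s - (e1 + 1) * F s)); last first.
    apply: (@nondecreasing_pos _ (fun x => x * f x - (e1 + 1) * F x)) => //.
      by move=> x /Ds[].
    move=> x x0; rewrite derive1E; have [_ ->] := Ds _ x0.
    by have [_ _ /andP[h _]] := gf _ x0; lra.
  have /andP[F0 Fs] := Ff _ s0; have fs := ge0 _ s0.
  have h := eF _ s0 st; have h2 : 0 <= s * f s by rewrite mulr_ge0// ltW.
  have : (e1 + 1) * F s <= (e1 + 1) * (s * f t) by rewrite ler_wpM2l// addr_ge0.
  by lra.
- apply: (small _ (f t) t t0) => // s s0 st.
  have Ds (x : R) : 0 < x -> is_derive x 1 (fun x => (e2 + 1) * F x - x * f x)
    ((e2 + 1) * f x - (x * derive1 f x + f x * 1)).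
    move=> x0; exact: (is_deriveB (@is_deriveZ _ _ _ F (e2 + 1) x 1 _ (dF _ x0)) (dtf _ x0)).
  apply: (@le_trans _ _ ((e2 + 1) * F s - s * f s)); last first.
    apply: (@nondecreasing_pos _ (fun x => (e2 + 1) * F x - x * f x)) => //.
      by move=> x /Ds[].
    move=> x x0; rewrite derive1E; have [_ ->] := Ds _ x0.
    by have [_ _ /andP[_ h]] := gf _ x0; lra.
  have /andP[F0 Fs] := Ff _ s0; have fs := ge0 _ s0.
  have [_ _ /andP[h1 h2]] := gf _ t0.
  have : s * f s <= s * f t by rewrite ler_pM2l// hf// ltW.
  have e20 : 0 <= (e2 + 1) * F s.
    have [fs0|fs0] := eqVneq (f s) 0.
      by move: Fs; rewrite fs0 mulr0 => Fs; rewrite (_ : F s = 0) ?mulr0//; lra.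
    have fsp : 0 < f s by rewrite lt_neqAle eq_sym fs0.
    have [_ _ /andP[h1' h2']] := gf _ s0.
    have : e1 * f s <= e2 * f s by exact: le_trans h1' h2'.
    by rewrite ler_pM2r// => ?; rewrite mulr_ge0//; lra.
  by lra.
Qed.

End young_function.

(** * Modulars *)

Section growth_of_monotone.
Context {R : realType}.
Implicit Types (f : R -> R) (e x y t : R).

(** Adding [e * t] makes the monotonicity strict, at the cost of [e] in the
    derivative. *)
Lemma homo_derive1_ge0 f :
  (forall t, 0 < t -> derivable f t 1) ->
  (forall x y, 0 < x -> x <= y -> f x <= f y) ->
  forall t, 0 < t -> 0 <= derive1 f t.
Proof.
move=> df hf t t0; apply/ler_addgt0Pr => e e0.
have d (x : R) : 0 < x -> is_derive x 1 (f \+ (fun x => e * x)) (derive1 f x + e * 1).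
  move=> x0; have d1 : is_derive x 1 f (derive1 f x).
    by rewrite derive1E; exact/derivableP/df.
  exact: (is_deriveD d1 (@is_deriveZ _ _ _ id e x 1 1 _)).
have := @incr_derive1_ge0_itvy R (f \+ (fun x => e * x)) false 0 t.
rewrite derive1E; have [_ ->] := d _ t0; rewrite mulr1; apply.
- by move=> x; rewrite inE/= in_itv/= andbT => /d[].
- move=> x y; rewrite !in_itv/= !andbT => x0 y0 xy.
  by rewrite ler_ltD ?ltr_pM2l// hf// ltW.
- by rewrite in_itv/= andbT.
Qed.

(** Converse of [growth_powR_nondecr] and [growth_powR_nonincr]. It reads off the bounds for a
    derivative that is only known through its existence, without a formula to
    integrate. *)
Lemma growth_of_homo e1 e2 f :
  (forall t, 0 < t -> 0 <= f t) ->
  (forall t, 0 < t -> derivable f t 1) ->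
  (forall x y, 0 < x -> x <= y -> f x * x `^ (- e1) <= f y * y `^ (- e1)) ->
  (forall x y, 0 < x -> x <= y -> f y * y `^ (- e2) <= f x * x `^ (- e2)) ->
  growth e1 e2 f.
Proof.
move=> f0 df h1 h2.
have dfp (e x : R) : 0 < x -> is_derive x 1 (fun x => f x * x `^ (- e))
    (x `^ (- e - 1) * (x * derive1 f x - e * f x)).
  move=> x0; have d1 : is_derive x 1 f (derive1 f x).
    by rewrite derive1E; exact/derivableP/df.
  have -> : x `^ (- e - 1) * (x * derive1 f x - e * f x) =
      f x * (- e * x `^ (- e - 1)) + x `^ (- e) * derive1 f x.
    have -> : x `^ (- e) = x * x `^ (- e - 1).
      rewrite -{2}(powRr1 (ltW x0)) -powRD ?(gt_eqF x0) ?implybT//.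
      by congr powR; ring.
    by ring.
  exact: (is_deriveM d1 (is_derive1_powR (- e) x0)).
move=> t t0; split; [exact: f0|exact: df|apply/andP; split].
- have := @homo_derive1_ge0 (fun x => f x * x `^ (- e1)) _ h1 t t0.
  rewrite derive1E; have [_ ->] := dfp e1 _ t0.
  rewrite pmulr_rge0 ?powR_gt0// subr_ge0; apply => x x0.
  by have [] := dfp e1 _ x0.
- have := @homo_derive1_ge0 (fun x => - (f x * x `^ (- e2))) _ _ t t0.
  rewrite derive1E deriveN; last by have [] := dfp e2 _ t0.
  have [_ ->] := dfp e2 _ t0.
  rewrite oppr_ge0 pmulr_rle0 ?powR_gt0// subr_le0; apply.
    by move=> x x0; apply: derivableN; have [] := dfp e2 _ x0.
  by move=> x y x0 xy; rewrite lerN2 h2.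
Qed.

End growth_of_monotone.

Section modular.
Context {R : realType} d (T : measurableType d) (mu : {measure set T -> \bar R}).
Variables (w h : T -> R).
Hypotheses (w0 : forall x, 0 <= w x) (h0 : forall x, 0 <= h x)
  (mw : measurable_fun setT w) (mh : measurable_fun setT h).
Implicit Types (f : R -> R) (t k c : R).

Definition modular f t : \bar R := (\int[mu]_x (f (t * h x) * w x)%:E)%E.

Section homo.
Variable f : R -> R.
Hypotheses (hf : forall x y : R, 0 <= x -> x <= y -> f x <= f y) (f0 : f 0 = 0).

Let fge0 x : 0 <= x -> 0 <= f x.
Proof. by move=> x0; rewrite -f0; exact: hf. Qed.

Lemma modular_integrand_ge0 t x : 0 <= t -> 0 <= f (t * h x) * w x.
Proof. by move=> t0; rewrite mulr_ge0// fge0// mulr_ge0. Qed.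

Lemma measurable_modular t : 0 <= t ->
  measurable_fun setT (fun x => f (t * h x) * w x).
Proof.
move=> t0; apply: measurable_funM => //.
rewrite (_ : (fun _ => _) = (fun x => f (Num.max 0 x)) \o (fun x => t * h x)).
  apply: measurableT_comp; first exact: measurable_homo_max.
  exact: measurable_funM.
by apply/funext => x /=; rewrite max_r// mulr_ge0.
Qed.

Lemma modular_integrable t : 0 <= t -> (modular f t < +oo)%E ->
  mu.-integrable setT (EFin \o (fun x => f (t * h x) * w x)).
Proof.
move=> t0 ft; apply/integrableP; split; first exact/measurable_EFinP/measurable_modular.
under eq_integral do rewrite /= ger0_norm ?modular_integrand_ge0//.
exact: ft.
Qed.

End homo.

Lemma modular_le f1 f2 c t1 t2 : 0 <= t1 -> 0 <= t2 -> 0 <= c ->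
  f1 0 = 0 -> (forall x y : R, 0 <= x -> x <= y -> f1 x <= f1 y) ->
  f2 0 = 0 -> (forall x y : R, 0 <= x -> x <= y -> f2 x <= f2 y) ->
  (forall x, 0 < x -> f1 (t1 * x) <= c * f2 (t2 * x)) ->
  (modular f1 t1 <= c%:E * modular f2 t2)%E.
Proof.
move=> t10 t20 c0 f10 hf1 f20 hf2 f12.
rewrite /modular -ge0_integralZl//; first last.
- by move=> x _; rewrite lee_fin modular_integrand_ge0.
- exact/measurable_EFinP/measurable_modular.
apply: ge0_le_integral => //.
- by move=> x _; rewrite lee_fin modular_integrand_ge0.
- exact/measurable_EFinP/measurable_modular.
- by apply: measurable_funeM; exact/measurable_EFinP/measurable_modular.
move=> x _; rewrite -EFinM lee_fin mulrA ler_wpM2r//.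
have := h0 x; rewrite le_eqVlt => /predU1P[<-|]; last exact: f12.
by rewrite !mulr0 f10 f20 mulr0.
Qed.

Section growth.
Variables (f : R -> R) (e1 e2 : R).
Hypotheses (e10 : 0 <= e1) (e20 : 0 <= e2) (f0 : f 0 = 0) (gf : growth e1 e2 f).

Let hf := growth_nneg_homo e10 f0 gf.

Lemma modular_lty t1 t2 : 0 < t1 -> 0 < t2 -> (modular f t1 < +oo)%E ->
  (modular f t2 < +oo)%E.
Proof.
move=> t10 t20 fin1.
pose k := t2 / t1; have k0 : 0 < k by exact: divr_gt0.
have t2E : t2 = k * t1 by rewrite /k divfK// gt_eqF.
pose c := Num.max (k `^ e1) (k `^ e2).
have c0 : 0 <= c by rewrite le_max powR_ge0.
apply: (@le_lt_trans _ _ (c%:E * modular f t1)%E); last first.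
  by rewrite lte_mul_pinfty.
apply: modular_le => //; [exact: ltW|exact: ltW|].
move=> x x0; rewrite t2E -mulrA.
have t1x : 0 < t1 * x by rewrite mulr_gt0.
have ft1x : 0 <= f (t1 * x) by have [] := gf t1x.
have [k1|k1] := leP 1 k.
  have /andP[_ /le_trans->//] := growth_scale_ge1 gf k1 t1x.
  by rewrite ler_wpM2r// le_max lexx orbT.
have k01 : 0 < k <= 1 by rewrite k0 ltW.
have /andP[_ /le_trans->//] := growth_scale_le1 gf k01 t1x.
by rewrite ler_wpM2r// le_max lexx.
Qed.

(** Growth passes to superpositions: the derivative in [t] of the integrand is
    dominated near [t] by a multiple of the integrand at [2 * t], so the integral
    is differentiable, and the monotonicity of [f * t ^ - e1] and [f * t ^ - e2]
    integrates. *)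
Lemma growth_modular : (modular f 1 < +oo)%E ->
  growth e1 e2 (fun t => \int[mu]_x (f (t * h x) * w x)).
Proof.
move=> fin1.
have fin (t : R) : 0 < t -> (modular f t < +oo)%E by move=> t0; exact: modular_lty fin1.
have int (t : R) : 0 < t -> mu.-integrable setT (EFin \o (fun x => f (t * h x) * w x)).
  by move=> t0; apply: modular_integrable (fin _ t0) => //; exact: ltW.
have fx0 (t : R) : 0 < t -> 0 <= f t by move=> t0; have [] := gf t0.
have Rmul (c t : R) : 0 < t -> \int[mu]_x (c * (f (t * h x) * w x)) = c * \int[mu]_x (f (t * h x) * w x).
  by move=> t0; rewrite RintegralZl//; exact: int.
have intZ (c t : R) : 0 < t -> mu.-integrable setT (EFin \o (fun x => c * (f (t * h x) * w x))).
  move=> t0; rewrite (_ : _ \o _ = (fun x => c%:E * (f (t * h x) * w x)%:E)%E).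
    by apply: integrableZl => //; exact: int.
  by apply/funext => x.
have dfh (x : R) y : 0 < x -> 0 < h y ->
    is_derive x 1 (fun x => f (x * h y) * w y) (w y * (derive1 f (x * h y) * h y)).
  move=> x0 hy; have xh : 0 < x * h y by rewrite mulr_gt0.
  have df := is_derive_growth gf xh.
  have dm : is_derive x 1 (h y \*: (@id R)) (h y *: 1) by exact: is_deriveZ.
  have dc : is_derive x 1 (f \o (h y \*: (@id R))) (derive1 f (x * h y) * (h y *: 1)).
    by apply: is_derive1_comp; rewrite /= /GRing.scale/= mulrC.
  have := @is_deriveZ _ _ _ _ (w y) x 1 _ dc.
  rewrite /GRing.scale/= mulr1 [X in is_derive _ _ X](_ : _ = (fun x => f (x * h y) * w y))//.
  apply/funext => z /=; rewrite /GRing.scale/= mulrC; congr (f _ * _).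
  exact: mulrC.
apply: growth_of_homo.
- move=> t t0; apply: Rintegral_ge0 => x _.
  by apply: modular_integrand_ge0 => //; exact: ltW.
- move=> t t0.
  (* On ]t / 2, 2 * t[ the derivative is at most e2 / (t / 2) times the integrand,
     which increases with its argument. *)
  pose D := (fun x => (2 * e2 / t) * (f ((2 * t) * h x) * w x)).
  apply: (@derivable_under_integral R d T mu (fun t x => f (t * h x) * w x) setT _ t (t / 2) (2 * t) _ _ _ D) => //.
  + by rewrite /= in_itv/=; apply/andP; split; lra.
  + by move=> x /=; rewrite in_itv/= => /andP[tx _]; apply: int; lra.
  + move=> x y /=; rewrite in_itv/= => /andP[tx _] _.
    have x0 : 0 < x by lra.
    have := h0 y; rewrite le_eqVlt => /predU1P[<-|hy].
      by under eq_fun do rewrite mulr0; exact: derivable_cst.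
    by have [] := dfh _ _ x0 hy.
  + by move=> x; rewrite mulr_ge0 ?modular_integrand_ge0 ?divr_ge0 ?mulr_ge0// ltW// mulr_gt0.
  + by apply: intZ; lra.
  + move=> x y /=; rewrite in_itv/= => /andP[tx xt] _.
    have x0 : 0 < x by lra.
    have c0 : 0 <= 2 * e2 / t by rewrite divr_ge0 ?mulr_ge0// ltW.
    have D0 : 0 <= D y by rewrite mulr_ge0// modular_integrand_ge0// mulr_ge0// ltW.
    have := h0 y; rewrite le_eqVlt => /predU1P[hy|hy].
      rewrite /partial1of2 -hy; under eq_fun do rewrite mulr0.
      by rewrite derive1_cst normr0.
    have xh : 0 < x * h y by rewrite mulr_gt0.
    have -> : partial1of2 (fun t x => f (t * h x) * w x) x y =
        w y * (derive1 f (x * h y) * h y).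
      by rewrite /partial1of2 derive1E; have [_ ->] := dfh _ _ x0 hy.
    have [fxh _ /andP[l u]] := gf xh.
    have f'0 : 0 <= derive1 f (x * h y).
      have : 0 <= x * h y * derive1 f (x * h y) by rewrite (le_trans _ l)// mulr_ge0.
      by rewrite pmulr_rge0.
    rewrite ger0_norm ?mulr_ge0//.
    have ub : x * (derive1 f (x * h y) * h y) <= e2 * f ((2 * t) * h y).
      apply: le_trans (_ : e2 * f (x * h y) <= _); first by move: u; lra.
      by rewrite ler_wpM2l// hf// ?ltW// ltr_pM2r.
    have A0 : 0 <= derive1 f (x * h y) * h y by rewrite mulr_ge0.
    have : t / 2 * (derive1 f (x * h y) * h y) <= x * (derive1 f (x * h y) * h y).
      by rewrite ler_wpM2r// ltW.
    move=> tA; rewrite /D [leRHS]mulrA [leRHS]mulrC ler_wpM2l// mulrAC ler_pdivlMr//.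
    by move: ub tA; lra.
- move=> x y x0 xy; have y0 := lt_le_trans x0 xy.
  rewrite ![_ * _ `^ _]mulrC -!Rmul//.
  apply: le_Rintegral => //; [exact: intZ|exact: intZ|] => z _.
  rewrite !mulrA ler_wpM2r//.
  have := h0 z; rewrite le_eqVlt => /predU1P[<-|hz]; first by rewrite !mulr0 f0 !mulr0.
  rewrite -(@ler_pM2r _ (h z `^ (- e1))) ?powR_gt0//.
  have xhz : 0 < x * h z by rewrite mulr_gt0.
  have xyz : x * h z <= y * h z by rewrite ler_pM2r.
  have := growth_powR_nondecr gf xhz xyz.
  by rewrite !powRM ?(ltW x0) ?(ltW y0) ?(ltW hz)// !mulrA ![f _ * _]mulrC.
- move=> x y x0 xy; have y0 := lt_le_trans x0 xy.
  rewrite ![_ * _ `^ _]mulrC -!Rmul//.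
  apply: le_Rintegral => //; [exact: intZ|exact: intZ|] => z _.
  rewrite !mulrA ler_wpM2r//.
  have := h0 z; rewrite le_eqVlt => /predU1P[<-|hz]; first by rewrite !mulr0 f0 !mulr0.
  rewrite -(@ler_pM2r _ (h z `^ (- e2))) ?powR_gt0//.
  have xhz : 0 < x * h z by rewrite mulr_gt0.
  have xyz : x * h z <= y * h z by rewrite ler_pM2r.
  have := growth_powR_nonincr gf xhz xyz.
  by rewrite !powRM ?(ltW x0) ?(ltW y0) ?(ltW hz)// !mulrA ![f _ * _]mulrC.
Qed.

End growth.

End modular.
Arguments modular_integrand_ge0 {R d T w h} w0 h0 {f} hf f0 {t} x.
Arguments modular_integrable {R d T mu w h} w0 h0 mw mh {f} hf f0 {t}.
Arguments modular_le {R d T mu w h} w0 h0 mw mh {f1 f2 c t1 t2}.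
Arguments modular_lty {R d T mu w h} w0 h0 mw mh {f e1 e2} e10 f0 gf {t1 t2}.
Arguments growth_modular {R d T mu w h} w0 h0 mw mh {f e1 e2} e10 e20 f0 gf.

(** * Measurability *)

Section measurability.
Context {R : realType} (N : nat).
Local Notation T := (Rtuple R N).

(** A continuous function is the pointwise limit of its compositions with the
    rounding of the coordinates to multiples of [1 / (n + 1)], which take
    countably many values on measurable cells. *)
Lemma Rcontinuous_measurable (F : T -> R) :
  Rcontinuous F -> measurable_fun setT F.
Proof.
move=> cF.
pose row_to (r : 'rV[R]_N) : T := [tuple (r ord0 i : measurableTypeR R) | i < N].
pose Q n (c : {ffun 'I_N -> int}) : 'rV[R]_N := \row_i ((c i)%:~R / n.+1%:R).
pose k n (x : T) : {ffun 'I_N -> int} := [ffun i => Num.floor (n.+1%:R * (tnth x i : R))].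
pose Fn n x := F (row_to (Q n (k n x))).
apply: (@measurable_fun_cvg _ _ _ _ Fn).
- move=> n _ Y mY; rewrite setTI.
  rewrite (_ : Fn n @^-1` Y = \bigcup_c (if `[< Y (F (row_to (Q n c))) >] then [set x | k n x = c] else set0)); last first.
    apply/seteqP; split => [x /= Yx|x [c _]].
      by exists (k n x) => //; case: asboolP.
    case: asboolP => //= Yc kc; rewrite /= in kc.
    by rewrite /Fn /= kc.
  apply: countable_bigcupT_measurable; first exact: countableP.
  move=> c; case: ifP => _ //.
  rewrite (_ : mkset _ = \bigcap_(i in [set: 'I_N])
      ((fun x : T => tnth x i) @^-1` `[(c i)%:~R / n.+1%:R, (c i + 1)%:~R / n.+1%:R[)).
    apply: fin_bigcap_measurable => // i _.
    by rewrite -[X in measurable X]setTI; exact: measurable_tnth.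
  have n0 : 0 < n.+1%:R :> R by rewrite ltr0n.
  apply/seteqP; split => x /=.
    move=> kc i _ /=; rewrite in_itv/= -kc ffunE.
    rewrite ler_pdivrMr// mulrC floor_le//=.
    by rewrite ltr_pdivlMr// mulrC floorD1_gt.
  move=> H; apply/ffunP => i; rewrite ffunE; apply: floor_def.
  have := H i I; rewrite /= in_itv/= ler_pdivrMr// ltr_pdivlMr//.
  by rewrite mulrC.
- move=> x _.
  pose r : 'rV[R]_N := \row_i (tnth x i : R).
  have Fr : F x = F (row_to r).
    by congr F; apply: eq_from_tnth => i; rewrite tnth_mktuple mxE.
  rewrite Fr; apply: (@cvg_comp _ _ _ (fun n => Q n (k n x)) (F \o row_to) _ (nbhs r)); last exact: cF.
  apply/cvg_ballP => e e0.
  near=> n; split => // i j.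
  rewrite /ball/= !mxE ffunE.
  have n0 : 0 < n.+1%:R :> R by rewrite ltr0n.
  have ne : n.+1%:R^-1 < e by near: n; exact: near_infty_natSinv_lt (PosNum e0).
  set y : R := tnth x j.
  rewrite (_ : y - _ = (n.+1%:R * y - (Num.floor (n.+1%:R * y))%:~R) / n.+1%:R); last first.
    by field; rewrite gt_eqF.
  rewrite ger0_norm ?divr_ge0 ?subr_ge0 ?floor_le//.
  apply: lt_trans ne; rewrite ltr_pdivrMr// mulVf ?gt_eqF//.
  by rewrite ltrBlDr -(intrD _ 1) addrC floorD1_gt.
Unshelve. all: by end_near. Qed.

Lemma measurable_Rdist : measurable_fun setT (fun z : T * T => Rdist z.1 z.2).
Proof.
rewrite (_ : (fun _ => _) = (fun x => powR x 2^-1) \o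
    (fun z : T * T => \sum_(i < N) ((tnth z.1 i : R) - tnth z.2 i) ^+ 2)).
  apply: measurableT_comp; first exact: measurable_powR.
  apply: measurable_sum => i; apply: measurable_funX.
  apply: measurable_funB; apply: (measurableT_comp (measurable_tnth i)).
    exact: measurable_fst.
  exact: measurable_snd.
apply/funext => z /=; rewrite powR12_sqrt//.
by apply: sumr_ge0 => i _; exact: sqr_ge0.
Qed.

Lemma Rdist_ge0 (x y : T) : 0 <= Rdist x y.
Proof. exact: sqrtr_ge0. Qed.

Lemma measurable_Ds s (u : T -> R) : measurable_fun setT u ->
  measurable_fun setT (Ds s u).
Proof.
move=> mu; apply: measurable_funM.
  apply: measurable_funB; apply: (measurableT_comp mu).
    exact: measurable_fst.
  exact: measurable_snd.
rewrite (_ : (fun _ => _) = (fun x => powR x (- s)) \o (fun z : T * T => Rdist z.1 z.2)).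
  by apply: measurableT_comp; [exact: measurable_powR|exact: measurable_Rdist].
by apply/funext => z /=; rewrite powRN.
Qed.

Lemma measurable_nu_density : measurable_fun setT (@nu_density R N).
Proof.
rewrite (_ : @nu_density R N = (fun x => powR x (- N%:R)) \o (fun z : T * T => Rdist z.1 z.2)).
  by apply: measurableT_comp; [exact: measurable_powR|exact: measurable_Rdist].
by apply/funext => z /=; rewrite powR_invn// Rdist_ge0.
Qed.

Lemma nu_density_ge0 (z : T * T) : 0 <= nu_density z.
Proof. by rewrite invr_ge0 exprn_ge0// Rdist_ge0. Qed.

Lemma DsZ s c (u : T -> R) z : Ds s (fun x => c * u x) z = c * Ds s u z.
Proof. by rewrite /Ds -mulrBr mulrA. Qed.

End measurability.

(** * The Young function and the space *)

Section young_pair.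
Context {R : realType}.
Implicit Types (phi : R -> R) (ell m t : R).

(** The integrand of [dJ u u] is [Gphi] of the difference quotient. *)
Definition Gphi phi t : R := t * (t * phi t).

(** The consequences of the hypotheses on [phi] on which the argument rests. *)
Record young_pair phi ell m : Prop := YoungPair {
  yp_ell : 1 < ell;
  yp_m : ell <= m;
  yp_Phi : growth ell m (Phi phi);
  yp_G : growth ell m (Gphi phi);
  yp_PhiG : forall t, 0 <= t -> ell * Phi phi t <= Gphi phi t <= m * Phi phi t;
  yp_gt0 : forall t, 0 < t -> 0 < Phi phi t }.

Lemma Phi_norm phi t : Phi phi `|t| = Phi phi t.
Proof. by rewrite /Phi normr_id. Qed.

Lemma Phi0 phi : Phi phi 0 = 0.
Proof. by rewrite /Phi normr0 set_itv1 Rintegral_set1. Qed.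

Lemma Gphi0 phi : Gphi phi 0 = 0.
Proof. by rewrite /Gphi mul0r. Qed.

Lemma young_pair_of_quotient_bounds phi ell m : let g := fun t => t * phi t in
  (forall t, 0 < t -> 0 < phi t) ->
  (forall t, 0 < t -> derivable g t 1 /\ derivable (derive1 g) t 1) ->
  g t @[t --> 0^'+] --> (0 : R) ->
  (forall t1 t2, 0 < t1 -> t1 < t2 -> g t1 < g t2) ->
  (forall t, 0 < t -> derive1 g t != 0) ->
  -1 < ell - 2 ->
  ereal_inf [set (derive1 (derive1 g) t * t / derive1 g t)%:E | t in [set t : R | 0 < t]]
    = (ell - 2)%:E ->
  ereal_sup [set (derive1 (derive1 g) t * t / derive1 g t)%:E | t in [set t : R | 0 < t]]
    = (m - 2)%:E ->
  ell <= m -> young_pair phi ell m.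
Proof.
move=> g phi0 dg cg hg g'0 ell1 infE supE ellm.
have g'gt0 t : 0 < t -> 0 < derive1 g t.
  move=> t0; rewrite lt_neqAle eq_sym g'0//=.
  apply: homo_derive1_ge0 => //; first by move=> x /dg[].
  by move=> x y x0; rewrite le_eqVlt => /predU1P[->//|xy]; exact/ltW/hg.
have gg : growth (ell - 1) (m - 1) g.
  apply: growth_of_second_order => //; [lra|lra| | | ].
  - by move=> t t0; rewrite mulr_ge0 ?(ltW t0)// ltW// phi0.
  - by move=> t /g'gt0/ltW.
  - move=> t t0; have g' := g'gt0 _ t0; apply/andP; split.
      have : ((ell - 2)%:E <= (derive1 (derive1 g) t * t / derive1 g t)%:E)%E.
        by rewrite -infE; apply: ereal_inf_lbound; exists t.
      rewrite lee_fin ler_pdivlMr// (mulrC _ t).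
      by rewrite (_ : ell - 1 - 1 = ell - 2)//; ring.
    have : ((derive1 (derive1 g) t * t / derive1 g t)%:E <= (m - 2)%:E)%E.
      by rewrite -supE; apply: ereal_sup_ubound; exists t.
    rewrite lee_fin ler_pdivrMr// (mulrC _ t).
    by rewrite (_ : m - 1 - 1 = m - 2)//; ring.
have g00 : g 0 = 0 by rewrite /g mul0r.
have e10 : 0 <= ell - 1 by lra.
have hg0 := growth_nneg_homo e10 g00 gg.
have eqPhi t : 0 < t -> \int[lebesgue_measure]_(x in `[0, t]) g x = Phi phi t.
  by move=> t0; rewrite /Phi gtr0_norm.
have gP : growth ell m (Phi phi).
  apply: (growth_eq eqPhi).
  by have := growth_primitive e10 g00 gg; rewrite !subrK.
have PG t : 0 < t -> ell * Phi phi t <= Gphi phi t <= m * Phi phi t.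
  move=> t0; have [_ _] := gP _ t0.
  suff -> : derive1 (Phi phi) t = g t by [].
  have [_ <-] := @is_derive_primitive R g t hg0 t0 (growth_cont gg t0).
  rewrite derive1E; apply: near_eq_derive.
  by near=> x; rewrite eqPhi//; near: x; exact: lt_nbhsr.
split => //; first lra.
- by have := growth_mulid gg; rewrite !subrK.
- move=> t; rewrite le_eqVlt => /predU1P[<-|]; last exact: PG.
  by rewrite Phi0 Gphi0 !mulr0 lexx.
- move=> t t0; have /andP[_] := PG _ t0; have [P0 _ _] := gP _ t0.
  rewrite lt_neqAle P0 andbT eq_sym; case: eqP => //= ->.
  by rewrite mulr0 /Gphi leNgt !mulr_gt0// phi0.
Unshelve. all: by end_near. Qed.

End young_pair.

Section space.
Context {R : realType} {N : nat} (s : R) (phi : R -> R) (V : Rtuple R N -> R)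
  (ell m V0 : R).
Hypothesis yp : young_pair phi ell m.
Hypothesis mV : measurable_fun setT V.
Hypothesis V00 : 0 < V0.
Hypothesis VV0 : forall x, V0 <= V x.
Local Notation T := (Rtuple R N).
Local Notation leb := (lebesgue_tuple R N).
Local Notation leb2 := (leb \x leb)%E.

Let ell0 : 0 <= ell. Proof. by have := yp_ell yp; lra. Qed.
Let m0 : 0 <= m. Proof. exact: le_trans ell0 (yp_m yp). Qed.
Let V_ge0 x : 0 <= V x. Proof. by apply: le_trans (VV0 x); exact: ltW. Qed.

Definition absDs (u : T -> R) z := `|Ds s u z|.
Definition absf (u : T -> R) x := `|u x|.

Definition seminorm_modular (f : R -> R) (u : T -> R) t :=
  modular leb2 (@nu_density R N) (absDs u) f t.
Definition potential_modular (f : R -> R) (u : T -> R) t := modular leb V (absf u) f t.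

(** Both [J] and [dJ] on the ray through [u] are of this form, for [f] equal to
    [Phi phi] and to [Gphi phi]. *)
Definition energy_part (f : R -> R) (u : T -> R) (t : R) : R :=
  \int[leb2]_z (f (t * absDs u z) * nu_density z)
  + \int[leb]_x (f (t * absf u x) * V x).

Lemma measurable_absDs u : measurable_fun setT u -> measurable_fun setT (absDs u).
Proof.
by move=> mu; apply: measurableT_comp => //; exact: measurable_Ds.
Qed.

Lemma measurable_absf u : measurable_fun setT u -> measurable_fun setT (absf u).
Proof. by move=> mu; exact: measurableT_comp. Qed.

Lemma absDs_ge0 u z : 0 <= absDs u z. Proof. exact: normr_ge0. Qed.

Lemma absf_ge0 u x : 0 <= absf u x. Proof. exact: normr_ge0. Qed.

Lemma seminorm_modular_lty f u t1 t2 : f 0 = 0 -> growth ell m f -> measurable_fun setT u ->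
  0 < t1 -> 0 < t2 -> (seminorm_modular f u t1 < +oo)%E -> (seminorm_modular f u t2 < +oo)%E.
Proof.
move=> f0 gf mu; exact: (modular_lty (@nu_density_ge0 R N) (absDs_ge0 u)
  (@measurable_nu_density R N) (measurable_absDs mu) ell0 f0 gf).
Qed.

Let homoP := growth_nneg_homo ell0 (Phi0 phi) (yp_Phi yp).
Let homoG := growth_nneg_homo ell0 (Gphi0 phi) (yp_G yp).

(** As [V] is bounded below, the potential term controls the Orlicz class, and by
    the growth of [Phi] the scale at which the double integral is finite can be
    taken to be 1. *)
Lemma XspaceP u : Xspace s phi V u <->
  [/\ measurable_fun setT u, (seminorm_modular (Phi phi) u 1 < +oo)%E &
      (potential_modular (Phi phi) u 1 < +oo)%E].
Proof.
have mod1E : measurable_fun setT u -> (\int[leb]_x (V x * Phi phi (u x))%:E = potential_modular (Phi phi) u 1)%E.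
  by move=> mu; apply: eq_integral => x _; rewrite mul1r Phi_norm mulrC.
have mod2E k : (0 < k) -> (\int[leb2]_z (Phi phi (Ds s u z / k) * nu_density z)%:E
     = seminorm_modular (Phi phi) u k^-1)%E.
  move=> k0; apply: eq_integral => z _.
  rewrite -Phi_norm normrM.
  by rewrite (ger0_norm (x := k^-1)) ?invr_ge0 ?(ltW k0)// [X in Phi phi X]mulrC.
split.
- move=> [[[mu _] [k k0]]]; rewrite (mod2E _ k0) => fin2; rewrite (mod1E mu) => fin1.
  split; [exact: mu| |exact: fin1].
  have k'0 : 0 < k^-1 by rewrite invr_gt0.
  exact: (seminorm_modular_lty (Phi0 phi) (yp_Phi yp) mu k'0 ltr01 fin2).
- move=> [mu fin2 fin1]; split; last by rewrite (mod1E mu); exact: fin1.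
  split; last first.
    by exists 1; [exact: ltr01|rewrite (mod2E _ ltr01) invr1; exact: fin2].
  split; [exact: mu|exists 1; first exact: ltr01].
  apply: (@le_lt_trans _ _ (V0^-1%:E * potential_modular (Phi phi) u 1)%E); last first.
    apply: lte_mul_pinfty fin1; last exact: fin_numE.
    by rewrite lee_fin invr_ge0 ltW.
  have mP := @measurable_modular R _ _ V (absf u) (absf_ge0 u) mV (measurable_absf mu) _ homoP 1 ler01.
  have mP1 := @measurable_modular R _ _ (cst 1) (absf u) (absf_ge0 u) (measurable_cst _) (measurable_absf mu) _ homoP 1 ler01.
  rewrite /potential_modular /modular -ge0_integralZl//; first last.
  + by rewrite lee_fin invr_ge0 ltW.
  + move=> x _; rewrite lee_fin.
    exact: (modular_integrand_ge0 V_ge0 (absf_ge0 u) homoP (Phi0 phi) x ler01).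
  + exact/measurable_EFinP.
  apply: ge0_le_integral => //.
  + move=> x _; rewrite divr1 -Phi_norm lee_fin -(Phi0 phi).
    exact: homoP.
  + apply/measurable_EFinP; apply: eq_measurable_fun mP1 => x _ /=.
    by rewrite mulr1 mul1r divr1 Phi_norm.
  + by apply: measurable_funeM; exact/measurable_EFinP.
  + move=> x _; rewrite -EFinM lee_fin divr1 mul1r Phi_norm mulrCA mulrC.
    rewrite ler_peMl//; first by rewrite -Phi_norm -(Phi0 phi) homoP.
    by rewrite mulrC ler_pdivlMr// mul1r.
Qed.

End space.

(** * Integrals up to null sets *)

Section integral_ae.
Context {R : realType} d (T : measurableType d) (mu : {measure set T -> \bar R}).
Implicit Types f g : T -> \bar R.
Import HBNNSimple.
Local Open Scope ereal_scope.

Let ge0_le_integral_ae f g : (forall x, 0 <= f x) -> (forall x, 0 <= g x) ->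
  {ae mu, forall x, f x = g x} -> \int[mu]_x f x <= \int[mu]_x g x.
Proof.
move=> f0 g0 [Z [mZ Z0 fgZ]].
rewrite !ge0_integralTE//; apply: ge_ereal_sup => _ [h hf <-].
rewrite -integralT_nnsfun (@ge0_negligible_integral _ _ _ _ _ Z)//; last 2 first.
- exact/measurable_EFinP.
- by move=> x _; rewrite lee_fin.
have mZC : measurable (setT `\` Z) by exact: measurableD.
rewrite integral_nnsfun// (mrestrict h mZC).
apply: ereal_sup_ubound; exists (proj_nnsfun h mZC) => //= x.
rewrite mindicE; case: (asboolP (Z x)) => Zx.
  by rewrite memNset ?mulr0//=; case.
rewrite mem_set//= mulr1; suff <- : f x = g x by exact: hf.
by apply: contrapT => fg; apply: Zx; exact: fgZ.
Qed.

(** Stated for arbitrary functions because the weight is merely Lebesgue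
    measurable, while its representative is Borel: the supremum defining the
    integral is unchanged when simple functions are cut off on a null set. *)
Lemma ae_eq_integralT f g :
  {ae mu, forall x, f x = g x} -> \int[mu]_x f x = \int[mu]_x g x.
Proof.
have H f' g' : (forall x, 0 <= f' x) -> (forall x, 0 <= g' x) ->
    {ae mu, forall x, f' x = g' x} -> \int[mu]_x f' x = \int[mu]_x g' x.
  move=> f0 g0 fg; apply/eqP; rewrite eq_le !ge0_le_integral_ae//.
  by apply: filterS fg => x ->.
move=> fg; rewrite integralE [RHS]integralE; congr (_ - _); apply: H => //.
- by apply: filterS fg => x; rewrite !funeposE => ->.
- by apply: filterS fg => x; rewrite !funenegE => ->.
Qed.

Lemma ae_eq_RintegralT (f g : T -> R) :
  {ae mu, forall x, f x = g x} ->
  (\int[mu]_x f x = \int[mu]_x g x)%R.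
Proof.
move=> fg; rewrite /Rintegral; congr fine; apply: ae_eq_integralT.
by apply: filterS fg => x ->.
Qed.

(** When the integral is infinite, both sides are 0; therefore the lower order
    functionals are homogeneous whether or not they are finite. *)
Lemma Rintegral_ge0_Zl (f : T -> R) (k : R) : measurable_fun setT f ->
  (forall x, 0 <= f x)%R -> (0 <= k)%R ->
  (\int[mu]_x (k * f x) = k * \int[mu]_x f x)%R.
Proof.
move=> mf f0 k0; rewrite /Rintegral.
rewrite (_ : \int[mu]_x (k * f x)%:E = k%:E * \int[mu]_x (f x)%:E); last first.
  rewrite -ge0_integralZl//; first by exact/measurable_EFinP.
  by move=> x _; rewrite lee_fin.
have : 0 <= \int[mu]_x (f x)%:E by apply: integral_ge0 => x _; rewrite lee_fin.
case: (\int[mu]_x _) => //= _.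
move: k0; rewrite le_eqVlt => /predU1P[<-|k0]; first by rewrite mul0e mul0r.
by rewrite gt0_muley ?lte_fin// mulr0.
Qed.

End integral_ae.

(** * The energy along rays *)

Section energy_space.
Context {R : realType} {N : nat} (s : R) (phi : R -> R) (V : Rtuple R N -> R)
  (ell m V0 : R).
Hypothesis yp : young_pair phi ell m.
Hypothesis mV : measurable_fun setT V.
Hypothesis V00 : 0 < V0.
Hypothesis VV0 : forall x, V0 <= V x.
Local Notation T := (Rtuple R N).
Local Notation leb := (lebesgue_tuple R N).
Local Notation leb2 := (leb \x leb)%E.
Local Notation X := (Xspace s phi V).
Local Notation EP := (energy_part s V).
Local Notation XP := (XspaceP s yp mV V00 VV0).

Let ell0 : 0 <= ell. Proof. by have := yp_ell yp; lra. Qed.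
Let m0 : 0 <= m. Proof. exact: le_trans ell0 (yp_m yp). Qed.
Let V_ge0 x : 0 <= V x. Proof. by apply: le_trans (VV0 x); exact: ltW. Qed.
Let homoP := growth_nneg_homo ell0 (Phi0 phi) (yp_Phi yp).
Let homoG := growth_nneg_homo ell0 (Gphi0 phi) (yp_G yp).

Lemma Gphi_modular_lty u : X u ->
  (seminorm_modular s (Gphi phi) u 1 < +oo)%E /\ (potential_modular V (Gphi phi) u 1 < +oo)%E.
Proof.
move=> /XP[mu fin2 fin1].
have GP x : 0 < x -> Gphi phi (1 * x) <= m * Phi phi (1 * x).
  by move=> /ltW x0; rewrite mul1r; have /andP[] := yp_PhiG yp x0.
have H2 : (seminorm_modular s (Gphi phi) u 1 <= m%:E * seminorm_modular s (Phi phi) u 1)%E.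
  exact: (modular_le (@nu_density_ge0 R N) (absDs_ge0 s u)
    (@measurable_nu_density R N) (measurable_absDs s mu) ler01 ler01 m0
    (Gphi0 phi) homoG (Phi0 phi) homoP GP).
have H1 : (potential_modular V (Gphi phi) u 1 <= m%:E * potential_modular V (Phi phi) u 1)%E.
  exact: (modular_le V_ge0 (absf_ge0 u) mV (measurable_absf mu) ler01 ler01 m0
    (Gphi0 phi) homoG (Phi0 phi) homoP GP).
split.
- apply: (le_lt_trans H2); apply: lte_mul_pinfty fin2; last exact: fin_numE.
  by rewrite lee_fin.
- apply: (le_lt_trans H1); apply: lte_mul_pinfty fin1; last exact: fin_numE.
  by rewrite lee_fin.
Qed.

Lemma growth_energy_part_Phi u : X u -> growth ell m (EP (Phi phi) u).
Proof.
move=> /XP[mu fin2 fin1]; apply: growthD.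
- exact: (growth_modular (@nu_density_ge0 R N) (absDs_ge0 s u)
   (@measurable_nu_density R N) (measurable_absDs s mu) ell0 m0 (Phi0 phi) (yp_Phi yp) fin2).
- exact: (growth_modular V_ge0 (absf_ge0 u) mV (measurable_absf mu)
   ell0 m0 (Phi0 phi) (yp_Phi yp) fin1).
Qed.

Lemma growth_energy_part_G u : X u -> growth ell m (EP (Gphi phi) u).
Proof.
move=> Xu; have [fin2 fin1] := Gphi_modular_lty Xu; have /XP[mu _ _] := Xu.
apply: growthD.
- exact: (growth_modular (@nu_density_ge0 R N) (absDs_ge0 s u)
   (@measurable_nu_density R N) (measurable_absDs s mu) ell0 m0 (Gphi0 phi) (yp_G yp) fin2).
- exact: (growth_modular V_ge0 (absf_ge0 u) mV (measurable_absf mu)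
   ell0 m0 (Gphi0 phi) (yp_G yp) fin1).
Qed.

Let int2 f u t : f 0 = 0 -> growth ell m f -> measurable_fun setT u ->
  (seminorm_modular s f u 1 < +oo)%E -> 0 < t ->
  leb2.-integrable setT (EFin \o (fun z => f (t * absDs s u z) * nu_density z)).
Proof.
move=> f0 gf mu fin t0.
apply: (modular_integrable (@nu_density_ge0 R N) (absDs_ge0 s u)
   (@measurable_nu_density R N) (measurable_absDs s mu)
   (growth_nneg_homo ell0 f0 gf) f0 (ltW t0)).
exact: (modular_lty (@nu_density_ge0 R N) (absDs_ge0 s u)
   (@measurable_nu_density R N) (measurable_absDs s mu) ell0 f0 gf ltr01 t0 fin).
Qed.

Let int1 f u t : f 0 = 0 -> growth ell m f -> measurable_fun setT u ->
  (potential_modular V f u 1 < +oo)%E -> 0 < t ->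
  leb.-integrable setT (EFin \o (fun x => f (t * absf u x) * V x)).
Proof.
move=> f0 gf mu fin t0.
apply: (modular_integrable V_ge0 (absf_ge0 u) mV (measurable_absf mu)
   (growth_nneg_homo ell0 f0 gf) f0 (ltW t0)).
exact: (modular_lty V_ge0 (absf_ge0 u) mV (measurable_absf mu)
   ell0 f0 gf ltr01 t0 fin).
Qed.

Lemma energy_part_PhiG u t : X u -> 0 < t ->
  ell * EP (Phi phi) u t <= EP (Gphi phi) u t <= m * EP (Phi phi) u t.
Proof.
move=> Xu t0; have [G2 G1] := Gphi_modular_lty Xu; have /XP[mu P2 P1] := Xu.
have iG2 := int2 (Gphi0 phi) (yp_G yp) mu G2 t0.
have iG1 := int1 (Gphi0 phi) (yp_G yp) mu G1 t0.
have iP2 := int2 (Phi0 phi) (yp_Phi yp) mu P2 t0.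
have iP1 := int1 (Phi0 phi) (yp_Phi yp) mu P1 t0.
have iZ2 c : leb2.-integrable setT (EFin \o (fun z => c * (Phi phi (t * absDs s u z) * nu_density z))).
  exact: (integrableZl measurableT c iP2).
have iZ1 c : leb.-integrable setT (EFin \o (fun x => c * (Phi phi (t * absf u x) * V x))).
  exact: (integrableZl measurableT c iP1).
have tD z : 0 <= t * absDs s u z by rewrite mulr_ge0 ?absDs_ge0 ?ltW.
have tu x : 0 <= t * absf u x by rewrite mulr_ge0 ?absf_ge0 ?ltW.
rewrite /EP !mulrDr -!RintegralZl//.
apply/andP; split; apply: lerD; apply: le_Rintegral => // z _; rewrite mulrA ler_wpM2r ?nu_density_ge0//.
- by have /andP[] := yp_PhiG yp (tD z).
- by have /andP[] := yp_PhiG yp (tu z).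
- by have /andP[] := yp_PhiG yp (tD z).
- by have /andP[] := yp_PhiG yp (tu z).
Qed.

Lemma absDsZ (u : T -> R) c z : 0 <= c -> absDs s (fun x => c * u x) z = c * absDs s u z.
Proof. by move=> c0; rewrite /absDs DsZ normrM ger0_norm. Qed.

Lemma absfZ (u : T -> R) c x : 0 <= c -> absf (fun x => c * u x) x = c * absf u x.
Proof. by move=> c0; rewrite /absf normrM ger0_norm. Qed.

Lemma energy_partZ f (u : T -> R) c t : 0 <= c -> EP f (fun x => c * u x) t = EP f u (t * c).
Proof.
move=> c0; rewrite /EP; congr (_ + _); apply: eq_Rintegral => z _.
- by rewrite absDsZ// mulrA.
- by rewrite absfZ// mulrA.
Qed.

Lemma XspaceZ u c : X u -> 0 < c -> X (fun x => c * u x).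
Proof.
move=> /XP[mu P2 P1] c0; have c0' := ltW c0; apply/XP; split.
- exact: measurable_funM.
- rewrite (_ : seminorm_modular _ _ _ _ = seminorm_modular s (Phi phi) u c).
    exact: (modular_lty (@nu_density_ge0 R N) (absDs_ge0 s u)
     (@measurable_nu_density R N) (measurable_absDs s mu) ell0 (Phi0 phi) (yp_Phi yp) ltr01 c0 P2).
  by apply: eq_integral => z _; rewrite absDsZ// mul1r.
- rewrite (_ : potential_modular _ _ _ _ = potential_modular V (Phi phi) u c).
    exact: (modular_lty V_ge0 (absf_ge0 u) mV (measurable_absf mu)
      ell0 (Phi0 phi) (yp_Phi yp) ltr01 c0 P1).
  by apply: eq_integral => z _; rewrite absfZ// mul1r.
Qed.

Lemma J_energy_part u t : X u -> 0 < t ->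
  J s phi V (fun x => t * u x) = (EP (Phi phi) u t)%:E.
Proof.
move=> /XP[mu P2 P1] t0.
have iP2 := int2 (Phi0 phi) (yp_Phi yp) mu P2 t0.
have iP1 := int1 (Phi0 phi) (yp_Phi yp) mu P1 t0.
rewrite /J /EP EFinD /Rintegral; congr (_ + _)%E.
- rewrite fineK; last exact: integrable_fin_num iP2.
  by apply: eq_integral => z _; rewrite -absDsZ ?ltW// Phi_norm.
- rewrite fineK; last exact: integrable_fin_num iP1.
  by apply: eq_integral => z _; rewrite -absfZ ?ltW// Phi_norm mulrC.
Qed.

Lemma dJ_energy_part u c : X u -> 0 < c ->
  dJ s phi V (fun x => c * u x) u = EP (Gphi phi) u c / c.
Proof.
move=> Xu c0; have [G2 G1] := Gphi_modular_lty Xu; have /XP[mu _ _] := Xu.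
have iG2 := int2 (Gphi0 phi) (yp_G yp) mu G2 c0.
have iG1 := int1 (Gphi0 phi) (yp_G yp) mu G1 c0.
have key x : phi `|c * x| * (c * x) * x = c^-1 * Gphi phi (c * `|x|).
  rewrite normrM (gtr0_norm c0) /Gphi.
  rewrite [RHS](_ : _ = phi (c * `|x|) * c * `|x| ^+ 2); last first.
    by field; rewrite gt_eqF.
  by rewrite real_normK ?num_real//; ring.
rewrite /EP mulrC mulrDr -!RintegralZl//; congr (_ + _).
- by apply: eq_Rintegral => z _; rewrite DsZ key mulrA.
- by apply: eq_Rintegral => x _; rewrite mulrA -key; ring.
Qed.

End energy_space.

(** * Roots of the fibre equation *)

Section fibering.
Context {R : realType}.
Implicit Types (A : R -> R) (e K t mu : R).

Lemma powR_large e K : 0 < e -> exists2 K0, 1 <= K0 & forall t, K0 <= t -> K <= t `^ e.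
Proof.
move=> e0; pose M := Num.max 1 K; have M1 : 1 <= M by rewrite le_max lexx.
have M0 : 0 <= M by exact: le_trans M1.
have e'0 : 0 <= e^-1 by rewrite invr_ge0 ltW.
exists (M `^ e^-1).
  have : 1 `^ e^-1 <= M `^ e^-1 by apply: ge0_ler_powR; rewrite ?nnegrE.
  by rewrite powR1.
move=> t Mt; apply: (@le_trans _ _ M); first by rewrite le_max lexx orbT.
have -> : M = (M `^ e^-1) `^ e by rewrite -powRrM mulVf ?gt_eqF// powRr1.
have M'0 := powR_ge0 M e^-1.
by apply: ge0_ler_powR => //; rewrite ?nnegrE ?(ltW e0)// (le_trans M'0).
Qed.

Lemma powR_small e K : 0 < e -> 0 < K ->
  exists2 d, 0 < d <= 1 & forall t, 0 < t -> t <= d -> t `^ e <= K.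
Proof.
move=> e0 K0; have [D D1 HD] := powR_large K^-1 e0.
have D0 : 0 < D by exact: lt_le_trans D1.
exists D^-1; first by rewrite invr_gt0 D0 invf_le1.
move=> t t0 tD; have := HD t^-1; rewrite -[D]invrK lef_pV2 ?posrE ?invr_gt0// => /(_ tD).
rewrite -(powR_inv1 (ltW t0)) -powRrM mulN1r powRN lef_pV2 ?posrE ?powR_gt0//.
Qed.

Section fiber.
Variables (A B : R -> R) (ell m q p lambda P Q : R).
Hypotheses (ell1 : 1 < ell) (ellm : ell <= m) (mq : m < q) (qp : q < p).
Hypotheses (lambda0 : 0 < lambda) (P0 : 0 < P) (Q0 : 0 < Q).
Hypotheses (gA : growth ell m A) (A1 : 0 < A 1).
Hypothesis BA : forall t, 0 < t -> ell * B t <= A t.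

Let F t := (A t + lambda * t `^ p * P) * t `^ (- q).

Let F_cont a b : 0 < a -> {within `[a, b], continuous F}.
Proof.
move=> a0; apply: derivable_within_continuous => x; rewrite in_itv/= => /andP[ax _].
have x0 : 0 < x by exact: lt_le_trans ax.
have d1 := is_derive_growth gA x0.
have d2 := is_derive1_powR p x0.
have d3 := is_derive1_powR (- q) x0.
have d4 := is_deriveM (is_deriveD d1 (@is_deriveZ _ _ _ (fun t => t `^ p) (lambda * P) x 1 _ d2)) d3.
have -> : F = (A + (lambda * P) \*: (fun t => t `^ p)) * (fun t => t `^ (- q)).
  by apply/funext => t; rewrite /F mulrAC.
by case: d4.
Qed.

Let FE t mu : 0 < t -> F t = mu * Q -> A t + lambda * t `^ p * P = mu * t `^ q * Q.
Proof.
move=> t0; rewrite /F powRN => /(congr1 (fun x => x * t `^ q)).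
by rewrite divfK ?gt_eqF ?powR_gt0// => ->; rewrite mulrAC.
Qed.

(** Divided by [t ^ q], the left-hand side of the fibre equation tends to infinity
    at 0 because [m < q]; the intermediate value theorem gives a root, and there
    [A] dominates [t ^ p] because [m < p]. *)
Lemma fiber_root_small d : 0 < d -> exists M, forall mu, M < mu ->
  exists t, [/\ 0 < t <= d, A t + lambda * t `^ p * P = mu * t `^ q * Q &
    t * derive1 A t - q * A t + lambda * (p - q) * t `^ p * P < 0].
Proof.
move=> d0.
have c0 : 0 < lambda * (p - q) * P by rewrite !mulr_gt0// subr_gt0.
have pm0 : 0 < p - m by rewrite subr_gt0 (lt_trans mq).
have qm0 : 0 < q - m by rewrite subr_gt0.
have c1 : 0 < (q - m) * A 1 / (lambda * (p - q) * P) / 2 by rewrite !divr_gt0// mulr_gt0.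
have [d1 /andP[d10 d11] Hd1] := @powR_small (p - m) ((q - m) * A 1 / (lambda * (p - q) * P) / 2)
   pm0 c1.
pose d2 := Num.min d d1.
have d20 : 0 < d2 by rewrite lt_min d0.
exists (F d2 / Q) => mu; rewrite ltr_pdivrMr// => Fmu.
have [K K1 HK] := @powR_large (q - m) (mu * Q / A 1) qm0.
have K0 : 0 < K by exact: lt_le_trans K1.
(* At t1 the function F is at least mu * Q, by the lower bound t ^ m * A 1 for
   A, and at d2 it is below. *)
pose t1 := Num.min d2 K^-1.
have t10 : 0 < t1 by rewrite lt_min d20 invr_gt0.
have t11 : t1 <= 1 by rewrite ge_min invf_le1// K1 orbT.
have Alow t : 0 < t -> t <= 1 -> t `^ m * A 1 <= A t.
  move=> t0 t1'; have := growth_scale_le1 gA (_ : 0 < t <= 1) ltr01.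
  by rewrite mulr1 t0 t1' => /(_ isT) /andP[].
have Ft1 : mu * Q <= F t1.
  have : mu * Q / A 1 <= t1^-1 `^ (q - m).
    by apply: HK; rewrite -[K]invrK lef_pV2 ?posrE ?invr_gt0// ge_min lexx orbT.
  rewrite ler_pdivrMr// => /le_trans; apply.
  rewrite -(powR_inv1 (ltW t10)) -powRrM mulN1r opprB.
  rewrite powRB ?(gt_eqF t10) ?implybT// -powRN mulrAC ler_pM2r ?powR_gt0//.
  by apply: (le_trans (Alow _ t10 t11)); rewrite lerDl !mulr_ge0 ?powR_ge0// ltW.
have t1d2 : t1 <= d2 by rewrite ge_min lexx.
have Fb : Num.min (F t1) (F d2) <= mu * Q <= Num.max (F t1) (F d2).
  by rewrite ge_min le_max Ft1 (ltW Fmu) orbT.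
have [t + Ft] := IVT t1d2 (F_cont t10) Fb.
rewrite in_itv/= => /andP[t1t td2]; have t0 : 0 < t by exact: lt_le_trans t1t.
have td1 : t <= d1 by apply: le_trans td2 _; rewrite ge_min lexx orbT.
exists t; split.
- by rewrite t0 (le_trans td2)// ge_min lexx.
- exact: FE.
have [_ _ /andP[_ gu]] := gA t0.
have hA := Alow _ t0 (le_trans td1 d11).
have tm0 : 0 < t `^ m by rewrite powR_gt0.
have : t `^ p <= (q - m) * A 1 / (lambda * (p - q) * P) / 2 * t `^ m.
  have -> : t `^ p = t `^ (p - m) * t `^ m.
    by rewrite -powRD ?subrK// (gt_eqF t0) implybT.
  by rewrite ler_pM2r// Hd1.
rewrite -(@ler_pM2l _ (lambda * (p - q) * P))// => h.
have e : lambda * (p - q) * P * ((q - m) * A 1 / (lambda * (p - q) * P) / 2 * t `^ m) = (q - m) / 2 * (t `^ m * A 1).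
  by field; rewrite ?gt_eqF// subr_gt0.
rewrite e in h.
have : (q - m) / 2 * (t `^ m * A 1) <= (q - m) / 2 * A t.
  by rewrite ler_pM2l// divr_gt0// subr_gt0.
have At0 : 0 < A t by apply: lt_le_trans hA; rewrite mulr_gt0.
have : 0 < (q - m) * A t by rewrite mulr_gt0// subr_gt0.
move: h gu; lra.
Qed.

(** Far from the origin [t ^ p] dominates [A]. At a root, [mu * Q] is then at most
    twice [lambda * P * t ^ (p - q)], which bounds [t] below by a multiple of
    [mu ^ (1 / (p - q))], and the energy is at most a negative multiple of
    [t ^ p]. *)
Lemma fiber_root_large : exists M c, 0 < c /\ forall mu, M < mu ->
  exists t, [/\ 0 < t, A t + lambda * t `^ p * P = mu * t `^ q * Q,
    0 < t * derive1 A t - q * A t + lambda * (p - q) * t `^ p * P &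
    B t - mu / q * (t `^ q * Q) + lambda / p * (t `^ p * P)
      <= - c * mu `^ (p / (p - q))].
Proof.
have [x1 x2 x3 x4] := And4 ell1 ellm mq qp.
have q0 : 0 < q by lra.
have p0 : 0 < p by lra.
have LP : 0 < lambda * P by exact: mulr_gt0.
have pm0 : 0 < p - m by rewrite subr_gt0 (lt_trans mq).
have pq0 : 0 < p - q by rewrite subr_gt0.
pose k := q^-1 - p^-1.
have k0 : 0 < k by rewrite subr_gt0 ltf_pV2.
(* Beyond K1 the second derivative is positive, beyond K2 the term in A is at
   most that in P, and beyond K3 half of the leading term absorbs B. *)
have [K1 K11 HK1] := @powR_large (p - m) (q * A 1 / (lambda * P * (p - q)) + 1) pm0.
have [K2 K21 HK2] := @powR_large (p - m) (A 1 / (lambda * P)) pm0.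
have [K3 K31 HK3] := @powR_large (p - m) (2 * A 1 / (lambda * P * k)) pm0.
pose K := Num.max K1 (Num.max K2 K3).
have K_1 : 1 <= K by rewrite le_max K11.
have K0 : 0 < K by exact: lt_le_trans K_1.
exists (Num.max 0 (F K / Q)), (k * lambda * P / 2 * (Q / (2 * (lambda * P))) `^ (p / (p - q))).
split; first by rewrite !mulr_gt0 ?powR_gt0 ?invr_gt0// divr_gt0// mulr_gt0.
move=> mu; rewrite gt_max => /andP[mu0]; rewrite ltr_pdivrMr// => Fmu.
have Aup t : 1 <= t -> A t <= t `^ m * A 1.
  by move=> t1; have := growth_scale_ge1 gA t1 ltr01; rewrite mulr1 => /andP[].
have A0 t : 0 < t -> 0 <= A t by move=> t0; have [] := gA t0.
have [L L1 HL] := @powR_large (p - q) (mu * Q / (lambda * P)) pq0.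
pose t2 := Num.max K L.
have Kt2 : K <= t2 by rewrite le_max lexx.
have t20 : 0 < t2 by exact: lt_le_trans Kt2.
have pqE t : 0 < t -> t `^ p * t `^ (- q) = t `^ (p - q).
  by move=> t0; rewrite -powRD// (gt_eqF t0) implybT.
have Ft2 : mu * Q <= F t2.
  have : mu * Q / (lambda * P) <= t2 `^ (p - q) by apply: HL; rewrite le_max lexx orbT.
  rewrite ler_pdivrMr// => /le_trans; apply.
  rewrite /F mulrDl (mulrAC _ (t2 `^ p)) -(mulrA (lambda * P)) pqE// mulrC.
  by rewrite lerDr mulr_ge0 ?powR_ge0 ?A0.
have Fb : Num.min (F K) (F t2) <= mu * Q <= Num.max (F K) (F t2).
  by rewrite ge_min le_max Ft2 (ltW Fmu) orbT.
have [t + Ft] := IVT Kt2 (F_cont K0) Fb.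
rewrite in_itv/= => /andP[Kt _]; have t0 : 0 < t by exact: lt_le_trans Kt.
have t1 : 1 <= t by exact: le_trans Kt.
have h1 := HK1 t (le_trans _ Kt); rewrite le_max lexx in h1; have {}h1 := h1 isT.
have h2 := HK2 t (le_trans _ Kt); rewrite !le_max lexx orbT in h2; have {}h2 := h2 isT.
have h3 := HK3 t (le_trans _ Kt); rewrite !le_max lexx !orbT in h3; have {}h3 := h3 isT.
have tm0 : 0 < t `^ m by rewrite powR_gt0.
have pmE : t `^ p = t `^ (p - m) * t `^ m.
  by rewrite -powRD ?subrK// (gt_eqF t0) implybT.
have eqt := FE t0 Ft.
have At := Aup _ t1.
exists t; split => //.
- have [_ _ /andP[gl _]] := gA t0.
  have c0 : 0 < lambda * P * (p - q) by rewrite mulr_gt0// subr_gt0.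
  have : q * A 1 < lambda * P * (p - q) * t `^ (p - m).
    by rewrite -ltr_pdivrMl// mulrC; apply: lt_le_trans h1; rewrite ltrDl.
  rewrite -(ltr_pM2r tm0) -[X in _ < X -> _]mulrA -pmE => h.
  have : q * A t <= q * (t `^ m * A 1) by rewrite ler_pM2l.
  have : 0 <= ell * A t by rewrite mulr_ge0 ?A0//; lra.
  by move: h gl; lra.
- have Bt : B t <= A t.
    have := BA t0; have := A0 _ t0 => At0 BAt.
    have [Bt0|Bt0] := leP (B t) 0; first by lra.
    apply: le_trans BAt; rewrite ler_peMl ?(ltW Bt0)//; lra.
  have muq : mu / q * (t `^ q * Q) = (A t + lambda * t `^ p * P) / q by rewrite eqt; ring.
  have e1 : 2 * A 1 * t `^ m <= lambda * P * k * t `^ p.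
    move: h3; rewrite ler_pdivrMr ?mulr_gt0// -(ler_pM2r tm0) => /le_trans; apply.
    by rewrite pmE (mulrC (t `^ (p - m))) -!mulrA.
  have Aq : 0 <= A t / q by rewrite divr_ge0 ?A0// ltW.
  have low : k * lambda * P / 2 * t `^ p <= - (B t - mu / q * (t `^ q * Q) + lambda / p * (t `^ p * P)).
    rewrite muq; have -> : - (B t - (A t + lambda * t `^ p * P) / q + lambda / p * (t `^ p * P)) =
       k * lambda * P * t `^ p - B t + A t / q by rewrite /k; ring.
    by move: Bt At e1 Aq; lra.
  rewrite mulNr lerNr; apply: le_trans low.
  rewrite -(mulrA (k * lambda * P / 2)) ler_pM2l; last by rewrite divr_gt0// !mulr_gt0.
  have up : mu * Q <= 2 * (lambda * P) * t `^ (p - q).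
    rewrite -Ft /F mulrDl.
    have -> : lambda * t `^ p * P * t `^ (- q) = lambda * P * t `^ (p - q).
      by rewrite -pqE//; ring.
    rewrite -(mulrA 2) mulr_natl mulr2n lerD2r -pqE// mulrA ler_pM2r ?powR_gt0//.
    apply: (le_trans At); rewrite pmE mulrA mulrC ler_pM2r//.
    by rewrite -ler_pdivrMl// mulrC.
  have -> : t `^ p = (t `^ (p - q)) `^ (p / (p - q)).
    by rewrite -powRrM mulrCA divff ?mulr1// gt_eqF.
  have LP2 : 0 < 2 * (lambda * P) by rewrite mulr_gt0.
  have s1 : 0 <= Q / (2 * (lambda * P)) by rewrite divr_ge0 ?ltW.
  rewrite -powRM ?(ltW mu0)//.
  apply: ge0_ler_powR; rewrite ?nnegrE ?powR_ge0 ?(mulr_ge0 _ (ltW mu0))//.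
    by rewrite divr_ge0 ?(ltW p0) ?(ltW pq0).
  by rewrite mulrAC ler_pdivrMr// [leLHS]mulrC [leRHS]mulrC.
Qed.

End fiber.
End fibering.

(** * Nehari sets along rays *)

Section power_terms.
Context {R : realType}.

Lemma powR_dilation (r c x : R) : 1 < r -> 0 < c ->
  `|c * x| `^ (r - 2) * (c * x) * x = c `^ (r - 1) * `|x| `^ r.
Proof.
move=> r1 c0; have r0 : r != 0 by rewrite gt_eqF// (lt_trans ltr01).
have [->|x0] := eqVneq x 0; first by rewrite !mulr0 normr0 powR0// mulr0.
have nx : 0 < `|x| by rewrite normr_gt0.
rewrite normrM (gtr0_norm c0) powRM ?(ltW c0)//.
have -> : c `^ (r - 1) = c `^ (r - 2) * c.
  rewrite -[X in _ = _ * X](powRr1 (ltW c0)) -powRD ?(gt_eqF c0) ?implybT//.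
  by congr powR; ring.
have -> : `|x| `^ r = `|x| `^ (r - 2) * x ^+ 2.
  rewrite -(real_normK (num_real x)) -powR_mulrn// -powRD ?subrK//.
  by rewrite (gt_eqF nx) implybT.
by ring.
Qed.

Context d (T : measurableType d) (mu : {measure set T -> \bar R}).
Variables (u : T -> R) (mu_ : measurable_fun setT u).

Lemma measurable_norm_powR (r : R) : measurable_fun setT (fun x => `|u x| `^ r).
Proof.
apply: (measurableT_comp (measurable_powR r)).
exact: measurableT_comp.
Qed.

(** The weight is replaced by its Borel representative [b] before scaling. *)
Lemma Rintegral_dilation (a b : T -> R) (r c : R) :
  {ae mu, forall x, a x = b x} -> measurable_fun setT b -> (forall x, 0 <= b x) ->
  1 < r -> 0 < c ->
  \int[mu]_x (a x * `|c * u x| `^ (r - 2) * (c * u x) * u x)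
  = c `^ (r - 1) * \int[mu]_x (a x * `|u x| `^ r).
Proof.
move=> ab mb b0 r1 c0.
rewrite (_ : \int[mu]_x (a x * `|u x| `^ r) = \int[mu]_x (b x * `|u x| `^ r)); last first.
  by apply: ae_eq_RintegralT; apply: filterS ab => x ->.
rewrite -Rintegral_ge0_Zl; last 3 first.
- by apply: measurable_funM => //; exact: measurable_norm_powR.
- by move=> x; rewrite mulr_ge0 ?powR_ge0.
- exact: powR_ge0.
apply: ae_eq_RintegralT; apply: filterS ab => x ->.
rewrite [RHS]mulrCA -(powR_dilation (u x) r1 c0) -!mulrA; exact: erefl.
Qed.

Lemma Rintegral_norm_powRZ (a b : T -> R) (r c : R) :
  {ae mu, forall x, a x = b x} -> measurable_fun setT b -> (forall x, 0 <= b x) ->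
  0 < c ->
  \int[mu]_x (a x * `|c * u x| `^ r) = c `^ r * \int[mu]_x (a x * `|u x| `^ r).
Proof.
move=> ab mb b0 c0.
rewrite (_ : \int[mu]_x (a x * `|u x| `^ r) = \int[mu]_x (b x * `|u x| `^ r)); last first.
  by apply: ae_eq_RintegralT; apply: filterS ab => x ->.
rewrite -Rintegral_ge0_Zl; last 3 first.
- by apply: measurable_funM => //; exact: measurable_norm_powR.
- by move=> x; rewrite mulr_ge0 ?powR_ge0.
- exact: powR_ge0.
apply: ae_eq_RintegralT; apply: filterS ab => x ->.
rewrite normrM (gtr0_norm c0) (powRM _ (ltW c0) (normr_ge0 _)); exact: mulrCA.
Qed.

End power_terms.

Section ray.
Context {R : realType} {N : nat} (s : R) (phi : R -> R)
  (V a b : Rtuple R N -> R) (ell m V0 q p : R).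
Hypothesis yp : young_pair phi ell m.
Hypothesis mV : measurable_fun setT V.
Hypothesis V00 : 0 < V0.
Hypothesis VV0 : forall x, V0 <= V x.
Hypothesis ab : {ae lebesgue_tuple R N, forall x, a x = b x}.
Hypothesis mb : measurable_fun setT b.
Hypothesis b0 : forall x, 0 <= b x.
Hypotheses (q1 : 1 < q) (p1 : 1 < p).
Local Notation T := (Rtuple R N).
Local Notation leb := (lebesgue_tuple R N).
Local Notation X := (Xspace s phi V).
Local Notation EP := (energy_part s V).
Local Notation XP := (XspaceP s yp mV V00 VV0).
Local Notation Qu := (normqa_q a q).
Local Notation Pu := (normp_p p).

Let one_ae : {ae leb, forall x, (cst 1 : T -> R) x = cst 1 x}.
Proof. exact: aeW. Qed.

Let PuE u : Pu u = \int[leb]_x ((cst 1 : T -> R) x * `|u x| `^ p).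
Proof. by apply: eq_Rintegral => x _; rewrite mul1r. Qed.

Lemma denergy_ray lambda mu u c : X u -> 0 < c ->
  denergy s phi V a q p lambda mu (fun x => c * u x) u =
  EP (Gphi phi) u c / c - mu * (c `^ (q - 1) * Qu u) + lambda * (c `^ (p - 1) * Pu u).
Proof.
move=> Xu c0; have /XP[mu_ _ _] := Xu.
rewrite /denergy (dJ_energy_part yp mV V00 VV0 Xu c0); congr (_ - _ * _ + _ * _).
  exact: (Rintegral_dilation mu_ ab mb b0 q1 c0).
rewrite PuE -(Rintegral_dilation mu_ one_ae (measurable_cst _) (fun=> ler01) p1 c0).
by apply: eq_Rintegral => x _; rewrite mul1r.
Qed.

Lemma normp_pZ u c : X u -> 0 < c -> Pu (fun x => c * u x) = c `^ p * Pu u.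
Proof.
move=> /XP[mu_ _ _] c0; rewrite !PuE.
exact: (Rintegral_norm_powRZ mu_ p one_ae (measurable_cst _) (fun=> ler01) c0).
Qed.

Lemma normqa_qZ u c : X u -> 0 < c -> Qu (fun x => c * u x) = c `^ q * Qu u.
Proof.
by move=> /XP[mu_ _ _] c0; exact: (Rintegral_norm_powRZ mu_ q ab mb b0 c0).
Qed.

Let oneM (u : T -> R) : u = (fun x => 1 * u x).
Proof. by apply/funext => x; rewrite mul1r. Qed.

Lemma denergy_diag lambda mu u : X u ->
  denergy s phi V a q p lambda mu u u =
  EP (Gphi phi) u 1 - mu * Qu u + lambda * Pu u.
Proof.
move=> Xu; rewrite [in LHS](oneM u) -[X in denergy _ _ _ _ _ _ _ _ _ X](oneM u).
by rewrite denergy_ray// !powR1 !mul1r divr1.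
Qed.

Lemma energy_diag lambda mu u : X u ->
  energy s phi V a q p lambda mu u =
  EP (Phi phi) u 1 - mu / q * Qu u + lambda / p * Pu u.
Proof.
move=> Xu; rewrite /energy; congr (_ - _ + _).
by rewrite {1}(oneM u) (J_energy_part yp mV V00 VV0 Xu ltr01).
Qed.

(** On the ray through [u], [denergy] is an explicit combination of
    [energy_part (Gphi phi) u] and powers, whose derivative at 1 is computed. *)
Lemma d2energy_diag lambda mu u : X u ->
  d2energy s phi V a q p lambda mu u u u =
  derive1 (EP (Gphi phi) u) 1 - EP (Gphi phi) u 1
  - mu * ((q - 1) * Qu u) + lambda * ((p - 1) * Pu u).
Proof.
move=> Xu; rewrite /d2energy.
pose h c := EP (Gphi phi) u c * c `^ (-1) + (- (mu * Qu u)) * c `^ (q - 1)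
  + (lambda * Pu u) * c `^ (p - 1).
have gG := growth_energy_part_G yp mV V00 VV0 Xu.
have dG := is_derive_growth gG ltr01.
have dp r := @is_derive1_powR R r 1 ltr01.
have dh := is_deriveD (is_deriveD (is_deriveM dG (dp (-1)))
  (@is_deriveZ _ _ _ _ (- (mu * Qu u)) _ _ _ (dp (q - 1))))
  (@is_deriveZ _ _ _ _ (lambda * Pu u) _ _ _ (dp (p - 1))).
have {}dh : is_derive ((fun t : R => 1 + t) 0) 1 h
    (derive1 (EP (Gphi phi) u) 1 - EP (Gphi phi) u 1
  - mu * ((q - 1) * Qu u) + lambda * ((p - 1) * Pu u)).
  rewrite /= addr0; apply: is_derive_eq dh _.
  by rewrite /GRing.scale/= !powR1; ring.
have dt : is_derive (0 : R) 1 (fun t : R => 1 + t) 1.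
  have := is_deriveD (@is_derive_cst R R R 1 0 1) (@is_derive_id R R 0 1).
  by rewrite add0r.
have dc := is_derive1_comp dh dt; rewrite mulr1 in dc.
rewrite derive1E; have [_ <-] := dc; apply: near_eq_derive; near=> t.
have t1 : 0 < 1 + t.
  rewrite -ltrBlDl sub0r; near: t; apply: lt_nbhsr.
  by rewrite ltrN10.
rewrite [X in denergy _ _ _ _ _ _ _ _ X](_ : _ = (fun x => (1 + t) * u x)); last first.
  by apply/funext => x; rewrite mulrDl mul1r.
rewrite denergy_ray// /h /= powR_inv1 ?(ltW t1)//; ring.
Unshelve. all: by end_near. Qed.

Lemma derive1_energy_partZ u t : X u -> 0 < t ->
  derive1 (EP (Gphi phi) (fun x => t * u x)) 1 = t * derive1 (EP (Gphi phi) u) t.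
Proof.
move=> Xu t0.
have -> : EP (Gphi phi) (fun x => t * u x) = EP (Gphi phi) u \o (t \*: (@id R)).
  apply/funext => r /=; rewrite (energy_partZ s V _ _ _ (ltW t0)).
  by rewrite mulrC.
have gG := growth_energy_part_G yp mV V00 VV0 Xu.
have dG : is_derive ((t \*: (@id R)) 1) 1 (EP (Gphi phi) u) (derive1 (EP (Gphi phi) u) t).
  by rewrite /= /GRing.scale/= mulr1; exact: is_derive_growth gG t0.
have dt := @is_deriveZ R R R id t 1 1 1 (@is_derive_id R R 1 1).
rewrite derive1E; have [_ ->] := is_derive1_comp dG dt.
by rewrite /GRing.scale/= mulr1 mulrC.
Qed.

Lemma Xnonzero_ray u t : Xnonzero s phi V u -> 0 < t ->
  Xnonzero s phi V (fun x => t * u x).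
Proof.
move=> [Xu nz] t0; split; first exact: (XspaceZ yp mV V00 VV0 Xu t0).
apply: contra_not nz; apply: filterS => x /eqP.
by rewrite mulf_eq0 gt_eqF//= => /eqP.
Qed.

Lemma nehari_ray lambda mu u t : Xnonzero s phi V u -> 0 < t ->
  EP (Gphi phi) u t + lambda * t `^ p * Pu u = mu * t `^ q * Qu u ->
  nehari s phi V a q p lambda mu (fun x => t * u x) /\
  d2energy s phi V a q p lambda mu (fun x => t * u x) (fun x => t * u x)
    (fun x => t * u x) =
  t * derive1 (EP (Gphi phi) u) t - q * EP (Gphi phi) u t
    + lambda * (p - q) * t `^ p * Pu u.
Proof.
move=> nzu t0 eqt; have [Xu _] := nzu.
have Xtu := XspaceZ yp mV V00 VV0 Xu t0.
split.
  split; first exact: Xnonzero_ray.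
  rewrite (denergy_diag _ _ Xtu) (energy_partZ s V _ _ _ (ltW t0)) (normp_pZ Xu t0)
    (normqa_qZ Xu t0) mul1r.
  rewrite mulrA -eqt; ring.
rewrite (d2energy_diag _ _ Xtu) (derive1_energy_partZ Xu t0) (energy_partZ s V _ _ _ (ltW t0))
  (normp_pZ Xu t0) (normqa_qZ Xu t0) mul1r.
have -> : mu * ((q - 1) * (t `^ q * Qu u)) = (q - 1) * (mu * t `^ q * Qu u) by ring.
by rewrite -eqt; ring.
Qed.

Lemma energy_ray lambda mu u t : X u -> 0 < t ->
  energy s phi V a q p lambda mu (fun x => t * u x) =
  EP (Phi phi) u t - mu / q * (t `^ q * Qu u) + lambda / p * (t `^ p * Pu u).
Proof.
move=> Xu t0; have Xtu := XspaceZ yp mV V00 VV0 Xu t0.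
by rewrite (energy_diag _ _ Xtu) (energy_partZ s V _ _ _ (ltW t0)) (normp_pZ Xu t0)
  (normqa_qZ Xu t0) mul1r.
Qed.

End ray.

(** * Norm and coercivity estimates *)

Section norm_bounds.
Context {R : realType} {N : nat} (s : R) (phi : R -> R)
  (V : Rtuple R N -> R) (ell m V0 : R).
Hypothesis yp : young_pair phi ell m.
Hypothesis mV : measurable_fun setT V.
Hypothesis V00 : 0 < V0.
Hypothesis VV0 : forall x, V0 <= V x.
Local Notation T := (Rtuple R N).
Local Notation leb := (lebesgue_tuple R N).
Local Notation X := (Xspace s phi V).
Local Notation EP := (energy_part s V).

Let ell0 : 0 <= ell. Proof. by have := yp_ell yp; lra. Qed.

Let J_div u k : X u -> 0 < k ->
  J s phi V (fun x => u x / k) = (EP (Phi phi) u k^-1)%:E.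
Proof.
move=> Xu k0; have k'0 : 0 < k^-1 by rewrite invr_gt0.
rewrite -(J_energy_part yp mV V00 VV0 Xu k'0); congr J.
by apply/funext => x; rewrite mulrC.
Qed.

Lemma Xnorm_ge0 u : 0 <= Xnorm s phi V u.
Proof.
rewrite /Xnorm; set S := [set k | _].
have [[k Sk]|S0] := pselect (S !=set0).
  by apply: lb_le_inf; [exists k|move=> y [/ltW]].
rewrite (_ : S = set0) ?inf0//; apply/seteqP; split => // k Sk.
by apply: S0; exists k.
Qed.

Lemma Xnorm_le u e : X u -> 0 < e <= 1 -> EP (Phi phi) u 1 <= e `^ m ->
  Xnorm s phi V u <= e.
Proof.
move=> Xu /andP[e0 e1] ue; apply: ge_inf.
  by exists 0 => k [/ltW].
split => //; rewrite (J_div Xu e0) lee_fin.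
have e'1 : 1 <= e^-1 by rewrite invf_ge1.
have /andP[_] := growth_scale_ge1 (growth_energy_part_Phi yp mV V00 VV0 Xu) e'1 ltr01.
rewrite mulr1 => /le_trans; apply.
rewrite -(powR_inv1 (ltW e0)) -powRrM mulN1r powRN.
by rewrite ler_pdivrMl ?powR_gt0// mulr1.
Qed.

(** If [k < K] and the energy of [u / k] is at most 1, scaling back bounds the
    energy of [u] by [K ^ m]. The set whose infimum is the norm is nonempty
    because [1 < ell]. *)
Lemma Xnorm_ge u K : X u -> 1 <= K -> K `^ m < EP (Phi phi) u 1 ->
  K <= Xnorm s phi V u.
Proof.
move=> Xu K1 Ku; have gP := growth_energy_part_Phi yp mV V00 VV0 Xu.
have m0 : 0 <= m := le_trans ell0 (yp_m yp).
have K0 : 0 < K by exact: lt_le_trans K1.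
apply: lb_le_inf.
  have [P0 _ _] := gP _ ltr01.
  pose k := Num.max 1 (EP (Phi phi) u 1).
  have k1 : 1 <= k by rewrite le_max lexx.
  have k0 : 0 < k by exact: lt_le_trans k1.
  exists k; split => //; rewrite (J_div Xu k0) lee_fin.
  have k'1 : 0 < k^-1 <= 1 by rewrite invr_gt0 k0 invf_le1.
  have /andP[_] := growth_scale_le1 gP k'1 ltr01.
  rewrite mulr1 => /le_trans; apply.
  apply: (@le_trans _ _ (k^-1 * EP (Phi phi) u 1)).
    by rewrite ler_wpM2r// ge1r_powR// ltW// (yp_ell yp).
  by rewrite ler_pdivrMl// mulr1 le_max lexx orbT.
move=> k [k0]; rewrite (J_div Xu k0) lee_fin => uk.
rewrite leNgt; apply/negP => kK.
have k'0 : 0 < k^-1 by rewrite invr_gt0.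
move: Ku; rewrite ltNge => /negP; apply.
have [k1|k1] := leP 1 k.
  have /andP[_] := growth_scale_ge1 gP k1 k'0.
  rewrite divff ?gt_eqF// => /le_trans; apply.
  apply: (@le_trans _ _ (k `^ m)); first by rewrite ler_piMr// powR_ge0.
  by apply: ge0_ler_powR => //; rewrite ?nnegrE ltW.
apply: (@le_trans _ _ (EP (Phi phi) u k^-1)).
  by apply: (growth_homo ell0 gP ltr01); rewrite invf_ge1// ltW.
apply: (le_trans uk); have : 1 `^ m <= K `^ m.
  by apply: ge0_ler_powR => //; rewrite ?nnegrE ltW.
by rewrite powR1.
Qed.

End norm_bounds.

Section nehari_bounds.
Context {R : realType} {N : nat} (s : R) (phi : R -> R)
  (V a b : Rtuple R N -> R) (ell m V0 q p lambda mu : R).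
Hypothesis yp : young_pair phi ell m.
Hypothesis mV : measurable_fun setT V.
Hypothesis V00 : 0 < V0.
Hypothesis VV0 : forall x, V0 <= V x.
Hypothesis ab : {ae lebesgue_tuple R N, forall x, a x = b x}.
Hypothesis mb : measurable_fun setT b.
Hypothesis b0 : forall x, 0 <= b x.
Hypotheses (mq : m < q) (qp : q < p).
Local Notation T := (Rtuple R N).
Local Notation leb := (lebesgue_tuple R N).
Local Notation X := (Xspace s phi V).
Local Notation EP := (energy_part s V).

(** The first order equation gives [mu * Q = A + lambda * P], and the second order
    condition becomes [lambda * (p - q) * P < (q - ell) * A]; substituting both in
    the energy and using [A <= m * B] leaves the stated multiple of [B]. *)
Lemma nehari_minus_coercive u :
  nehari_minus s phi V a q p lambda mu u ->
  (p * (q - m) - m * (q - ell)) / (p * q) * EP (Phi phi) u 1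
    <= energy s phi V a q p lambda mu u.
Proof.
move=> [[[Xu _] d1] d2].
have [hmq hqp hl hm] := And4 mq qp (yp_ell yp) (yp_m yp).
have q1 : 1 < q by lra.
have p1 : 1 < p by lra.
have XE := energy_diag a q p yp mV V00 VV0 lambda mu Xu.
have D1 := denergy_diag yp mV V00 VV0 ab mb b0 q1 p1 lambda mu Xu.
have D2 := d2energy_diag yp mV V00 VV0 ab mb b0 q1 p1 lambda mu Xu.
rewrite d1 in D1; rewrite D2 in d2; rewrite XE {XE D2}.
have gG := growth_energy_part_G yp mV V00 VV0 Xu.
have [A0 _ /andP[l _]] := gG _ ltr01; rewrite mul1r in l.
have /andP[PG1 PG2] := energy_part_PhiG yp mV V00 VV0 Xu ltr01.
set A := EP (Gphi phi) u 1 in D1 d2 l A0 PG1 PG2 *.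
set B := EP (Phi phi) u 1 in PG1 PG2 *.
set Q := normqa_q a q u in D1 d2 *.
set P := normp_p p u in D1 d2 *.
have hP : lambda * P * (p - q) < (q - ell) * A.
  have : derive1 (EP (Gphi phi) u) 1 - A - (q - 1) * (mu * Q) + (p - 1) * (lambda * P) < 0.
    by move: d2; rewrite !(mulrCA mu) !(mulrCA lambda).
  have -> : mu * Q = A + lambda * P by lra.
  by move: l; lra.
have p0 : 0 < p by lra.
have q0 : 0 < q by lra.
have m0 : 0 < m by lra.
have -> : mu / q * Q = (A + lambda * P) / q.
  have -> : A + lambda * P = mu * Q by lra.
  by ring.
have B0 : 0 <= B by have [] := growth_energy_part_Phi yp mV V00 VV0 Xu ltr01.
have e1 : B - (A + lambda * P) / q + lambda / p * P = B - A / q - lambda * P * (p - q) / (p * q).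
  by field; rewrite !gt_eqF.
have e2 : lambda * P * (p - q) / (p * q) <= (q - ell) * A / (p * q).
  by rewrite ler_pM2r ?invr_gt0 ?mulr_gt0// ltW.
have e3 : A / q + (q - ell) * A / (p * q) <= m * B / q + (q - ell) * (m * B) / (p * q).
  apply: lerD; rewrite ler_pM2r ?invr_gt0 ?mulr_gt0//.
  by rewrite ler_wpM2l//; lra.
have e5 : B - m * B / q - (q - ell) * (m * B) / (p * q) = (p * (q - m) - m * (q - ell)) / (p * q) * B.
  by field; rewrite !gt_eqF.
rewrite e1; move: e2 e3; rewrite -e5; lra.
Qed.

End nehari_bounds.

(** * A truncated Young inequality *)

Section truncation.
Context {R : realType}.

(** Where the left-hand side is positive, [z ^ (p - q)] is below a multiple of
    [b], so [b * z ^ q] is at most a multiple of [b ^ (1 + q / (p - q))]. *)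
Lemma powR_young (lambda q p : R) : 0 < lambda -> 0 < q -> q < p ->
  exists2 C, 0 < C & forall b z : R, 0 <= b -> 0 <= z ->
    b / q * z `^ q - lambda / p * z `^ p <= C * b `^ (p / (p - q)).
Proof.
move=> l0 q0 qp; have p0 : 0 < p by exact: lt_trans qp.
have pq0 : 0 < p - q by rewrite subr_gt0.
pose e := q / (p - q).
have e0 : 0 < e by rewrite divr_gt0.
pose c := p / (q * lambda).
have c0 : 0 < c by rewrite divr_gt0// mulr_gt0.
exists (c `^ e / q); first by rewrite divr_gt0// powR_gt0.
move=> b z b0; rewrite le_eqVlt => /predU1P[<-|z0].
  rewrite !powR0 ?gt_eqF// !mulr0 subrr mulr_ge0 ?powR_ge0//.
  by rewrite divr_ge0 ?powR_ge0// ltW.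
move: b0; rewrite le_eqVlt => /predU1P[<-|b0].
  rewrite !mul0r powR0 ?mulr0 ?sub0r; last by rewrite gt_eqF// divr_gt0.
  by rewrite oppr_le0 mulr_ge0 ?powR_ge0// divr_ge0// ltW.
have zq0 : 0 < z `^ q by rewrite powR_gt0.
have zpE : z `^ p = z `^ (p - q) * z `^ q.
  by rewrite -powRD ?subrK// (gt_eqF z0) implybT.
have rE : p / (p - q) = 1 + e by rewrite /e; field; rewrite gt_eqF.
have RHS0 : 0 <= c `^ e / q * b `^ (p / (p - q)).
  by rewrite mulr_ge0 ?powR_ge0// divr_ge0 ?powR_ge0// ltW.
have [h|h] := leP (b / q * z `^ q) (lambda / p * z `^ p).
  by apply: le_trans RHS0; rewrite subr_le0.
have zc : z `^ (p - q) < c * b.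
  move: h; rewrite zpE mulrA ltr_pM2r// => h.
  have -> : c * b = b / q / (lambda / p) by rewrite /c; field; rewrite !gt_eqF.
  by rewrite ltr_pdivlMr ?divr_gt0// mulrC.
have zq : z `^ q <= c `^ e * b `^ e.
  have -> : z `^ q = (z `^ (p - q)) `^ e.
    by rewrite -powRrM /e mulrCA divff ?mulr1// gt_eqF.
  rewrite -(powRM _ (ltW c0) (ltW b0)).
  apply: ge0_ler_powR; rewrite ?nnegrE ?powR_ge0 ?(mulr_ge0 (ltW c0) (ltW b0))//.
    exact: ltW.
  exact: ltW.
apply: (@le_trans _ _ (b / q * z `^ q)).
  by rewrite gerBl mulr_ge0 ?powR_ge0// divr_ge0// ltW.
have -> : c `^ e / q * b `^ (p / (p - q)) = b / q * (c `^ e * b `^ e).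
  rewrite rE powRD ?(gt_eqF b0) ?implybT// (powRr1 (ltW b0)); ring.
by rewrite ler_pM2l// divr_gt0.
Qed.

Context d (T : measurableType d) (mu : {measure set T -> \bar R}).
Variables (g h : T -> R).
Hypotheses (mg : measurable_fun setT g) (mh : measurable_fun setT h).
Hypotheses (g0 : forall x, 0 <= g x) (h0 : forall x, 0 <= h x).
Hypothesis ig : mu.-integrable setT (EFin \o g).

(** Here [g] is the bound given by Young's inequality and [h * (n + 1)^-1] the one
    valid for small arguments; the second term is the part of [g] above [n + 1]. *)
Definition truncation (n : nat) x : R :=
  Num.min (g x) (h x * n.+1%:R^-1) + Num.max (g x - n.+1%:R) 0.

Lemma truncation_ge0 n x : 0 <= truncation n x.
Proof.
by rewrite addr_ge0// ?le_min ?le_max ?lexx ?orbT// g0 mulr_ge0// invr_ge0.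
Qed.

Lemma truncation_le n x : truncation n x <= 2 * g x.
Proof.
rewrite mulr_natl mulr2n; apply: lerD; first by rewrite ge_min lexx.
by rewrite ge_max g0 andbT gerBl.
Qed.

Lemma measurable_truncation n : measurable_fun setT (truncation n).
Proof.
apply: measurable_funD.
  apply: measurable_minr => //; exact: measurable_funM.
by apply: measurable_maxr => //; exact: measurable_funB.
Qed.

Lemma integrable_truncation n : mu.-integrable setT (EFin \o truncation n).
Proof.
apply: (@le_integrable _ _ _ mu setT measurableT _ (fun x => (2%:E * (EFin \o g) x)%E)).
- exact/measurable_EFinP/measurable_truncation.
- move=> x _; rewrite /= lee_fin !ger0_norm ?truncation_ge0 ?mulr_ge0//.
  exact: truncation_le.
- exact: integrableZl.
Qed.

(** Pointwise convergence to 0, dominated by [2 * g]. *)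
Lemma truncation_small e : 0 < e -> exists n, \int[mu]_x truncation n x <= e.
Proof.
move=> e0.
have cv x : (truncation n x)%:E @[n --> \oo] --> (cst 0 x : \bar R).
  apply: cvg_EFin; first exact: nearW.
  have c1 : Num.min (g x) (h x * n.+1%:R^-1) @[n --> \oo] --> (0 : R).
    have u n : (0 : R) <= Num.min (g x) (h x * n.+1%:R^-1) <= h x * n.+1%:R^-1.
      by rewrite le_min g0 mulr_ge0 ?invr_ge0//= ge_min lexx orbT.
    have cu : h x * n.+1%:R^-1 @[n --> \oo] --> (0 : R).
      by rewrite -[X in _ --> X](mulr0 (h x)); apply: cvgMr; exact: cvg_harmonic.
    exact: (squeeze_cvgr (nearW _ u) (cvg_cst _) cu).
  have c2 : Num.max (g x - n.+1%:R) 0 @[n --> \oo] --> (0 : R).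
    apply: cvg_near_cst.
    near=> n; rewrite max_r// subr_le0.
    apply: (@le_trans _ _ n%:R); last by rewrite ler_nat.
    by near: n; exact: nbhs_infty_ger.
  have c := cvgD c1 c2; rewrite [X in _ --> X]addr0 in c.
  exact: c.
have mt n : measurable_fun setT (fun x => (truncation n x)%:E).
  exact/measurable_EFinP/measurable_truncation.
have bd : {ae mu, forall x (n : nat), setT x ->
    (`|(truncation n x)%:E| <= (2%:E * (EFin \o g) x))%E}.
  apply: aeW => x n _ /=.
  by rewrite ger0_norm ?truncation_ge0// -EFinM lee_fin truncation_le.
have [_ _] := dominated_convergence measurableT mt (measurable_cst (0%E : \bar R))
  (aeW _ (fun x _ => cv x)) (integrableZl measurableT 2 ig) bd.
rewrite integral0 => /fine_cvgP[_] /(cvgr_le (0 : R)) => /(_ e e0)[n _ H].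
by exists n; have := H n (leqnn n).
Unshelve. all: by end_near. Qed.

End truncation.

(** * Lower bound for low-energy critical points *)

Section nehari_plus_large.
Context {R : realType} {N : nat} (s : R) (phi : R -> R)
  (V a b : Rtuple R N -> R) (ell m V0 q p lambda : R).
Hypothesis yp : young_pair phi ell m.
Hypothesis mV : measurable_fun setT V.
Hypothesis V00 : 0 < V0.
Hypothesis VV0 : forall x, V0 <= V x.
Hypothesis ab : {ae lebesgue_tuple R N, forall x, a x = b x}.
Hypothesis mb : measurable_fun setT b.
Hypothesis b0 : forall x, 0 <= b x.
Hypotheses (mq : m < q) (qp : q < p) (lambda0 : 0 < lambda).
Local Notation T := (Rtuple R N).
Local Notation leb := (lebesgue_tuple R N).
Local Notation X := (Xspace s phi V).
Local Notation EP := (energy_part s V).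
Hypothesis ib : leb.-integrable setT (EFin \o (fun x => b x `^ (p / (p - q)))).

(** If the integral of [|v| ^ p] were infinite, its real value would be 0; the
    energy would then be [B - A / q], which is nonnegative since
    [A <= m * B] and [m < q]. *)
Lemma normp_p_integrable mu v : X v -> denergy s phi V a q p lambda mu v v = 0 ->
  energy s phi V a q p lambda mu v < 0 ->
  leb.-integrable setT (EFin \o (fun x => `|v x| `^ p)).
Proof.
move=> Xv d1 en.
have [hmq hqp hl hm] := And4 mq qp (yp_ell yp) (yp_m yp).
have q1 : 1 < q by lra.
have p1 : 1 < p by lra.
have [[[mv _] _] _] := Xv.
have mvp := measurable_norm_powR mv p.
have vp0 x : 0 <= `|v x| `^ p by exact: powR_ge0.
apply: contrapT => nint.
have P0 : normp_p p v = 0.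
  rewrite /normp_p /Rintegral.
  suff -> : (\int[leb]_x (`|v x| `^ p)%:E = +oo)%E by [].
  apply/eqP; rewrite -leye_eq leNgt; apply/negP => fin.
  apply: nint; apply/integrableP; split; first exact/measurable_EFinP.
  under eq_integral do rewrite /= (ger0_norm (vp0 _)).
  exact: fin.
have D1 := denergy_diag yp mV V00 VV0 ab mb b0 q1 p1 lambda mu Xv.
rewrite (energy_diag a q p yp mV V00 VV0 lambda mu Xv) P0 in en.
rewrite d1 P0 in D1.
have /andP[_ PG] := energy_part_PhiG yp mV V00 VV0 Xv ltr01.
have [B0 _ _] := growth_energy_part_Phi yp mV V00 VV0 Xv ltr01.
set A := EP (Gphi phi) v 1 in D1 PG.
set B := EP (Phi phi) v 1 in PG B0 en.
set Q := normqa_q a q v in D1 en.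
have q0 : 0 < q by lra.
have : mu / q * Q = A / q.
  have -> : A = mu * Q by lra.
  by ring.
move=> e; rewrite e in en.
have : A / q <= B by rewrite ler_pdivrMr// (le_trans PG)// (mulrC B) ler_wpM2r// ltW.
by lra.
Qed.

Lemma weighted_powR_integrable (v : T -> R) : measurable_fun setT v ->
  leb.-integrable setT (EFin \o (fun x => `|v x| `^ p)) ->
  leb.-integrable setT (EFin \o (fun x => b x * `|v x| `^ q)).
Proof.
move=> mv ip.
have [hmq hqp hl hm] := And4 mq qp (yp_ell yp) (yp_m yp).
have q0 : 0 < q by lra.
have p0 : 0 < p by lra.
have [C C0 young] := powR_young lambda0 q0 qp.
have mbq : measurable_fun setT (fun x => b x * `|v x| `^ q).
  by apply: measurable_funM => //; exact: measurable_norm_powR.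
have bvq0 x : 0 <= b x * `|v x| `^ q by rewrite mulr_ge0 ?powR_ge0.
have := integrableD measurableT (integrableZl measurableT (q * C) ib)
  (integrableZl measurableT (q * (lambda / p)) ip).
apply: le_integrable; [exact: measurableT|exact/measurable_EFinP|].
move=> x _; rewrite /= lee_fin.
have R0 : 0 <= q * C * b x `^ (p / (p - q)) + q * (lambda / p) * `|v x| `^ p.
  rewrite addr_ge0// mulr_ge0 ?powR_ge0// mulr_ge0 ?(ltW q0) ?(ltW C0)//.
  by rewrite divr_ge0// ltW.
rewrite (ger0_norm (bvq0 x)) (ger0_norm R0).
have := young (b x) `|v x| (b0 x) (normr_ge0 _).
rewrite lerBlDr => yx.
have -> : b x * `|v x| `^ q = q * (b x / q * `|v x| `^ q).
  by field; rewrite gt_eqF.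
by rewrite -!(mulrA q) -mulrDr ler_pM2l.
Qed.

(** Rescaling [v] by [t = mu ^ (1 / (p - q))] makes the lower order part of the
    energy [t ^ p] times that of [z = |v| / t] at [mu = 1]. Its integrand is at
    least [- truncation - K] where [z > d] and at least [- truncation] elsewhere.
    As the truncation integrates to at most [c0 / 2], the set where [z > d]
    accounts for the rest, and there [Phi phi (d * t) <= Phi phi |v|]. *)
Lemma nehari_plus_modular c0 : 0 < c0 -> exists d e, [/\ 0 < d, 0 < e &
  forall mu v, 0 < mu -> X v -> denergy s phi V a q p lambda mu v v = 0 ->
    energy s phi V a q p lambda mu v <= - c0 * mu `^ (p / (p - q)) ->
    e * Phi phi (d * mu `^ (p - q)^-1) <= EP (Phi phi) v 1].
Proof.
move=> c00.
have aux (x y z c : R) : x - y + z <= - c -> 0 <= x -> c <= y - z by lra.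
have [hmq hqp hl hm] := And4 mq qp (yp_ell yp) (yp_m yp).
have q0 : 0 < q by lra.
have p0 : 0 < p by lra.
have pq0 : 0 < p - q by lra.
have [C C0 young] := powR_young lambda0 q0 qp.
pose g x := C * b x `^ (p / (p - q)).
pose h x := b x / q.
have g0 x : 0 <= g x by rewrite mulr_ge0 ?powR_ge0// ltW.
have h0 x : 0 <= h x by rewrite divr_ge0// ltW.
have ig : leb.-integrable setT (EFin \o g).
  exact: (integrableZl measurableT C ib).
have mg : measurable_fun setT g by case/integrableP: ig => /measurable_EFinP.
have mh : measurable_fun setT h by exact: measurable_funM.
have c02 : 0 < c0 / 2 by rewrite divr_gt0.
have [n nc] := truncation_small mg mh g0 h0 ig c02.
pose K : R := n.+1%:R.
have K0 : 0 < K by rewrite ltr0n.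
(* So that h * d ^ q is the bound used in the truncation. *)
pose d := (K^-1) `^ q^-1.
have d0 : 0 < d by rewrite powR_gt0// invr_gt0.
have dq : d `^ q = K^-1.
  by rewrite /d -powRrM mulVf ?gt_eqF// powRr1// invr_ge0 ltW.
exists d, (V0 * (c0 / 2) / K); split; [exact: d0| |].
  by rewrite divr_gt0// mulr_gt0.
move=> mu v mu0 Xv d1 en.
pose t := mu `^ (p - q)^-1.
have t0 : 0 < t by rewrite powR_gt0.
have tpE : t `^ p = mu `^ (p / (p - q)) by rewrite /t -powRrM mulrC.
have tqE : mu * t `^ q = t `^ p.
  have -> : t `^ p = t `^ (p - q) * t `^ q.
    by rewrite -powRD ?subrK// (gt_eqF t0) implybT.
  by rewrite {2}/t -powRrM mulVf ?gt_eqF// powRr1// ltW.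
have tp0 : 0 < t `^ p by rewrite powR_gt0.
rewrite -tpE in en.
have en0 : energy s phi V a q p lambda mu v < 0.
  by apply: le_lt_trans en _; rewrite mulNr oppr_lt0 mulr_gt0.
have ip := normp_p_integrable Xv d1 en0.
have [[[mv _] _] _] := Xv.
have vp0 r x : 0 <= `|v x| `^ r by exact: powR_ge0.
have bvq0 x : 0 <= b x * `|v x| `^ q by exact: mulr_ge0.
have iq := weighted_powR_integrable mv ip.
have Phid0 : 0 < Phi phi (d * t) by apply: (yp_gt0 yp); exact: mulr_gt0.
have ell0 : 0 <= ell by exact: le_trans ler01 (ltW hl).
have homoP := growth_nneg_homo ell0 (Phi0 phi) (yp_Phi yp).
have Phi_ge0 x : 0 <= Phi phi `|v x| by rewrite -(Phi0 phi) homoP.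
have iV : leb.-integrable setT (EFin \o (fun x => Phi phi (1 * absf v x) * V x)).
  have /(XspaceP s yp mV V00 VV0)[_ _ fin1] := Xv.
  have V_ge0 x : 0 <= V x by rewrite (le_trans _ (VV0 x))// ltW.
  exact: (modular_integrable V_ge0 (absf_ge0 v) mV (measurable_absf mv) homoP
    (Phi0 phi) ler01 fin1).
have mPhi : measurable_fun setT (fun x => Phi phi `|v x|).
  have := @measurable_modular R _ T (cst 1) (absf v) (absf_ge0 v)
    (measurable_cst _) (measurable_absf mv) _ homoP 1 ler01.
  by apply: eq_measurable_fun => x _; rewrite mul1r mulr1.
have PV x : V0 * Phi phi `|v x| <= Phi phi (1 * absf v x) * V x.
  by rewrite mul1r mulrC ler_wpM2l.
have iPhi : leb.-integrable setT (EFin \o (fun x => Phi phi `|v x|)).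
  apply: (le_integrable _ _ _ (integrableZl measurableT V0^-1 iV)).
  - exact: measurableT.
  - exact/measurable_EFinP.
  move=> x _; rewrite /= lee_fin.
  have R0 : Phi phi `|v x| <= V0^-1 * (Phi phi (1 * absf v x) * V x).
    by rewrite ler_pdivlMl.
  rewrite (ger0_norm (Phi_ge0 x)) (ger0_norm (le_trans (Phi_ge0 x) R0)).
  exact: R0.
have it := integrable_truncation mg mh g0 h0 ig n.
pose L := K / Phi phi (d * t).
have key x : mu / q * (b x * `|v x| `^ q) - lambda / p * `|v x| `^ p <=
   t `^ p * (truncation g h n x + L * Phi phi `|v x|).
  pose z := `|v x| / t.
  have z0 : 0 <= z by rewrite divr_ge0// ltW.
  have vE : `|v x| = z * t by rewrite divfK// gt_eqF.
  rewrite vE !(powRM _ z0 (ltW t0)).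
  have -> : mu / q * (b x * (z `^ q * t `^ q)) - lambda / p * (z `^ p * t `^ p) =
      t `^ p * (b x / q * z `^ q - lambda / p * z `^ p).
    by rewrite -tqE; ring.
  rewrite ler_pM2l// -vE.
  have yz : b x / q * z `^ q - lambda / p * z `^ p <= g x by exact: young.
  have LP : 0 <= L * Phi phi `|v x| by rewrite mulr_ge0// divr_ge0// ltW.
  have [zd|zd] := leP z d.
    apply: (@le_trans _ _ (Num.min (g x) (h x * n.+1%:R^-1))).
      rewrite le_min yz/= -/K -dq.
      apply: (@le_trans _ _ (b x / q * z `^ q)).
        by rewrite gerBl mulr_ge0 ?powR_ge0// divr_ge0// ltW.
      apply: ler_wpM2l; first exact: h0.
      by apply: ge0_ler_powR; rewrite ?nnegrE ?(ltW q0) ?(ltW d0).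
    rewrite /truncation -addrA lerDl addr_ge0//.
    by rewrite le_max lexx orbT.
  apply: (le_trans yz).
  have : K <= L * Phi phi `|v x|.
    rewrite /L mulrAC ler_pdivlMr// ler_pM2l// homoP ?mulr_ge0 ?ltW//.
    by rewrite -ltr_pdivlMr.
  have : g x - K <= Num.max (g x - n.+1%:R) 0 by rewrite le_max lexx.
  have : 0 <= Num.min (g x) (h x * n.+1%:R^-1).
    by rewrite le_min g0 mulr_ge0 ?invr_ge0.
  move=> mn0 gK KL; rewrite -[g x](subrK K) /truncation lerD//.
  by rewrite -[leLHS]add0r lerD.
have RZ c f : leb.-integrable setT (EFin \o f) -> leb.-integrable setT (EFin \o (fun x => c * f x)).
  by move=> i; exact: (integrableZl measurableT c i).
have main : mu / q * normqa_q a q v - lambda / p * normp_p p v <=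
   t `^ p * (\int[leb]_x truncation g h n x + L * \int[leb]_x Phi phi `|v x|).
  have -> : normqa_q a q v = \int[leb]_x (b x * `|v x| `^ q).
    by apply: ae_eq_RintegralT; apply: filterS ab => x ->.
  have iL := RZ L _ iPhi.
  have iS : leb.-integrable setT (EFin \o (fun x => truncation g h n x + L * Phi phi `|v x|)).
    exact: (integrableD measurableT it iL).
  rewrite /normp_p -(RintegralZl _ measurableT iq) -(RintegralZl _ measurableT ip).
  rewrite -(RintegralZl _ measurableT iPhi) -(RintegralD measurableT it iL).
  rewrite -(RintegralZl _ measurableT iS).
  rewrite -(RintegralB measurableT (RZ (mu / q) _ iq) (RZ (lambda / p) _ ip)).
  apply: (le_Rintegral measurableT) => [| |x _]; [|exact: RZ|exact: key].
  exact: (integrableB measurableT (RZ (mu / q) _ iq) (RZ (lambda / p) _ ip)).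
rewrite (energy_diag a q p yp mV V00 VV0 lambda mu Xv) in en.
have VPhi : V0 * \int[leb]_x Phi phi `|v x| <= EP (Phi phi) v 1.
  rewrite /EP -(RintegralZl _ measurableT iPhi).
  have : \int[leb]_x (V0 * Phi phi `|v x|) <= \int[leb]_x (Phi phi (1 * absf v x) * V x).
    by apply: (le_Rintegral measurableT) => [| |x _]; [exact: RZ|exact: iV|exact: PV].
  move=> /le_trans; apply; rewrite lerDr; apply: Rintegral_ge0 => z _.
  by rewrite mulr_ge0 ?nu_density_ge0// -(Phi0 phi) homoP// mulr_ge0// absDs_ge0.
have [B0 _ _] := growth_energy_part_Phi yp mV V00 VV0 Xv ltr01.
set B := EP (Phi phi) v 1 in en VPhi B0 *.
set IP := \int[leb]_x Phi phi `|v x| in main VPhi.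
have c0L : c0 / 2 <= L * IP.
  have : c0 * t `^ p <= t `^ p * (c0 / 2 + L * IP).
    rewrite mulNr in en.
    apply: (@le_trans _ _ (t `^ p * (\int[leb]_x truncation g h n x + L * IP))).
      by apply: le_trans main; exact: aux en B0.
    by rewrite ler_pM2l// lerD2r.
  by rewrite mulrC ler_pM2l// -lerBlDl {1}(splitr c0) addrK.
apply: le_trans VPhi; rewrite -/t -!mulrA ler_pM2l//.
move: c0L; rewrite /L -(ler_pM2r Phid0) => h1.
rewrite mulrCA mulrC -mulrA mulrC.
have e1 : K / Phi phi (d * t) * IP * Phi phi (d * t) = K * IP by field; rewrite gt_eqF.
rewrite e1 in h1.
have : c0 / 2 * Phi phi (d * t) / K <= IP by rewrite ler_pdivrMr// (mulrC IP).
apply: le_trans; rewrite le_eqVlt; apply/orP; left; apply/eqP; ring.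
Qed.

End nehari_plus_large.

(** * The maximum distance and its balls *)

Section max_distance.
Context {R : realType} (N : nat).
Local Notation T := (Rtuple R N).
Local Notation leb := (lebesgue_tuple R N).
Local Notation leb2 := (leb \x leb)%E.

(** The balls of this distance are cubes, whose Lebesgue measure is a product. *)
Definition mdist (x y : T) : R :=
  \big[Num.max/0]_(i < N) `|(tnth x i : R) - tnth y i|.

Lemma mdist_ge0 x y : 0 <= mdist x y.
Proof. exact: bigmax_ge_id. Qed.

Lemma mdist_leP x y c : 0 <= c ->
  (mdist x y <= c) <-> (forall i, `|(tnth x i : R) - tnth y i| <= c).
Proof.
move=> c0; split => [/bigmax_leP[_ H] i|H]; first exact: H.
by apply/bigmax_leP; split.
Qed.

Lemma mdist_sym x y : mdist x y = mdist y x.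
Proof. by apply: eq_bigr => i _; rewrite distrC. Qed.

Lemma mdist_triangle y x z : mdist x z <= mdist x y + mdist y z.
Proof.
apply/mdist_leP; first by rewrite addr_ge0 ?mdist_ge0.
move=> i; apply: le_trans (ler_distD (tnth y i : R) _ _) _; apply: lerD.
  by move: i; apply/mdist_leP; rewrite ?mdist_ge0.
by move: i; apply/mdist_leP; rewrite ?mdist_ge0.
Qed.

Lemma mdist_le_Rdist x y : mdist x y <= Rdist x y.
Proof.
apply/mdist_leP; first exact: Rdist_ge0.
move=> i; rewrite -sqrtr_sqr /Rdist ler_wsqrtr// (bigD1 i)//= lerDl.
by apply: sumr_ge0 => j _; exact: sqr_ge0.
Qed.

Lemma measurable_mdist : measurable_fun setT (fun z : T * T => mdist z.1 z.2).
Proof.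
rewrite /mdist; elim: (index_enum _) => [|i r IH].
  by under eq_fun do rewrite big_nil; exact: measurable_cst.
under eq_fun do rewrite big_cons.
apply: (measurable_maxr _ IH); apply: measurableT_comp => //.
apply: measurable_funB; apply: (measurableT_comp (measurable_tnth i)).
  exact: measurable_fst.
exact: measurable_snd.
Qed.

Lemma measurable_mdistr y : measurable_fun setT (mdist ^~ y).
Proof.
have := measurableT_comp measurable_mdist (measurable_pair2 y); exact.
Qed.

Lemma lebesgue_mdist_ball x c : 0 <= c ->
  leb [set y | mdist x y <= c] = ((2 * c) ^+ N)%:E.
Proof.
move=> c0.
rewrite (_ : [set y | _] =
    [set y | forall i, `[(tnth x i : R) - c, (tnth x i : R) + c]%classic (tnth y i)]); last first.
  apply/seteqP; split => y /=.
    move=> /mdist_leP-/(_ c0) H i; rewrite /= in_itv/=.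
    by have := H i; rewrite distrC ler_distl.
  move=> H; apply/mdist_leP => // i; rewrite distrC ler_distl.
  by have := H i; rewrite /= in_itv.
rewrite (lebesgue_tuple_box (A := fun i => `[(tnth x i : R) - c, (tnth x i : R) + c]%classic))//.
under eq_bigr do rewrite lebesgue_measure_itv/=.
have E (i : 'I_N) : (if ((tnth x i : R) - c)%:E < ((tnth x i : R) + c)%:E
    then ((tnth x i : R) + c)%:E - ((tnth x i : R) - c)%:E else 0)%E = (2 * c)%:E.
  rewrite lte_fin; case: ltP => h; first by rewrite -EFinB; congr EFin; ring.
  by congr EFin; lra.
under eq_bigr do rewrite E.
by rewrite prodEFin prodr_const card_ord.
Qed.

End max_distance.

(** * A tent function in the space *)

Section shells.
Context {R : realType} (N : nat).
Local Notation T := (Rtuple R N).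
Local Notation leb := (lebesgue_tuple R N).
Local Notation leb2 := (leb \x leb)%E.
Variables (o : T) (c : R).
Hypothesis c0 : 0 <= c.

(** Pairs at distance at most [r] one of whose points lies in the cube that
    supports the tent function. *)
Definition shell (r : R) : set (T * T) :=
  [set z | (mdist z.1 o <= c \/ mdist z.2 o <= c) /\ mdist z.1 z.2 <= r].

Let Q : set T := [set x | mdist x o <= c].

Let mQ : measurable Q.
Proof.
rewrite /Q -[X in measurable X]setTI.
rewrite (_ : [set x | _] = (fun x => mdist x o) @^-1` `]-oo, c]%classic).
  exact: measurable_mdistr.
by apply/seteqP; split => x /=; rewrite in_itv.
Qed.

Let lebQ : leb Q = ((2 * c) ^+ N)%:E.
Proof.
rewrite -(@lebesgue_mdist_ball R N o c c0); congr (leb _).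
by apply/seteqP; split => x /=; rewrite mdist_sym.
Qed.

Let mD r : measurable [set z : T * T | mdist z.1 z.2 <= r].
Proof.
rewrite -[X in measurable X]setTI.
rewrite (_ : [set z | _] = (fun z : T * T => mdist z.1 z.2) @^-1` `]-oo, r]%classic).
  exact: measurable_mdist.
by apply/seteqP; split => x /=; rewrite in_itv.
Qed.

Let S1 r : set (T * T) := (Q `*` setT) `&` [set z | mdist z.1 z.2 <= r].
Let S2 r : set (T * T) := (setT `*` Q) `&` [set z | mdist z.1 z.2 <= r].

Let mS1 r : measurable (S1 r).
Proof. by apply: measurableI => //; exact: measurableX. Qed.

Let mS2 r : measurable (S2 r).
Proof. by apply: measurableI => //; exact: measurableX. Qed.

Let shellE r : shell r = S1 r `|` S2 r.
Proof.
apply/seteqP; split => [[x y] /= [[h|h] d]|[x y] [|] /= [[h1 h2] d]].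
- by left.
- by right.
- by split => //; left.
- by split => //; right.
Qed.

Lemma measurable_shell r : measurable (shell r).
Proof. by rewrite shellE; exact: measurableU. Qed.

Let lebS1 r : 0 <= r -> leb2 (S1 r) = ((2 * c) ^+ N * (2 * r) ^+ N)%:E.
Proof.
move=> r0; rewrite /product_measure1.
rewrite (eq_integral (fun x => (((2 * r) ^+ N)%:E * (\1_Q x)%:E)%E)).
  rewrite ge0_integralZl//.
  - by rewrite integral_indic// setIT [X in (_ * X)%E]lebQ -EFinM mulrC.
  - exact/measurable_EFinP/measurable_indic.
  - by rewrite lee_fin exprn_ge0// mulr_ge0.
move=> x _; rewrite /= indicE; case: (pselect (Q x)) => Qx.
  rewrite mem_set// mule1 -(@lebesgue_mdist_ball R N x r r0); congr (leb _).
  apply/seteqP; split => y; rewrite /xsection /= inE /S1 /=; first by case.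
  by move=> h; split.
rewrite memNset// mule0 (_ : xsection _ _ = set0) ?measure0//.
by apply/seteqP; split => y //; rewrite /xsection /= inE /S1 /= => -[[]].
Qed.

(** Here the section is taken in the other variable, so the two iterated
    integrals have to be exchanged. *)
Let lebS2 r : 0 <= r -> leb2 (S2 r) = ((2 * c) ^+ N * (2 * r) ^+ N)%:E.
Proof.
move=> r0; transitivity ((leb \x^ leb)%E (S2 r)).
  by apply: product_measure_unique => //= ? ? ? ?; rewrite product_measure2E.
rewrite /product_measure2.
rewrite (eq_integral (fun x => (((2 * r) ^+ N)%:E * (\1_Q x)%:E)%E)).
  rewrite ge0_integralZl//.
  - by rewrite integral_indic// setIT [X in (_ * X)%E]lebQ -EFinM mulrC.
  - exact/measurable_EFinP/measurable_indic.
  - by rewrite lee_fin exprn_ge0// mulr_ge0.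
move=> y _; rewrite /= indicE; case: (pselect (Q y)) => Qy.
  rewrite mem_set// mule1 -(@lebesgue_mdist_ball R N y r r0); congr (leb _).
  apply/seteqP; split => x; rewrite /ysection /= inE /S2 /=.
    by rewrite mdist_sym; case.
  by move=> h; rewrite mdist_sym.
rewrite memNset// mule0 (_ : ysection _ _ = set0) ?measure0//.
by apply/seteqP; split => x //; rewrite /ysection /= inE /S2 /= => -[[]].
Qed.

Lemma lebesgue_shell r : 0 <= r ->
  (leb2 (shell r) <= (2 * ((2 * c) ^+ N * (2 * r) ^+ N))%:E)%E.
Proof.
move=> r0; rewrite shellE.
apply: (le_trans (measureU2 _ (mS1 r) (mS2 r))).
rewrite [X in (X + _)%E](lebS1 r0) [X in (_ + X)%E](lebS2 r0).
by rewrite -EFinD lee_fin [leRHS]mulr_natl mulr2n.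
Qed.

End shells.

Section dyadic.
Context {R : realType}.

Lemma dyadic_le1 (d : R) : 0 < d -> d <= 1 ->
  exists n, 2^-1 ^+ n.+1 < d <= 2^-1 ^+ n.
Proof.
move=> d0 d1.
have ex : exists n, 2^-1 ^+ n.+1 < d.
  have half1 : `|2^-1 : R| < 1 by rewrite ger0_norm//; lra.
  have [n _ H] := proj1 (cvgrPdist_lt _ _) (cvg_expr half1) d d0.
  exists n; have := H n.+1 (leqnSn n).
  by rewrite /= sub0r normrN ger0_norm// exprn_ge0.
exists (ex_minn ex); case: ex_minnP => n nd min; rewrite nd/=.
case: n nd min => [|n] nd min; first by rewrite expr0.
by rewrite leNgt; apply/negP => /min; rewrite ltnn.
Qed.

Lemma dyadic_gt1 (d : R) : 1 < d -> exists n, 2 ^+ n < d <= 2 ^+ n.+1.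
Proof.
move=> d1.
have ex : exists n, d <= 2 ^+ n.+1.
  have [n nd] : exists n : nat, d <= n%:R.
    by exists (Num.bound d); rewrite ltW// archi_boundP// ltW// (lt_trans ltr01).
  exists n; apply: (le_trans nd); rewrite -natrX ler_nat.
  by apply: (leq_trans (ltnW (ltn_expl n (isT : (1 < 2)%N)))); rewrite leq_exp2l.
exists (ex_minn ex); case: ex_minnP => n nd min; rewrite nd/= andbT.
case: n nd min => [|n] nd min; first by rewrite expr0.
by rewrite ltNge; apply/negP => /min; rewrite ltnn.
Qed.

End dyadic.

Section tent.
Context {R : realType} {N : nat} (s : R) (phi : R -> R)
  (V : Rtuple R N -> R) (ell m V0 : R).
Hypothesis s01 : 0 < s < 1.
Hypothesis yp : young_pair phi ell m.
Hypothesis mV : measurable_fun setT V.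
Hypothesis V00 : 0 < V0.
Hypothesis VV0 : forall x, V0 <= V x.
Local Notation T := (Rtuple R N).
Local Notation leb := (lebesgue_tuple R N).
Local Notation leb2 := (leb \x leb)%E.
Variables (o : T) (c M : R).
Hypotheses (c01 : 0 < c <= 1) (VM : forall x, mdist x o <= c -> V x <= M).

Definition tent x : R := Num.max 0 (c - mdist x o).

Let c0 : 0 <= c. Proof. by case/andP: c01 => /ltW. Qed.
Let ell0 : 0 <= ell. Proof. by have := yp_ell yp; lra. Qed.
Let homoP := growth_nneg_homo ell0 (Phi0 phi) (yp_Phi yp).

Lemma tent_ge0 x : 0 <= tent x.
Proof. by rewrite le_max lexx. Qed.

Lemma tent_le1 x : tent x <= 1.
Proof.
have /andP[_ c1] := c01.
by rewrite ge_max ler01/= lerBlDr (le_trans c1)// lerDl mdist_ge0.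
Qed.

Lemma tent_out x : ~ mdist x o <= c -> tent x = 0.
Proof. by move=> /negP; rewrite -ltNge => h; rewrite /tent max_l// subr_le0 ltW. Qed.

Lemma tent_lip x y : `|tent x - tent y| <= mdist x y.
Proof.
have H x' y' : tent x' - tent y' <= mdist x' y'.
  rewrite lerBlDr ge_max addr_ge0 ?mdist_ge0 ?tent_ge0//=.
  have : c - mdist y' o <= tent y' by rewrite le_max lexx orbT.
  have := mdist_triangle x' y' o; rewrite (mdist_sym y').
  have := mdist_triangle x' y' o; have := mdist_triangle y' x' o.
  by rewrite (mdist_sym y' x'); lra.
by rewrite ler_norml H andbT lerNl opprB mdist_sym H.
Qed.

Lemma measurable_tent : measurable_fun setT tent.
Proof.
by apply: measurable_maxr => //; apply: measurable_funB => //; exact: measurable_mdistr.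
Qed.

(** The tent function is 1-Lipschitz for [mdist] and takes values between 0 and 1,
    and [mdist] is at most the Euclidean distance. *)
Lemma Ds_tent_le z : 0 < mdist z.1 z.2 ->
  absDs s tent z <= Num.min 1 (mdist z.1 z.2) * mdist z.1 z.2 `^ (- s).
Proof.
move=> d0; have dr := mdist_le_Rdist z.1 z.2.
have r0 : 0 < Rdist z.1 z.2 by exact: lt_le_trans dr.
rewrite /absDs /Ds normrM normfV (ger0_norm (powR_ge0 _ _)) powRN.
apply: ler_pM => //; first by rewrite invr_ge0 powR_ge0.
  rewrite le_min tent_lip andbT.
  have := tent_ge0 z.1; have := tent_ge0 z.2; have := tent_le1 z.1.
  have := tent_le1 z.2; rewrite ler_norml; move=> *; apply/andP; split; lra.
have s0 : 0 <= s by case/andP: s01 => /ltW.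
rewrite lef_pV2 ?posrE ?powR_gt0//.
by apply: ge0_ler_powR => //; rewrite nnegrE ltW.
Qed.

Let theta : R := Num.max (2^-1 `^ (1 - s)) (2^-1 `^ s).

Let theta01 : 0 < theta < 1.
Proof.
have /andP[s0 s1] := s01.
rewrite lt_max powR_gt0//= gt_max.
have H e : 0 < e -> (2^-1 : R) `^ e < 1.
  move=> e0; have : (2^-1 : R) `^ e < 1 `^ e.
    by apply: gt0_ltr_powR => //; rewrite ?nnegrE//; lra.
  by rewrite powR1.
by rewrite !H// subr_gt0.
Qed.

Let powR_half e n : ((2^-1 : R) ^+ n) `^ e = (2^-1 `^ e) ^+ n.
Proof.
have h0 : 0 <= 2^-1 :> R by rewrite invr_ge0.
rewrite -(powR_mulrn n h0) -(powR_mulrn n (powR_ge0 _ e)); exact: powRAC.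
Qed.

Let wt n (r : R) : R := Phi phi 1 * theta ^+ n * (2 / r) ^+ N.

Let integrand z := Phi phi (absDs s tent z) * nu_density z.

(** On a dyadic shell of radius [r] the density is at most [(2 / r) ^ N], which
    compensates the measure of the shell; the remaining factor is geometric in
    the index of the shell. *)
Let integrand_shell n r z : r / 2 < mdist z.1 z.2 -> mdist z.1 z.2 <= r ->
  Num.min 1 (mdist z.1 z.2) * mdist z.1 z.2 `^ (- s) <= theta ^+ n -> 0 < r ->
  integrand z <= wt n r * \1_(shell o c r) z.
Proof.
move=> rd dr dt r0; have /andP[t0 t1] := theta01.
have d0 : 0 < mdist z.1 z.2 by apply: lt_trans rd; rewrite divr_gt0.
have r'0 : 0 < Rdist z.1 z.2 by exact: lt_le_trans (mdist_le_Rdist _ _).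
case: (pselect (mdist z.1 o <= c \/ mdist z.2 o <= c)) => [zS|zS]; last first.
  have z1 : tent z.1 = 0 by apply: tent_out => h; apply: zS; left.
  have z2 : tent z.2 = 0 by apply: tent_out => h; apply: zS; right.
  rewrite /integrand /absDs /Ds z1 z2 subr0 mul0r normr0 Phi0 mul0r.
  rewrite mulr_ge0// /wt !mulr_ge0 ?exprn_ge0// ?divr_ge0// ?ltW//.
  exact: (yp_gt0 yp).
rewrite indicE mem_set; last by split.
rewrite mulr1; apply: ler_pM.
- by rewrite -(Phi0 phi) homoP ?absDs_ge0.
- exact: nu_density_ge0.
- have tn0 : 0 < theta ^+ n by rewrite exprn_gt0.
  have tn1 : theta ^+ n <= 1 by rewrite exprn_ile1// ltW.
  apply: (@le_trans _ _ (Phi phi (theta ^+ n))).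
    by rewrite homoP ?absDs_ge0// (le_trans (Ds_tent_le d0)).
  have tn01 : 0 < theta ^+ n <= 1 by rewrite tn0.
  have /andP[_] := growth_scale_le1 (yp_Phi yp) tn01 ltr01.
  rewrite mulr1 => /le_trans; apply.
  rewrite mulrC ler_wpM2l//; first by rewrite ltW// (yp_gt0 yp).
  by rewrite ge1r_powR// ltW// (yp_ell yp).
- have r2 : (Rdist z.1 z.2)^-1 <= 2 / r.
    rewrite -[leRHS]invrK lef_pV2 ?posrE ?invr_gt0 ?divr_gt0// invf_div.
    by apply: (le_trans (ltW rd)); exact: mdist_le_Rdist.
  have rV0 : 0 <= (Rdist z.1 z.2)^-1 by rewrite invr_ge0 Rdist_ge0.
  by rewrite /nu_density -exprVn lerXn2r ?nnegrE// (le_trans rV0).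
Qed.

Let term n z : R := wt n (2^-1 ^+ n) * \1_(shell o c (2^-1 ^+ n)) z
  + wt n (2 ^+ n.+1) * \1_(shell o c (2 ^+ n.+1)) z.

Let wt_ge0 n r : 0 < r -> 0 <= wt n r.
Proof.
move=> r0; have /andP[t0 _] := theta01.
rewrite /wt !mulr_ge0 ?exprn_ge0 ?divr_ge0 ?(ltW r0) ?(ltW t0)//.
by rewrite ltW// (yp_gt0 yp).
Qed.

Let h2 n : 0 < (2^-1 : R) ^+ n. Proof. by rewrite exprn_gt0// invr_gt0. Qed.
Let d2 n : 0 < (2 : R) ^+ n. Proof. by rewrite exprn_gt0. Qed.

Let term_ge0 n z : 0 <= term n z.
Proof. by rewrite addr_ge0// mulr_ge0// wt_ge0. Qed.

Let integrand_term z : exists n, integrand z <= term n z.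
Proof.
have /andP[s0 s1] := s01.
have := mdist_ge0 z.1 z.2; rewrite le_eqVlt => /predU1P[d0|d0].
  exists 0%N; apply: le_trans (term_ge0 0 z).
  have : `|tent z.1 - tent z.2| <= 0 by rewrite d0 tent_lip.
  rewrite normr_le0 => /eqP E.
  by rewrite /integrand /absDs /Ds E mul0r normr0 Phi0 mul0r.
have [d1|d1] := leP (mdist z.1 z.2) 1.
  have [n /andP[nd dn]] := dyadic_le1 d0 d1; exists n.
  apply: (@le_trans _ _ (wt n (2^-1 ^+ n) * \1_(shell o c (2^-1 ^+ n)) z)).
    apply: integrand_shell => //; first by rewrite -exprSr.
    rewrite min_r// -{1}(powRr1 (ltW d0)) -powRD ?(gt_eqF d0) ?implybT//.
    apply: (@le_trans _ _ ((2^-1 ^+ n) `^ (1 - s))).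
      by apply: ge0_ler_powR => //; rewrite ?nnegrE ?subr_ge0 ?(ltW s1) ?(ltW d0) ?(ltW (h2 n)).
    rewrite powR_half lerXn2r ?nnegrE ?powR_ge0 ?le_max ?lexx//.
    by rewrite powR_ge0.
  by rewrite lerDl mulr_ge0// wt_ge0.
have [n /andP[nd dn]] := dyadic_gt1 d1; exists n.
apply: (@le_trans _ _ (wt n (2 ^+ n.+1) * \1_(shell o c (2 ^+ n.+1)) z)).
  apply: integrand_shell => //.
    by rewrite exprSr mulfK.
  rewrite min_l ?(ltW d1)// mul1r powRN.
  apply: (@le_trans _ _ ((2^-1 ^+ n) `^ s)).
    rewrite -[(2^-1 ^+ n) `^ s]invrK lef_pV2 ?posrE ?invr_gt0 ?powR_gt0//.
    rewrite -powRN -mulN1r powRrM (powR_inv1 (ltW (h2 n))) exprVn invrK.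
    by apply: ge0_ler_powR => //; rewrite ?nnegrE ?(ltW s0) ?(ltW d0) ?(ltW (d2 n)) ?(ltW nd).
  rewrite powR_half lerXn2r ?nnegrE ?powR_ge0 ?le_max ?lexx ?orbT//.
  by rewrite powR_ge0.
by rewrite lerDr mulr_ge0// wt_ge0.
Qed.

Let cube : set T := [set x | mdist x o <= c].

Let mcube : measurable cube.
Proof.
rewrite /cube -[X in measurable X]setTI.
rewrite (_ : [set x | _] = (fun x => mdist x o) @^-1` `]-oo, c]%classic).
  exact: measurable_mdistr.
by apply/seteqP; split => x /=; rewrite in_itv.
Qed.

Let lebcube : leb cube = ((2 * c) ^+ N)%:E.
Proof.
rewrite -(@lebesgue_mdist_ball R N o c c0); congr (leb _).
by apply/seteqP; split => x /=; rewrite mdist_sym.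
Qed.

Let le_cube (f : T -> R) (K : R) : measurable_fun setT f -> 0 <= K ->
  (forall x, 0 <= f x <= K * \1_cube x) -> (\int[leb]_x (f x)%:E < +oo)%E.
Proof.
move=> mf K0 fK.
apply: (@le_lt_trans _ _ (\int[leb]_x (K%:E * (\1_cube x)%:E))%E).
  apply: ge0_le_integral => //.
  - by move=> x _; rewrite lee_fin; have /andP[] := fK x.
  - exact/measurable_EFinP.
  - by apply: measurable_funeM; exact/measurable_EFinP/measurable_indic.
  - by move=> x _; rewrite -EFinM lee_fin; have /andP[] := fK x.
rewrite ge0_integralZl//; last exact/measurable_EFinP/measurable_indic.
by rewrite integral_indic// setIT [X in (_ * X)%E]lebcube -EFinM ltry.
Qed.

Let Phi1 : 0 < Phi phi 1. Proof. exact: (yp_gt0 yp). Qed.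

Let mterm (r w : R) : 0 <= w -> 0 <= r ->
  (\int[leb2]_z (w * \1_(shell o c r) z)%:E
   <= (w * (2 * ((2 * c) ^+ N * (2 * r) ^+ N)))%:E)%E.
Proof.
move=> w0 r0; under eq_integral do rewrite EFinM.
have mS : measurable (shell o c r) by exact: measurable_shell.
rewrite ge0_integralZl//; last exact/measurable_EFinP/measurable_indic.
rewrite integral_indic// setIT EFinM.
apply: lee_wpmul2l; first by rewrite lee_fin.
exact: lebesgue_shell.
Qed.

Let ctot : R := 2 * (Phi phi 1 * (2 * ((2 * c) ^+ N * 4 ^+ N))).

Let int_term n : (\int[leb2]_z (term n z)%:E <= (ctot * theta ^+ n)%:E)%E.
Proof.
have ms r : measurable_fun setT (fun z : T * T => (\1_(shell o c r) z : R)).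
  by apply: measurable_indic; exact: measurable_shell.
under eq_integral do rewrite EFinD.
rewrite ge0_integralD//; first last.
- by apply/measurable_EFinP; exact: measurable_funM.
- by move=> z _; rewrite lee_fin mulr_ge0// wt_ge0.
- by apply/measurable_EFinP; exact: measurable_funM.
- by move=> z _; rewrite lee_fin mulr_ge0// wt_ge0.
have W r : 0 < r -> wt n r * (2 * ((2 * c) ^+ N * (2 * r) ^+ N)) = ctot * theta ^+ n / 2.
  move=> r0; have e : (2 / r) ^+ N * (2 * r) ^+ N = 4 ^+ N.
    by rewrite -exprMn; congr (_ ^+ _); field; rewrite gt_eqF.
  by rewrite /wt /ctot -e; field.
have B r : 0 < r -> (\int[leb2]_z (wt n r * \1_(shell o c r) z)%:E
    <= (ctot * theta ^+ n / 2)%:E)%E.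
  move=> r0; rewrite -(W _ r0); exact: (mterm (wt_ge0 n r0) (ltW r0)).
have -> : ctot * theta ^+ n = ctot * theta ^+ n / 2 + ctot * theta ^+ n / 2 by field.
by rewrite EFinD; apply: leeD; exact: B.
Qed.

(** The shells of radii [2 ^ - n] and [2 ^ (n + 1)] cover the pairs of distinct
    points that meet the cube, and each contributes at most a multiple of [theta ^ n]. *)
Lemma tent_seminorm_modular_lty : (seminorm_modular s (Phi phi) tent 1 < +oo)%E.
Proof.
have ms r : measurable_fun setT (fun z : T * T => (\1_(shell o c r) z : R)).
  by apply: measurable_indic; exact: measurable_shell.
have mterm' n : measurable_fun setT (fun z => (term n z)%:E).
  by apply/measurable_EFinP; apply: measurable_funD; exact: measurable_funM.
have t0 n z : (0 <= (term n z)%:E)%E by rewrite lee_fin.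
have /andP[th0 th1] := theta01.
apply: (@le_lt_trans _ _ (\int[leb2]_z (\sum_(n <oo) (term n z)%:E))%E).
  apply: ge0_le_integral => //.
  - move=> z _; rewrite lee_fin.
    exact: (modular_integrand_ge0 (@nu_density_ge0 R N) (absDs_ge0 s tent) homoP
      (Phi0 phi) z ler01).
  - apply/measurable_EFinP.
    exact: (measurable_modular (absDs_ge0 s tent) (@measurable_nu_density R N)
      (measurable_absDs s measurable_tent) homoP ler01).
  - by apply: ge0_emeasurable_sum => // n z _ _; exact: t0.
  - move=> z _; have [n zn] := integrand_term z.
    apply: (@le_trans _ _ (term n z)%:E); first by rewrite mul1r lee_fin.
    have := @nneseries_lim_ge R (fun n => (term n z)%:E) xpredT 0%N n.+1 (fun n _ _ => t0 n z).
    by apply: le_trans; rewrite big_nat_recr//= leeDr// sume_ge0.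
rewrite integral_nneseries//.
apply: (@le_lt_trans _ _ (\sum_(n <oo) (ctot * theta ^+ n)%:E)%E).
  apply: lee_nneseries => [n _ _|n _]; last exact: int_term.
  by apply: integral_ge0 => z _; exact: t0.
have th : `|theta| < 1 by rewrite ger0_norm// ltW.
have cg := @cvg_geometric_series R ctot theta th.
rewrite (_ : (\sum_(n <oo) (ctot * theta ^+ n)%:E)%E = (ctot * (1 - theta)^-1)%:E) ?ltry//.
apply/cvg_lim => //.
rewrite (_ : (fun n => (\sum_(0 <= i < n) (ctot * theta ^+ i)%:E)%E) = EFin \o series (geometric ctot theta)).
  by apply: cvg_EFin => //; exact: nearW.
by apply/funext => n; rewrite /= /series/= sumEFin.
Qed.

Lemma tent_Xspace : Xspace s phi V tent.
Proof.
apply/(XspaceP s yp mV V00 VV0); split.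
- exact: measurable_tent.
- exact: tent_seminorm_modular_lty.
- have V_ge0 x : 0 <= V x by rewrite (le_trans _ (VV0 x))// ltW.
  apply: (@le_cube _ (Phi phi 1 * Num.max 0 M)).
  + exact: (measurable_modular (absf_ge0 tent) mV (measurable_absf measurable_tent) homoP ler01).
  + by rewrite mulr_ge0 ?(ltW Phi1)// le_max lexx.
  move=> x; rewrite mul1r; apply/andP; split.
    by rewrite mulr_ge0// -(Phi0 phi) homoP// absf_ge0.
  rewrite indicE; case: (pselect (cube x)) => xc.
    rewrite mem_set// mulr1; apply: ler_pM => //.
    - by rewrite -(Phi0 phi) homoP// absf_ge0.
    - by rewrite homoP// ?absf_ge0// /absf ger0_norm ?tent_ge0// tent_le1.
    - by rewrite le_max VM// orbT.
  by rewrite memNset// mulr0 /absf (tent_out xc) normr0 Phi0 mul0r.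
Qed.

Lemma tent_Xnonzero : Xnonzero s phi V tent.
Proof.
split; first exact: tent_Xspace.
have /andP[cp _] := c01.
have c20 : 0 <= c / 2 by rewrite divr_ge0.
move=> [Z [mZ Z0 HZ]].
have sub : [set x | mdist o x <= c / 2] `<=` Z.
  move=> x /= xc; apply: HZ => /= t0.
  have : c - mdist x o <= tent x by rewrite le_max lexx orbT.
  by rewrite t0 mdist_sym; have := cp; lra.
have mB : measurable [set x | mdist o x <= c / 2].
  rewrite -[X in measurable X]setTI.
  rewrite (_ : [set x | _] = (fun x => mdist x o) @^-1` `]-oo, c / 2]%classic).
    exact: measurable_mdistr.
  by apply/seteqP; split => x /=; rewrite in_itv/= mdist_sym.
have : (leb [set x | (mdist o x <= c / 2)%R] <= leb Z)%E by apply: le_measure; rewrite ?inE.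
rewrite Z0 (@lebesgue_mdist_ball R N o (c / 2) c20) lee_fin leNgt => /negP; apply.
by rewrite exprn_gt0// mulr_gt0// divr_gt0.
Qed.

Lemma tent_powR_integrable p : 0 < p ->
  leb.-integrable setT (EFin \o (fun x => `|tent x| `^ p)).
Proof.
move=> p0; have mp := measurable_norm_powR measurable_tent p.
apply/integrableP; split; first exact/measurable_EFinP.
under eq_integral do rewrite /= (ger0_norm (powR_ge0 _ _)).
apply: (@le_cube _ 1) => // x; rewrite powR_ge0/= mul1r indicE.
case: (pselect (cube x)) => xc.
  rewrite mem_set//; have : `|tent x| `^ p <= 1 `^ p.
    apply: ge0_ler_powR; rewrite ?nnegrE ?(ltW p0)//.
    by rewrite ger0_norm ?tent_ge0// tent_le1.
  by rewrite powR1.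
by rewrite memNset// (tent_out xc) normr0 powR0// gt_eqF.
Qed.

End tent.

(** * Positivity and local boundedness *)

Section positivity.
Context {R : realType} {N : nat} (s : R) (phi : R -> R)
  (V : Rtuple R N -> R) (ell m V0 : R).
Hypothesis yp : young_pair phi ell m.
Hypothesis mV : measurable_fun setT V.
Hypothesis V00 : 0 < V0.
Hypothesis VV0 : forall x, V0 <= V x.
Local Notation T := (Rtuple R N).
Local Notation leb := (lebesgue_tuple R N).
Local Notation X := (Xspace s phi V).
Local Notation EP := (energy_part s V).

Let Rintegral_gt0 (f : T -> R) (u : T -> R) :
  leb.-integrable setT (EFin \o f) -> (forall x, 0 <= f x) ->
  ~ {ae leb, forall x, u x = 0} -> {ae leb, forall x, f x = 0 -> u x = 0} ->
  0 < \int[leb]_x f x.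
Proof.
move=> fi f0 nz fu.
have If : (\int[leb]_x (f x)%:E)%E \is a fin_num by exact: integrable_fin_num fi.
have : 0 <= \int[leb]_x f x by exact: Rintegral_ge0.
rewrite le_eqVlt => /predU1P[e|//]; exfalso; apply: nz.
have mf : measurable_fun setT (EFin \o f) by case/integrableP: fi.
have /(ae_eq_integral_abs leb measurableT mf) : (\int[leb]_x `|(EFin \o f) x|)%E = 0%E.
  rewrite (eq_integral (fun x => (f x)%:E)); last first.
    by move=> x _; rewrite /= ger0_norm.
  by rewrite -[LHS](fineK If); congr EFin; exact: esym e.
move=> H; near=> x.
have fx : (EFin \o f) x = cst 0%E x by near: x; apply: filterS H => x; exact.
have H2 : f x = 0 -> u x = 0 by near: x; exact: fu.
by apply: H2; case: fx.
Unshelve. all: by end_near. Qed.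

Lemma normp_p_gt0 (u : T -> R) p : p != 0 -> ~ {ae leb, forall x, u x = 0} ->
  leb.-integrable setT (EFin \o (fun x => `|u x| `^ p)) -> 0 < normp_p p u.
Proof.
move=> p0 nz ip; apply: (Rintegral_gt0 ip _ nz) => [x|]; first exact: powR_ge0.
by apply: aeW => x /powR_eq0_eq0 /normr0_eq0.
Qed.

Lemma normqa_q_gt0 (a b u : T -> R) q : {ae leb, forall x, a x = b x} ->
  (forall x, 0 <= b x) -> {ae leb, forall x, 0 < a x} ->
  ~ {ae leb, forall x, u x = 0} ->
  leb.-integrable setT (EFin \o (fun x => b x * `|u x| `^ q)) ->
  0 < normqa_q a q u.
Proof.
move=> ab b0 a0 nz iq.
have -> : normqa_q a q u = \int[leb]_x (b x * `|u x| `^ q).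
  by apply: ae_eq_RintegralT; apply: filterS ab => x ->.
apply: (Rintegral_gt0 iq _ nz) => [x|]; first by rewrite mulr_ge0 ?powR_ge0.
near=> x.
have bx : b x != 0.
  have <- : a x = b x by near: x.
  by rewrite gt_eqF//; near: x.
by move=> /eqP; rewrite mulf_eq0 (negbTE bx)/= => /eqP /powR_eq0_eq0 /normr0_eq0.
Unshelve. all: by end_near. Qed.

Lemma energy_part_Phi_gt0 u : Xnonzero s phi V u -> 0 < EP (Phi phi) u 1.
Proof.
move=> [Xu nz].
have ell0 : 0 <= ell by have := yp_ell yp; lra.
have homoP := growth_nneg_homo ell0 (Phi0 phi) (yp_Phi yp).
have V_gt0 x : 0 < V x by exact: lt_le_trans (VV0 x).
have V_ge0 x : 0 <= V x by exact: ltW.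
have /(XspaceP s yp mV V00 VV0)[mu _ fin1] := Xu.
have iV := modular_integrable V_ge0 (absf_ge0 u) mV (measurable_absf mu) homoP
    (Phi0 phi) ler01 fin1.
apply: ltr_wpDl.
  apply: Rintegral_ge0 => z _.
  by rewrite mulr_ge0 ?nu_density_ge0// -(Phi0 phi) homoP// mulr_ge0// absDs_ge0.
apply: (Rintegral_gt0 iV _ nz) => [x|].
  by rewrite mulr_ge0// -(Phi0 phi) homoP// mulr_ge0// absf_ge0.
apply: aeW => x /eqP; rewrite mulf_eq0 (gt_eqF (V_gt0 x)) orbF mul1r => /eqP e.
apply: contrapT => /eqP u0.
have : 0 < absf u x by rewrite normr_gt0.
by move/(yp_gt0 yp); rewrite e ltxx.
Qed.

End positivity.

Section bounded_near.
Context {R : realType} (N : nat).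
Local Notation T := (Rtuple R N).

Lemma Rcontinuous_cube (F : T -> R) : Rcontinuous F ->
  exists o c M, 0 < c <= 1 /\ forall x, mdist x o <= c -> F x <= M.
Proof.
move=> cF.
pose row_to (r : 'rV[R]_N) : T := [tuple (r ord0 i : measurableTypeR R) | i < N].
pose o : T := row_to 0.
have : \forall r \near nbhs (0 : 'rV[R]_N), F (row_to r) < F o + 1.
  by apply: (cvgr_lt (F o) (cF 0)); rewrite ltrDl.
move=> /nbhs_ballP[e /= e0 H].
have e0' : 0 < e := e0.
have c0 : 0 < Num.min 1 (e / 2) by rewrite lt_min ltr01 divr_gt0.
exists o, (Num.min 1 (e / 2)), (F o + 1); split.
  by rewrite c0 ge_min lexx.
move=> x /mdist_leP-/(_ (ltW c0)) xo.
have xE : x = row_to (\row_i (tnth x i : R)).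
  by apply: eq_from_tnth => i; rewrite tnth_mktuple mxE.
rewrite xE; apply/ltW/H; split => // i j.
rewrite /ball/= !mxE sub0r normrN.
have := xo j; rewrite /o tnth_mktuple mxE subr0 => /le_lt_trans; apply.
by rewrite gt_min; apply/orP; right; rewrite ltr_pdivrMr// ltr_pMr// ltr1n.
Qed.

End bounded_near.

(** * Asymptotics in the parameter *)

Section asymptotics.
Context {R : realType} {N : nat} (s : R) (phi : R -> R)
  (V a b : Rtuple R N -> R) (ell m V0 q p lambda : R).
Hypothesis yp : young_pair phi ell m.
Hypothesis mV : measurable_fun setT V.
Hypothesis V00 : 0 < V0.
Hypothesis VV0 : forall x, V0 <= V x.
Hypothesis ab : {ae lebesgue_tuple R N, forall x, a x = b x}.
Hypothesis mb : measurable_fun setT b.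
Hypothesis b0 : forall x, 0 <= b x.
Hypothesis a0 : {ae lebesgue_tuple R N, forall x, 0 < a x}.
Hypotheses (mq : m < q) (qp : q < p) (lambda0 : 0 < lambda).
Local Notation T := (Rtuple R N).
Local Notation leb := (lebesgue_tuple R N).
Local Notation X := (Xspace s phi V).
Local Notation EP := (energy_part s V).
Hypothesis ib : leb.-integrable setT (EFin \o (fun x => b x `^ (p / (p - q)))).
Variable u0 : T -> R.
Hypothesis nz0 : Xnonzero s phi V u0.
Hypothesis iu0 : leb.-integrable setT (EFin \o (fun x => `|u0 x| `^ p)).

Let q1 : 1 < q.
Proof. exact: lt_trans (lt_le_trans (yp_ell yp) (yp_m yp)) mq. Qed.

Let p1 : 1 < p. Proof. exact: lt_trans q1 qp. Qed.

Let Xu0 : X u0. Proof. by case: nz0. Qed.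

Let A := EP (Gphi phi) u0.
Let B := EP (Phi phi) u0.
Let P := normp_p p u0.
Let Q := normqa_q a q u0.

Let P0 : 0 < P.
Proof.
apply: normp_p_gt0 => //; first by rewrite gt_eqF// (lt_trans ltr01 p1).
by case: nz0.
Qed.

Let Q0 : 0 < Q.
Proof.
have [[[[mu _] _] _] nz] := nz0.
exact: (normqa_q_gt0 ab b0 a0 nz
  (weighted_powR_integrable yp mb b0 mq qp lambda0 ib mu iu0)).
Qed.

Let gA : growth ell m A := growth_energy_part_G yp mV V00 VV0 Xu0.

Let gB : growth ell m B := growth_energy_part_Phi yp mV V00 VV0 Xu0.

Let BA t : 0 < t -> ell * B t <= A t.
Proof. by move=> t0; have /andP[] := energy_part_PhiG yp mV V00 VV0 Xu0 t0. Qed.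

Let A1 : 0 < A 1.
Proof.
apply: lt_le_trans (BA ltr01); rewrite mulr_gt0//.
  exact: lt_trans (yp_ell yp).
exact: (energy_part_Phi_gt0 yp mV V00 VV0 nz0).
Qed.

(** The threshold is finite because the space contains a nonzero function; this is
    what makes the hypotheses on the minimizers apply for large [mu]. *)
Lemma mu_n_lty : exists M, forall mu, M < mu ->
  (mu_n s phi V a q p lambda < mu%:E)%E.
Proof.
exists (Rn s phi V a q p lambda (fun x => 1 * u0 x)) => mu Mmu.
apply: (@le_lt_trans _ _ (Rn s phi V a q p lambda (fun x => 1 * u0 x))%:E); last first.
  by rewrite lte_fin.
apply: (@le_trans _ _ (ereal_inf [set (Rn s phi V a q p lambda (fun x => t * u0 x))%:E
    | t in [set t : R | 0 < t]])).
  by apply: ereal_inf_lbound; exists u0.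
by apply: ereal_inf_lbound; exists 1 => //=; exact: ltr01.
Qed.

(** The points of the ray given by [fiber_root_small] have energy at most
    [B t + lambda / p * t ^ p * P], which vanishes with [t]. *)
Lemma Eminus_upper e : 0 < e -> exists M, forall mu, M < mu ->
  (Eminus s phi V a q p lambda mu <= e%:E)%E.
Proof.
move=> e0.
have ell0 : 0 < ell by exact: lt_trans (yp_ell yp).
have p0 : 0 < p by exact: lt_trans p1.
have q0 : 0 < q by exact: lt_trans q1.
pose K := B 1 + lambda / p * P.
have K0 : 0 < K.
  rewrite addr_gt0 ?(energy_part_Phi_gt0 yp mV V00 VV0 nz0)//.
  by rewrite mulr_gt0// divr_gt0.
have eK : 0 < e / K by rewrite divr_gt0.
have [d /andP[d0 d1] Hd] := powR_small ell0 eK.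
have [M HM] := fiber_root_small mq qp lambda0 P0 Q0 gA A1 d0.
exists (Num.max 0 M) => mu; rewrite gt_max => /andP[mu0 /HM[t [/andP[t0 td] eqt dt]]].
have [nt d2] := nehari_ray yp mV V00 VV0 ab mb b0 q1 p1 nz0 t0 eqt.
apply: (@le_trans _ _ (energy s phi V a q p lambda mu (fun x => t * u0 x))%:E).
  apply: ereal_inf_lbound; exists (fun x => t * u0 x) => //.
  by split; [exact: nt|rewrite d2; exact: dt].
rewrite lee_fin (energy_ray q p yp mV V00 VV0 ab mb b0 lambda mu Xu0 t0).
have t1 : 0 < t <= 1 by rewrite t0 (le_trans td).
have Bt : B t <= t `^ ell * B 1.
  by have := growth_scale_le1 gB t1 ltr01; rewrite mulr1 => /andP[].
have tp : t `^ p <= t `^ ell.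
  apply: (ger_powR t1).
  by apply: ltW; apply: (le_lt_trans (yp_m yp)); exact: lt_trans qp.
have muq : 0 <= mu / q * (t `^ q * Q).
  by rewrite mulr_ge0 ?divr_ge0 ?(ltW mu0) ?(ltW q0)// mulr_ge0 ?powR_ge0// ltW.
apply: (@le_trans _ _ (t `^ ell * K)); last first.
  by rewrite -ler_pdivlMr// Hd.
rewrite -/A -/B -/P -/Q /K mulrDr; apply: lerD.
  by apply: le_trans Bt; rewrite gerBl.
rewrite (mulrCA (t `^ ell)) ler_wpM2l ?divr_ge0 ?(ltW lambda0) ?(ltW p0)//.
by rewrite ler_wpM2r// ltW.
Qed.

Lemma Eplus_upper : exists M c, 0 < c /\ forall mu, M < mu ->
  (Eplus s phi V a q p lambda mu <= (- c * mu `^ (p / (p - q)))%:E)%E.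
Proof.
have [M [c [c0 H]]] :=
  fiber_root_large (yp_ell yp) (yp_m yp) mq qp lambda0 P0 Q0 gA BA.
exists M, c; split => // mu /H[t [t0 eqt dt en]].
have [nt d2] := nehari_ray yp mV V00 VV0 ab mb b0 q1 p1 nz0 t0 eqt.
apply: (@le_trans _ _ (energy s phi V a q p lambda mu (fun x => t * u0 x))%:E).
  apply: ereal_inf_lbound; exists (fun x => t * u0 x) => //.
  by split; [exact: nt|rewrite d2; exact: dt].
by rewrite lee_fin (energy_ray q p yp mV V00 VV0 ab mb b0 lambda mu Xu0 t0).
Qed.

Section minus.
Hypothesis hc : m * (q - ell) < p * (q - m).
Variable u : R -> T -> R.
Hypothesis hu : forall mu : R, (mu_n s phi V a q p lambda < mu%:E)%E ->
  [/\ nehari_minus s phi V a q p lambda mu (u mu),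
      weak_solution s phi V a q p lambda mu (u mu) &
      (energy s phi V a q p lambda mu (u mu))%:E
        = Eminus s phi V a q p lambda mu].

Let k := (p * (q - m) - m * (q - ell)) / (p * q).

Let k0 : 0 < k.
Proof.
by rewrite divr_gt0 ?subr_gt0// mulr_gt0 ?(lt_trans ltr01 p1) ?(lt_trans ltr01 q1).
Qed.

Let minus_bound : exists M, forall mu, M < mu ->
  X (u mu) /\ k * EP (Phi phi) (u mu) 1 <= energy s phi V a q p lambda mu (u mu).
Proof.
have [M HM] := mu_n_lty; exists M => mu /HM/hu[nm _ _].
have [[[Xu _] _] _] := nm; split; first exact: Xu.
exact: (nehari_minus_coercive yp mV V00 VV0 ab mb b0 mq qp nm).
Qed.

Let energy_small e : 0 < e -> exists M, forall mu, M < mu ->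
  energy s phi V a q p lambda mu (u mu) <= e.
Proof.
move=> e0; have [M1 H1] := mu_n_lty; have [M2 H2] := Eminus_upper e0.
exists (Num.max M1 M2) => mu; rewrite gt_max => /andP[/H1/hu[_ _ E] /H2].
by rewrite -E lee_fin.
Qed.

Lemma Xnorm_minus_cvg0 : Xnorm s phi V (u mu) @[mu --> +oo%R] --> (0 : R).
Proof.
apply/cvgrPdist_le => e e0.
pose e' := Num.min e 1.
have e'01 : 0 < e' <= 1 by rewrite lt_min e0 ltr01 ge_min lexx orbT.
have /andP[e'0 _] := e'01.
have ke : 0 < k * e' `^ m by rewrite mulr_gt0// powR_gt0.
have [M1 H1] := minus_bound; have [M2 H2] := energy_small ke.
near=> mu.
have /H1[Xu c] : M1 < mu by near: mu; apply: nbhs_pinfty_gt; exact: num_real.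
have /H2 le : M2 < mu by near: mu; apply: nbhs_pinfty_gt; exact: num_real.
rewrite sub0r normrN ger0_norm ?Xnorm_ge0//.
apply: (@le_trans _ _ e'); last by rewrite ge_min lexx.
apply: (Xnorm_le yp mV V00 VV0 Xu e'01).
by rewrite -(ler_pM2l k0); exact: le_trans le.
Unshelve. all: by end_near. Qed.

Lemma Eminus_cvg0 : Eminus s phi V a q p lambda mu @[mu --> +oo%R] --> 0%E.
Proof.
have cE : energy s phi V a q p lambda mu (u mu) @[mu --> +oo%R] --> (0 : R).
  apply/cvgrPdist_le => e e0.
  have [M1 H1] := minus_bound; have [M2 H2] := energy_small e0.
  near=> mu.
  have /H1[Xu c] : M1 < mu by near: mu; apply: nbhs_pinfty_gt; exact: num_real.
  have /H2 le : M2 < mu by near: mu; apply: nbhs_pinfty_gt; exact: num_real.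
  have [EP0 _ _] := growth_energy_part_Phi yp mV V00 VV0 Xu ltr01.
  rewrite sub0r normrN ger0_norm// (le_trans _ c)// mulr_ge0// ltW//.
have [M HM] := mu_n_lty.
have : (energy s phi V a q p lambda mu (u mu))%:E @[mu --> +oo%R] --> 0%:E.
  by apply: cvg_EFin => //; exact: nearW.
apply: cvg_trans; apply: near_eq_cvg; near=> mu.
have /HM/hu[_ _ E] : M < mu by near: mu; apply: nbhs_pinfty_gt; exact: num_real.
by rewrite E.
Unshelve. all: by end_near. Qed.

End minus.

Section plus.
Variable v : R -> T -> R.
Hypothesis hv : forall mu : R, (mu_n s phi V a q p lambda < mu%:E)%E ->
  [/\ nehari_plus s phi V a q p lambda mu (v mu),
      weak_solution s phi V a q p lambda mu (v mu) &
      (energy s phi V a q p lambda mu (v mu))%:E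
        = Eplus s phi V a q p lambda mu].

Lemma Xnorm_plus_cvgy : Xnorm s phi V (v mu) @[mu --> +oo%R] --> +oo%R.
Proof.
apply/cvgryPge => K'.
pose K := Num.max 1 K'.
have K1 : 1 <= K by rewrite le_max lexx.
have [M1 H1] := mu_n_lty.
have [M2 [c [c0 H2]]] := Eplus_upper.
have [d [e [d0 e0 H3]]] :=
  nehari_plus_modular s yp mV V00 VV0 ab mb b0 mq qp lambda0 ib c0.
have ell0 : 0 < ell by exact: lt_trans (yp_ell yp).
have Phi1 := yp_gt0 yp ltr01.
have [D D1 HD] := powR_large ((K `^ m + 1) / (e * Phi phi 1)) ell0.
have pq0 : 0 < (p - q)^-1 by rewrite invr_gt0 subr_gt0.
have [L L1 HL] := powR_large (D / d) pq0.
near=> mu.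
have mL : L <= mu by near: mu; apply: nbhs_pinfty_ge; exact: num_real.
have mu0 : 0 < mu by apply: lt_le_trans mL; exact: lt_le_trans L1.
have /H1/hv[[[[Xv _] dv] _] _ E] : M1 < mu.
  by near: mu; apply: nbhs_pinfty_gt; exact: num_real.
have : M2 < mu by near: mu; apply: nbhs_pinfty_gt; exact: num_real.
move=> /H2; rewrite -E lee_fin => en.
have low := H3 mu (v mu) mu0 Xv dv en.
apply: (@le_trans _ _ K); first by rewrite le_max lexx orbT.
apply: (Xnorm_ge yp mV V00 VV0 Xv K1); apply: lt_le_trans low.
set tau := d * _.
have Dtau : D <= tau by rewrite -ler_pdivrMl// mulrC; exact: HL.
have tau1 : 1 <= tau by exact: le_trans Dtau.
have /andP[low _] := growth_scale_ge1 (yp_Phi yp) tau1 ltr01.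
rewrite mulr1 in low.
apply: (@lt_le_trans _ _ (K `^ m + 1)); first by rewrite ltrDl.
apply: (@le_trans _ _ (e * (tau `^ ell * Phi phi 1))); last by rewrite ler_pM2l.
rewrite mulrCA -ler_pdivrMr ?mulr_gt0//.
exact: HD.
Unshelve. all: by end_near. Qed.

End plus.

End asymptotics.

(** Passing to the Borel representative [b] of [a]. *)
Lemma finite_norm_integrable (R : realType) (N : nat) (r : R) (a b : Rtuple R N -> R) :
  0 < r -> {ae lebesgue_tuple R N, forall x, a x = b x} ->
  measurable_fun setT b -> (forall x, 0 <= b x) ->
  finite_norm (lebesgue_tuple R N) r%:E a ->
  (lebesgue_tuple R N).-integrable setT (EFin \o (fun x => b x `^ r)).
Proof.
move=> r0 ab mb b0 fa.
have mbr : measurable_fun setT (fun x => b x `^ r).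
  exact: (measurableT_comp (measurable_powR r)).
apply/integrableP; split; first exact/measurable_EFinP.
have := poweR_lty r fa; rewrite powR_Lnorm ?gt_eqF//.
congr (_ < _)%E; apply: ae_eq_integralT; apply: filterS ab => x abx.
by rewrite /= abx !ger0_norm ?powR_ge0// poweR_EFin.
Qed.

Theorem proposition5p4 (R : realType) (N : nat) (s : R) (phi : R -> R)
    (ell m q p : R) (a V : Rtuple R N -> R) (V0 lambda : R)
    (u v : R -> Rtuple R N -> R) :
  let g := fun t : R => t * phi t in
  (1 <= N)%N ->
  0 < s < 1 ->
  (forall t : R, 0 < t -> 0 < phi t) ->
  (forall t : R, 0 < t -> derivable phi t 1 /\ {for t, continuous (derive1 phi)}) ->
  (forall t : R, 0 < t -> derivable g t 1 /\ derivable (derive1 g) t 1) ->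
  g t @[t --> 0^'+] --> (0 : R) ->
  g t @[t --> +oo%R] --> +oo%R ->
  (forall t1 t2 : R, 0 < t1 -> t1 < t2 -> g t1 < g t2) ->
  (* the quotients (t phi(t))'' t / (t phi(t))' are well defined *)
  (forall t : R, 0 < t -> derive1 g t != 0) ->
  -1 < ell - 2 ->
  ereal_inf [set (derive1 (derive1 g) t * t / derive1 g t)%:E | t in [set t : R | 0 < t]]
    = (ell - 2)%:E ->
  ereal_sup [set (derive1 (derive1 g) t * t / derive1 g t)%:E | t in [set t : R | 0 < t]]
    = (m - 2)%:E ->
  (\int[lebesgue_measure]_(t in `]0%R, 1%R[)
      ((t / Phi phi t) `^ (s / (N%:R - s)))%:E < +oo)%E ->
  (\int[lebesgue_measure]_(t in `]1%R, +oo[)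
      ((t / Phi phi t) `^ (s / (N%:R - s)))%:E = +oo)%E ->
  ell <= m -> m < q -> q < p -> p < N%:R * ell / (N%:R - ell * s) ->
  m * (q - ell) < p * (q - m) ->
  lebesgue_measurable_fun a ->
  finite_norm (lebesgue_tuple R N) (p / (p - q))%:E a ->
  {ae lebesgue_tuple R N, forall x, 0 < a x} ->
  Rcontinuous V ->
  0 < V0 ->
  (forall x, V0 <= V x) ->
  (forall M : R, 0 < M -> (lebesgue_tuple R N [set x | (V x <= M)%R] < +oo)%E) ->
  0 < lambda ->
  (forall mu : R, (mu_n s phi V a q p lambda < mu%:E)%E ->
    [/\ nehari_minus s phi V a q p lambda mu (u mu),
        weak_solution s phi V a q p lambda mu (u mu) &
        (energy s phi V a q p lambda mu (u mu))%:E
          = Eminus s phi V a q p lambda mu]) ->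
  (forall mu : R, (mu_n s phi V a q p lambda < mu%:E)%E ->
    [/\ nehari_plus s phi V a q p lambda mu (v mu),
        weak_solution s phi V a q p lambda mu (v mu) &
        (energy s phi V a q p lambda mu (v mu))%:E
          = Eplus s phi V a q p lambda mu]) ->
  [/\ Xnorm s phi V (u mu) @[mu --> +oo%R] --> (0 : R),
      Eminus s phi V a q p lambda mu @[mu --> +oo%R] --> 0%E &
      Xnorm s phi V (v mu) @[mu --> +oo%R] --> +oo%R].
Proof.
move=> g _ s01 phi0 _ dg g0 _ hg g'0 ell1 infE supE _ _ ellm mq qp _ hc
  [a' ma' aa'] fa a0 cV V00 VV0 _ lambda0 hu hv.
have yp : young_pair phi ell m by exact: (young_pair_of_quotient_bounds phi0 dg g0 hg g'0).
have mV := Rcontinuous_measurable cV.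
(* A nonnegative Borel representative of the weight. *)
pose b x := Num.max 0 (a' x).
have ab : {ae lebesgue_tuple R N, forall x, a x = b x}.
  near=> x.
  have ax : 0 < a x by near: x.
  have e : a x = a' x by near: x.
  by rewrite /b -e max_r// ltW.
have mb : measurable_fun setT b by exact: measurable_maxr.
have bge0 x : 0 <= b x by rewrite le_max lexx.
have q1 : 1 < q by exact: lt_trans (lt_le_trans (yp_ell yp) ellm) mq.
have p0 : 0 < p by exact: lt_trans ltr01 (lt_trans q1 qp).
have r0 : 0 < p / (p - q) by rewrite divr_gt0// subr_gt0.
have intb := finite_norm_integrable r0 ab mb bge0 fa.
have [x0 [c [M [c01 VM]]]] := Rcontinuous_cube cV.
have nz0 := tent_Xnonzero s01 yp mV V00 VV0 c01 VM.
have iu0 := tent_powR_integrable x0 c01 p0.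
split.
- exact: (Xnorm_minus_cvg0 yp mV V00 VV0 ab mb bge0 a0 mq qp lambda0 intb nz0 iu0 hc hu).
- exact: (Eminus_cvg0 yp mV V00 VV0 ab mb bge0 a0 mq qp lambda0 intb nz0 iu0 hc hu).
- exact: (Xnorm_plus_cvgy yp mV V00 VV0 ab mb bge0 a0 mq qp lambda0 intb nz0 iu0 hv).
Unshelve. all: by end_near. Qed.
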